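(* Let $\mathcal W$ be the class of $C^*$-algebras $D$ such that $W(D)$ is almost unperforated. Let $A$ be a simple $C^*$-algebra which is essentially tracially in $\mathcal W$. Then $A\in\mathcal W$, i.e. $W(A)$ is almost unperforated.
   Context: **Cuntz semigroup.** For a $C^*$-algebra $A$ let $M_\infty(A)_+=\bigcup_nM_n(A)_+$, identifying $x\in M_n(A)$ with $\mathrm{diag}(x,0)\in M_{n+m}(A)$. For $a,b\in M_n(A)_+$, $a\lesssim b$ means there are $x_i\in M_n(A)$ with $\|a-x_i^*bx_i\|\to0$; $a\sim b$ means $a\lesssim b$ and $b\lesssim a$. $W(A)=M_\infty(A)_+/\sim$, with classes $\langle a\rangle$, addition induced by $a\oplus b=\mathrm{diag}(a,b)$, and order $\langle a\rangle\le\langle b\rangle$ iff $a\lesssim b$. $W(A)$ is almost unperforated if for all $\langle a\rangle,\langle b\rangle\in W(A)$ and $k\in\mathbb N$, $(k+1)\langle a\rangle\le k\langle b\rangle$ implies $\langle a\rangle\le\langle b\rangle$. **Essential tracial approximation.** $A_+^1$ is the set of positive elements of norm $\le1$; $a\in_\varepsilon S$ means $\|a-x\|<\varepsilon$ for some $x\in S$. Let $\mathcal P$ be a class of $C^*$-algebras. A simple $C^*$-algebra $A$ is *essentially tracially in* $\mathcal P$ if for any finite $\mathcal F\subset A$, $\varepsilon>0$ and $s\in A_+\setminus\{0\}$ there are $e\in A_+^1$ and a nonzero $C^*$-subalgebra $B\subset A$ with $B\in\mathcal P$ such that (1) $\|ex-xe\|<\varepsilon$ for all $x\in\mathcal F$;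 (2) $(1-e)x\in_\varepsilon B$ and $\|(1-e)x\|\ge\|x\|-\varepsilon$ for all $x\in\mathcal F$; (3) $e\lesssim s$. (Here $1$ is the unit of $A$, or of the unitization if $A$ is non-unital.) *)

(* Defs.v *)
From HB Require Import structures.
From mathcomp Require Import all_boot all_order all_algebra.
From mathcomp Require Import complex.
From mathcomp Require Import all_classical all_reals all_analysis.

Set Implicit Arguments.
Unset Strict Implicit.
Unset Printing Implicit Defensive.

Import Order.TTheory GRing.Theory Num.Theory.
Import numFieldNormedType.Exports.

Local Open Scope classical_set_scope.
Local Open Scope complex_scope.
Local Open Scope ring_scope.

(* C*-algebras, not necessarily unital. The multiplication is a field of the
   structure because the ring structures of the library have a unit. *)
HB.mixin Record CompleteNormedModule_isCStarAlgebra (R : realType) A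
    & CompleteNormedModule R[i] A := {
  cmul : A -> A -> A;
  cstar : A -> A;
  cmulA : associative cmul;
  cmulDl : left_distributive cmul +%R;
  cmulDr : right_distributive cmul +%R;
  cmulZl : forall (k : R[i]) (x y : A), cmul (k *: x) y = k *: cmul x y;
  cmulZr : forall (k : R[i]) (x y : A), cmul x (k *: y) = k *: cmul x y;
  cstarD : {morph cstar : x y / x + y};
  cstarZ : forall (k : R[i]) (x : A), cstar (k *: x) = k^* *: cstar x;
  cstarK : involutive cstar;
  cstarM : forall x y : A, cstar (cmul x y) = cmul (cstar y) (cstar x);
  cnormM : forall x y : A, `|cmul x y| <= `|x| * `|y|;
  cnorm_star : forall x : A, `|cmul (cstar x) x| = `|x| ^+ 2 }.

#[short(type="cstarAlgType")]
HB.structure Definition CStarAlgebra (R : realType) :=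
  {A of CompleteNormedModule_isCStarAlgebra R A & CompleteNormedModule R[i] A}.

Notation "x *c y" := (cmul x y) (at level 40, left associativity).
Notation "x ^c*" := (cstar x) (at level 2, format "x ^c*").

Record cstarSubalg (R : realType) (A : cstarAlgType R) := CStarSubalg {
  subalg_set :> set A;
  subalg0 : subalg_set 0;
  subalgD : forall x y, subalg_set x -> subalg_set y -> subalg_set (x + y);
  subalgZ : forall (k : R[i]) x, subalg_set x -> subalg_set (k *: x);
  subalgM : forall x y, subalg_set x -> subalg_set y -> subalg_set (x *c y);
  subalg_star : forall x, subalg_set x -> subalg_set x^c*;
  subalg_closed : closed subalg_set }.

Definition subalg_pred (R : realType) (A : cstarAlgType R) (B : cstarSubalg A)
  : {pred A} := mem (subalg_set B).

Record subalgType (R : realType) (A : cstarAlgType R) (B : cstarSubalg A) :=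
  SubalgElt { subalg_val : A; subalg_valP : subalg_val \in subalg_pred B }.

Section subalg_structure.
Context (R : realType) (A : cstarAlgType R) (B : cstarSubalg A).

Let memB x : (x \in subalg_pred B) = (x \in subalg_set B).
Proof. by []. Qed.

Lemma subalg_submod_closed : submod_closed (subalg_pred B).
Proof.
split; first by rewrite memB; apply/mem_set/subalg0.
move=> k x y; rewrite !memB => /set_mem Bx /set_mem By.
by apply/mem_set/subalgD => //; exact: subalgZ.
Qed.

HB.instance Definition _ :=
  GRing.isSubmodClosed.Build R[i] A (subalg_pred B) subalg_submod_closed.
HB.instance Definition _ := [isSub for @subalg_val R A B].
HB.instance Definition _ := [Choice of subalgType B by <:].
HB.instance Definition _ := [SubChoice_isSubLmodule of subalgType B by <:].

Let bnorm (x : subalgType B) : R[i] := `|subalg_val x|.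

Let bnormD x y : bnorm (x + y) <= bnorm x + bnorm y.
Proof. exact: ler_normD. Qed.

Let bnormZ (k : R[i]) x : bnorm (k *: x) = `|k| * bnorm x.
Proof. exact: normrZ. Qed.

Let bnorm0 x : bnorm x = 0 -> x = 0.
Proof. by move/normr0_eq0 => x0; apply/val_inj. Qed.

HB.instance Definition _ :=
  Lmodule_isNormed.Build R[i] (subalgType B) bnormD bnormZ bnorm0.

Let subalg_complete (F : set_system (subalgType B)) :
  ProperFilter F -> cauchy F -> cvg F.
Proof.
move=> FF /cauchyP Fc.
pose G := (@subalg_val R A B) @ F.
have Gc : cauchy G.
  apply/cauchyP => e e0; have [x Fx] := Fc e e0.
  by exists (subalg_val x); move: Fx; rewrite -!ball_normE.
have /cvg_ex[l Gl] : cvg G by exact: cauchy_cvg.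
have Bl : subalg_set B l.
  have := @closed_cvg _ _ F _ (@subalg_val R A B) (subalg_set B)
            (subalg_closed (c := B)); apply; last exact: Gl.
  by apply: filterE => x; apply/set_mem; exact: subalg_valP.
have Bl' : l \in subalg_pred B by exact/mem_set.
apply/cvg_ex; exists (SubalgElt Bl').
apply/cvgrPdist_lt => e e0.
by move/cvgrPdist_lt : Gl => /(_ e e0).
Qed.

HB.instance Definition _ :=
  Uniform_isComplete.Build (subalgType B) subalg_complete.

Lemma subalg_mulP (x y : subalgType B) :
  subalg_val x *c subalg_val y \in subalg_pred B.
Proof. by apply/mem_set/subalgM; apply/set_mem; exact: subalg_valP. Qed.

Lemma subalg_starP (x : subalgType B) : (subalg_val x)^c* \in subalg_pred B.
Proof. by apply/mem_set/subalg_star/set_mem; exact: subalg_valP. Qed.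

Let bmul x y : subalgType B := SubalgElt (subalg_mulP x y).
Let bstar x : subalgType B := SubalgElt (subalg_starP x).

Let bmulA : associative bmul.
Proof. by move=> x y z; apply/val_inj/cmulA. Qed.

Let bmulDl : left_distributive bmul +%R.
Proof. by move=> x y z; apply/val_inj/cmulDl. Qed.

Let bmulDr : right_distributive bmul +%R.
Proof. by move=> x y z; apply/val_inj/cmulDr. Qed.

Let bmulZl (k : R[i]) x y : bmul (k *: x) y = k *: bmul x y.
Proof. exact/val_inj/cmulZl. Qed.

Let bmulZr (k : R[i]) x y : bmul x (k *: y) = k *: bmul x y.
Proof. exact/val_inj/cmulZr. Qed.

Let bstarD : {morph bstar : x y / x + y}.
Proof. by move=> x y; apply/val_inj/cstarD. Qed.

Let bstarZ (k : R[i]) x : bstar (k *: x) = k^* *: bstar x.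
Proof. exact/val_inj/cstarZ. Qed.

Let bstarK : involutive bstar.
Proof. by move=> x; apply/val_inj/cstarK. Qed.

Let bstarM x y : bstar (bmul x y) = bmul (bstar y) (bstar x).
Proof. exact/val_inj/cstarM. Qed.

Let bnormM (x y : subalgType B) : `|bmul x y| <= `|x| * `|y|.
Proof. exact: cnormM. Qed.

Let bnorm_star (x : subalgType B) : `|bmul (bstar x) x| = `|x| ^+ 2.
Proof. exact: cnorm_star. Qed.

HB.instance Definition _ :=
  CompleteNormedModule_isCStarAlgebra.Build R (subalgType B)
    bmulA bmulDl bmulDr bmulZl bmulZr bstarD bstarZ bstarK bstarM
    bnormM bnorm_star.

End subalg_structure.

Section matrix_amplifications.
Context (R : realType) (A : cstarAlgType R).

Definition rnorm (x : A) : R := complex.Re `|x|.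

Definition cpos (x : A) : Prop := exists y : A, x = y^c* *c y.

Definition cmulmx m n p (X : 'M[A]_(m, n)) (Y : 'M[A]_(n, p)) : 'M[A]_(m, p) :=
  \matrix_(i, j) \sum_k X i k *c Y k j.

Definition cstarmx m n (X : 'M[A]_(m, n)) : 'M[A]_(n, m) :=
  \matrix_(i, j) (X j i)^c*.

Definition cposmx n (X : 'M[A]_n) : Prop :=
  exists Y : 'M[A]_n, X = cmulmx (cstarmx Y) Y.

(* Columns form the Hilbert A-module A^n, with A-valued inner product v^* w. *)
Definition colnorm n (v : 'M[A]_(n, 1)) : R :=
  Num.sqrt (rnorm (cmulmx (cstarmx v) v ord0 ord0)).

(* The C*-norm of M_n(A): M_n(A) acts faithfully on the Hilbert module A^n by
   adjointable operators, and this is the operator norm of that action. The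
   canonical norm of the library on matrices is the maximum of the norms of the
   entries, which is not a C*-norm. *)
Definition mxnorm n (X : 'M[A]_n) : R :=
  sup [set colnorm (cmulmx X v) | v in [set v | colnorm v <= 1]].

Definition cuntz_submx n (a b : 'M[A]_n) : Prop :=
  exists x : nat -> 'M[A]_n,
    (fun i => mxnorm (a - cmulmx (cstarmx (x i)) (cmulmx b (x i)))) @ \oo
      --> (0 : R).

(* Representatives of elements of M_oo(A)_+. X and diag(X, 0) are distinct here;
   cuntz_le compares matrices after padding them with zeros to a common size, so
   that they have the same class in W(A). *)
Record Moopos := MkMoopos {
  Moo_dim : nat;
  Moo_mx : 'M[A]_Moo_dim;
  Moo_mxP : cposmx Moo_mx }.

(* The matrix diag(X, 0) of size N, for n <= N. *)
Definition padmx n N (X : 'M[A]_n) : 'M[A]_N :=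
  \matrix_(i, j) if (insub (i : nat), insub (j : nat)) is (Some i', Some j')
                 then X i' j' else 0.

Definition cuntz_le (a b : Moopos) : Prop :=
  let N := maxn (Moo_dim a) (Moo_dim b) in
  cuntz_submx (padmx N (Moo_mx a)) (padmx N (Moo_mx b)).

Definition cuntz_eq (a b : Moopos) : Prop := cuntz_le a b /\ cuntz_le b a.

Lemma cposmx_dsum m n (X : 'M[A]_m) (Y : 'M[A]_n) :
  cposmx X -> cposmx Y -> cposmx (block_mx X 0 0 Y).
Proof.
have star0 : (0 : A)^c* = 0 by have := cstarZ 0 (0 : A); rewrite conjC0 !scale0r.
have mul0 (x : A) : 0 *c x = 0 by have := cmulZl 0 0 x; rewrite !scale0r.
have mulr0 (x : A) : x *c 0 = 0 by have := cmulZr 0 x 0; rewrite !scale0r.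
have mx0 p q i j : (0 : 'M[A]_(p, q)) i j = 0 by rewrite mxE.
move=> [X' ->] [Y' ->]; exists (block_mx X' 0 0 Y').
apply/matrixP => i j; rewrite [RHS]mxE big_split_ord /=.
under eq_bigr => k _ do rewrite mxE.
under [X in _ = _ + X]eq_bigr => k _ do rewrite mxE.
case: (split_ordP i) => i' ->; case: (split_ordP j) => j' ->.
- rewrite block_mxEul mxE [X in _ = _ + X]big1 ?addr0; last first.
    by move=> k _; rewrite block_mxEdl mxE star0 mul0.
  by apply: eq_bigr => k _; rewrite !block_mxEul mxE.
- rewrite block_mxEur mxE !big1 ?addr0// => k _;
    by rewrite ?(block_mxEul, block_mxEur, block_mxEdl, block_mxEdr) !mx0
               ?star0 ?mul0 ?mulr0.
- rewrite block_mxEdl mxE !big1 ?addr0// => k _;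
    by rewrite ?(block_mxEul, block_mxEur, block_mxEdl, block_mxEdr) !mx0
               ?star0 ?mul0 ?mulr0.
- rewrite block_mxEdr mxE [X in _ = X + _]big1 ?add0r; last first.
    by move=> k _; rewrite block_mxEur mxE star0 mul0.
  by apply: eq_bigr => k _; rewrite !block_mxEdr mxE.
Qed.

Lemma cposmx_empty : cposmx (0 : 'M[A]_0).
Proof. by exists 0; apply/matrixP; case. Qed.

Definition Moo_dsum (a b : Moopos) : Moopos :=
  MkMoopos (cposmx_dsum (Moo_mxP a) (Moo_mxP b)).

Definition Moo_zero : Moopos := MkMoopos cposmx_empty.

(* W(A) is a quotient set: its elements are the equivalence classes. *)
Definition cuntz_class (a : Moopos) : set Moopos := [set b | cuntz_eq b a].

Definition cuntzW : set (set Moopos) := range cuntz_class.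

Definition W_add (X Y : set Moopos) : set Moopos :=
  [set c | exists a b, [/\ X a, Y b & cuntz_eq c (Moo_dsum a b)]].

Definition W_natmul (k : nat) (X : set Moopos) : set Moopos :=
  iter k (W_add X) (cuntz_class Moo_zero).

Definition W_le (X Y : set Moopos) : Prop :=
  exists a b, [/\ X a, Y b & cuntz_le a b].

Definition W_almost_unperforated : Prop :=
  forall X Y : set Moopos, cuntzW X -> cuntzW Y ->
  forall k : nat, W_le (W_natmul k.+1 X) (W_natmul k Y) -> W_le X Y.

End matrix_amplifications.

Definition closed_ideal (R : realType) (A : cstarAlgType R) (I : set A) :=
  [/\ I 0, forall x y, I x -> I y -> I (x + y),
      forall (k : R[i]) x, I x -> I (k *: x),
      forall a x, I x -> I (a *c x) /\ I (x *c a) & closed I].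

Definition simple_cstar (R : realType) (A : cstarAlgType R) : Prop :=
  forall I : set A, closed_ideal I -> I = [set 0] \/ I = setT.

(* The relation e <~ s for elements of A = M_1(A). *)
Definition cuntz_sub (R : realType) (A : cstarAlgType R) (a b : A) : Prop :=
  cuntz_submx (const_mx a : 'M[A]_1) (const_mx b : 'M[A]_1).

Definition near_set (R : realType) (A : cstarAlgType R)
  (a : A) (eps : R) (S : set A) : Prop := exists2 x, S x & rnorm (a - x) < eps.

(* (1 - e)x, with 1 in the unitization, is the element x - ex of A. *)
Definition essentially_tracially_in (R : realType)
    (P : cstarAlgType R -> Prop) (A : cstarAlgType R) : Prop :=
  forall (F : set A) (eps : R) (s : A),
    finite_set F -> 0 < eps -> cpos s -> s != 0 ->
  exists (e : A) (B : cstarSubalg A),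
    [/\ cpos e /\ rnorm e <= 1,
        P (subalgType B) /\ (exists2 b, subalg_set B b & b != 0),
        forall x, F x -> rnorm (e *c x - x *c e) < eps,
        forall x, F x -> near_set (x - e *c x) eps B /\
                         rnorm x - eps <= rnorm (x - e *c x)
      & cuntz_sub e s].

Definition class_W (R : realType) (D : cstarAlgType R) : Prop :=
  W_almost_unperforated D.

(* Main.v *)
(* Suppose (k+1)<a> <= k<b> in M_n(A).  For [e] as in the definition of the
   approximation and f = 1 - e, elements of M_n(B) close to f a^(1/4), f b^(1/2)
   and f x, with [x] running over the elements implementing the comparison, satisfy the
   same relation up to a small error, because [f] almost commutes with
   everything in sight. Almost unperforation of W(B) then yields b' <~ b with
   [a] arbitrarily close to b' + a^(1/2) (1 - f^4) a^(1/2), and the last term is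
   <~ diag(e, ..., e).

   If M_n(A) has no minimal projection, every nonzero positive element splits
   into orthogonal nonzero parts, so that, up to a small cut of [a], some
   c + d <= b has (m+1)<a> <= m<c> and d != 0; the transfer is applied to [a] and
   [c], and choosing s with diag(s, ..., s) <~ d absorbs the error.  If M_n(A) has a
   minimal projection, the lower bound on |(1 - e)x| and simplicity make [e]
   small against any given element, and the error term is small in norm. *)

From HB Require Import structures.
Require Import Defs.
From mathcomp Require Import all_boot all_order all_algebra.
From mathcomp Require Import all_classical all_reals all_analysis.
From mathcomp Require Import complex zify ring lra.

Set Implicit Arguments.
Unset Strict Implicit.
Unset Printing Implicit Defensive.

Import Order.TTheory GRing.Theory Num.Theory.
Import numFieldNormedType.Exports.

Local Open Scope classical_set_scope.
Local Open Scope complex_scope.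
Local Open Scope ring_scope.

(** The approximation writes [a] as b' + r, up to a small error, with r <~ diag(e, ..., e) <~
    diag(s, ..., s). This alone gives only a <~ diag(b, s, ..., s): [s] may be prescribed but not
    zero, so a summand remains. Either part of [b] is set aside for it beforehand or r is made small
    in norm; this is the origin of the case distinction. The powers are dictated by degree. For z
    near f a^(1/4), y near f b^(1/2) and w near f x, the elements (z^* z)^2 and w^* y^* y w both
    carry f^4, so their relation survives the compression; moreover (z^* z)^2 and y^* y are positive
    in M_n(B) by their form. Spectra are avoided throughout: positivity is a norm condition, square
    roots come from an iteration with polynomials, and the functional calculus rests on Bernstein
    polynomials, whose values at a positive contraction are positive and add up to 1. Norms of
    matrices are compared with their entries up to a factor n^2, which is harmless since tolerances
    are chosen after n. *)

Lemma ler_add_double (F : numDomainType) (x y e : F) :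
  x <= e -> y <= e -> x + y <= 2 * e.
Proof. by move=> xe ye; rewrite mulr2n mulrDl !mul1r lerD. Qed.

(** * Real-valued norms, and completeness by sequences *)

Section real_norm.
Context (R : realType).

(* Locked, lest unification unfold the norms of unitizations and matrices. *)
Definition nrm (V : normedZmodType R[i]) : V -> R :=
  locked (fun x => complex.Re `|x|).

Lemma nrm_Re (V : normedZmodType R[i]) (x : V) : nrm x = complex.Re `|x|.
Proof. by rewrite /nrm -lock. Qed.

Lemma nrmE (V : normedZmodType R[i]) (x : V) : `|x| = (nrm x)%:C.
Proof.
rewrite nrm_Re; have := ger0_Im (normr_ge0 x).
by case: `|x| => a b /= ->.
Qed.

Lemma nrm_ge0 (V : normedZmodType R[i]) (x : V) : 0 <= nrm x.
Proof. by rewrite -ler0c -nrmE. Qed.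

Lemma nrm0 (V : normedZmodType R[i]) : nrm (0 : V) = 0.
Proof. by rewrite nrm_Re normr0. Qed.

Lemma nrm0_eq0 (V : normedZmodType R[i]) (x : V) : nrm x = 0 -> x = 0.
Proof. by move=> x0; apply: normr0_eq0; rewrite nrmE x0. Qed.

Lemma nrm_eq0 (V : normedZmodType R[i]) (x : V) : (nrm x == 0) = (x == 0).
Proof. by apply/eqP/eqP => [/nrm0_eq0//|->]; rewrite nrm0. Qed.

Lemma nrmN (V : normedZmodType R[i]) (x : V) : nrm (- x) = nrm x.
Proof. by rewrite !nrm_Re normrN. Qed.

Lemma nrmB (V : normedZmodType R[i]) (x y : V) : nrm (x - y) = nrm (y - x).
Proof. by rewrite -nrmN opprB. Qed.

Lemma nrmD (V : normedZmodType R[i]) (x y : V) : nrm (x + y) <= nrm x + nrm y.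
Proof. by rewrite -lecR rmorphD /= -!nrmE ler_normD. Qed.

Lemma nrm_triangle (V : normedZmodType R[i]) (y x z : V) :
  nrm (x - z) <= nrm (x - y) + nrm (y - z).
Proof. by rewrite (le_trans _ (nrmD _ _))// addrA subrK. Qed.

Lemma nrm_sum (V : normedZmodType R[i]) (I : Type) (r : seq I) (P : pred I)
  (F : I -> V) : nrm (\sum_(i <- r | P i) F i) <= \sum_(i <- r | P i) nrm (F i).
Proof.
elim/big_ind2 : _ => //; first by rewrite nrm0.
by move=> x s y t xs yt; rewrite (le_trans (nrmD _ _))// lerD.
Qed.

Lemma nrmZ (V : normedModType R[i]) (k : R[i]) (x : V) :
  nrm (k *: x) = nrm k * nrm x.
Proof. by apply/complexI; rewrite rmorphM /= -!nrmE normrZ. Qed.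

Lemma nrm_real (t : R) : nrm t%:C = `|t|.
Proof. by rewrite nrm_Re normc_def /= expr0n addr0 sqrtr_sqr. Qed.

Lemma nrm_i : nrm ('i : R[i]) = 1.
Proof. by rewrite nrm_Re normc_def /= expr0n expr1n add0r sqrtr1. Qed.

Lemma nrmM_complex (k l : R[i]) : nrm (k * l) = nrm k * nrm l.
Proof. by apply/complexI; rewrite rmorphM /= -!nrmE normrM. Qed.

Lemma conjC_real (t : R) : (t%:C : R[i])^* = t%:C.
Proof. by rewrite conj_Creal// complex_real. Qed.

Lemma conjC_i : ('i : R[i])^* = - 'i.
Proof.
have : ('i : R[i])^* * 'i = 1.
  by rewrite mulrC -normCK nrmE nrm_i expr1n.
move=> h; apply: (@mulIf _ 'i); last by rewrite h mulNr -expr2 sqr_i opprK.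
by rewrite -nrm_eq0 nrm_i oner_eq0.
Qed.

Lemma nrm_conj (k : R[i]) : nrm k^* = nrm k.
Proof. by rewrite !nrm_Re norm_conjC. Qed.

(* Filters of a metrizable space converge as soon as sequences do. *)
Lemma seq_complete (V : normedModType R[i]) :
  (forall u : nat -> V,
     (forall e, 0 < e -> exists N, forall m n, (N <= m)%N -> (N <= n)%N ->
        nrm (u m - u n) < e) ->
     exists l, forall e, 0 < e -> exists N, forall n, (N <= n)%N ->
        nrm (u n - l) < e) ->
  forall F : set_system V, ProperFilter F -> cauchy F -> cvg F.
Proof.
move=> seqc F FF /cauchyP Fc.
have d0 n : 0 < (n.+1%:R^-1 : R) by rewrite invr_gt0 ltr0n.
have dC0 n : 0 < ((n.+1%:R^-1 : R)%:C : R[i]) by rewrite ltcR.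
have /choice[x Fx] n : exists x, F (ball (x : V) (n.+1%:R^-1 : R)%:C).
  by have [x ?] := Fc _ (dC0 n); exists x.
(* Two members of the filter meet, so the distance between the centres is at most the sum of the
   radii. *)
have close m n : nrm (x m - x n) < m.+1%:R^-1 + n.+1%:R^-1.
  have [z []] : exists z, ball (x m) (m.+1%:R^-1)%:C z /\ ball (x n) (n.+1%:R^-1)%:C z.
    by apply: (@filter_ex _ F FF); exact: filterI (Fx m) (Fx n).
  rewrite -!ball_normE /= !nrmE !ltcR => xmz xnz.
  rewrite (le_lt_trans (nrm_triangle z _ _))// ltrD//.
  by rewrite nrmB.
have archi (e : R) : 0 < e -> exists N, forall n, (N <= n)%N -> n.+1%:R^-1 < e.
  move=> e0; have [N _ hN] := near_infty_natSinv_lt (PosNum e0).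
  by exists N.
have [|l xl] := seqc x.
  move=> e e0; have [N hN] := archi _ (divr_gt0 e0 (ltr0n _ 2)).
  exists N => m n Nm Nn; rewrite (lt_le_trans (close m n))//.
  by rewrite (splitr e) ltW// ltrD// hN.
apply/cvg_ex; exists l; apply/cvgrPdist_lt => e e0.
have eE : e = (complex.Re e)%:C by rewrite RRe_real// gtr0_real.
have re0 : 0 < complex.Re e by move: e0; rewrite eE ltcR.
have [N1 h1] := archi _ (divr_gt0 re0 (ltr0n _ 2)).
have [N2 h2] := xl _ (divr_gt0 re0 (ltr0n _ 2)).
pose N := maxn N1 N2; have := Fx N; apply: filterS => z.
rewrite -ball_normE /= nrmE ltcR => xz; rewrite eE nrmE ltcR.
rewrite (le_lt_trans (nrm_triangle (x N) _ _))// (splitr (complex.Re e)).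
rewrite ltrD//; first by rewrite nrmB h2// leq_maxr.
by rewrite (lt_trans xz)// h1// leq_maxl.
Qed.

End real_norm.

(** * Operator norms satisfying the C*-identity *)

Section operator_norm.
Context (R : realType) (T V : lmodType R[i]).
Variables (mul : T -> T -> T) (star : T -> T) (act : T -> V -> V) (nV : V -> R).
Hypotheses (nV_ge0 : forall v, 0 <= nV v)
  (nVZ : forall k v, nV (k *: v) = nrm k * nV v)
  (nVD : forall v w, nV (v + w) <= nV v + nV w)
  (actDl : forall S S' v, act (S + S') v = act S v + act S' v)
  (actZl : forall k S v, act (k *: S) v = k *: act S v)
  (actZr : forall k S v, act S (k *: v) = k *: act S v)
  (actM : forall S S' v, act (mul S S') v = act S (act S' v))
  (act_bounded : forall S, exists2 C, 0 <= C & forall v, nV (act S v) <= C * nV v)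
  (act_star : forall S v, nV (act S v) ^+ 2 <= nV v * nV (act (mul (star S) S) v))
  (starK : involutive star).

(** Serves both the unitization, acting on A + C with the maximum norm, and M_n(A), acting on
    columns. The hypothesis [act_star] stands for the Cauchy-Schwarz inequality and is what yields
    the C*-identity. *)
Definition opnorm (S : T) : R := sup [set nV (act S v) | v in [set v | nV v <= 1]].

Let nV0 : nV 0 = 0.
Proof. by have := nVZ 0 0; rewrite scale0r nrm0 mul0r. Qed.

Let has_sup_opnorm S : has_sup [set nV (act S v) | v in [set v | nV v <= 1]].
Proof.
split; first by exists (nV (act S 0)); exists 0 => //=; rewrite nV0.
have [C C0 hC] := act_bounded S; exists C => _ [v /= v1 <-].
by rewrite (le_trans (hC v))// ler_piMr.
Qed.

Lemma opnorm_ge0 S : 0 <= opnorm S.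
Proof.
have [_ ubS] := has_sup_opnorm S; apply: le_trans (ub_le_sup ubS _).
  exact: nV_ge0 (act S 0).
by exists 0 => //=; rewrite nV0.
Qed.

Lemma opnorm_bound S v : nV (act S v) <= opnorm S * nV v.
Proof.
have [v0|v0] := eqVneq (nV v) 0.
  have [C C0 hC] := act_bounded S; rewrite v0 mulr0.
  by rewrite (le_trans (hC v))// v0 mulr0.
have v_gt0 : 0 < nV v by rewrite lt_neqAle eq_sym v0 nV_ge0.
have [_ ubS] := has_sup_opnorm S.
have : nV (act S ((nV v)^-1%:C *: v)) <= opnorm S.
  apply: ub_le_sup => //; exists ((nV v)^-1%:C *: v) => //=.
  by rewrite nVZ nrm_real ger0_norm ?invr_ge0// mulVf.
rewrite actZr nVZ nrm_real ger0_norm ?invr_ge0//.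
by rewrite mulrC ler_pdivrMr.
Qed.

Lemma opnorm_le S C : 0 <= C -> (forall v, nV (act S v) <= C * nV v) ->
  opnorm S <= C.
Proof.
move=> C0 hC; apply: ge_sup; first by have [] := has_sup_opnorm S.
by move=> _ [v /= v1 <-]; rewrite (le_trans (hC v))// ler_piMr.
Qed.

Lemma opnormD S S' : opnorm (S + S') <= opnorm S + opnorm S'.
Proof.
apply: opnorm_le => [|v]; first by rewrite addr_ge0 ?opnorm_ge0.
by rewrite actDl (le_trans (nVD _ _))// mulrDl lerD// opnorm_bound.
Qed.

Lemma opnormZ k S : opnorm (k *: S) = nrm k * opnorm S.
Proof.
have le k' S' : opnorm (k' *: S') <= nrm k' * opnorm S'.
  apply: opnorm_le => [|v]; first by rewrite mulr_ge0 ?opnorm_ge0 ?nrm_ge0.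
  by rewrite actZl nVZ -mulrA ler_wpM2l ?nrm_ge0 ?opnorm_bound.
apply/eqP; rewrite eq_le le /=.
have [->|k0] := eqVneq k 0; first by rewrite nrm0 mul0r opnorm_ge0.
have /(le_trans _) := le k^-1 (k *: S); rewrite scalerA mulVf// scale1r => /(_ _ (lexx _)).
rewrite -(ler_pM2l (_ : 0 < nrm k)); last by rewrite lt_neqAle nrm_ge0 eq_sym nrm_eq0 k0.
by rewrite mulrA -nrmM_complex mulfV// [nrm 1]nrm_real normr1 mul1r.
Qed.

Lemma opnormM S S' : opnorm (mul S S') <= opnorm S * opnorm S'.
Proof.
apply: opnorm_le => [|v]; first by rewrite mulr_ge0 ?opnorm_ge0.
rewrite actM (le_trans (opnorm_bound _ _))// -mulrA.
by rewrite ler_wpM2l ?opnorm_ge0 ?opnorm_bound.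
Qed.

(** [act_star] gives |S|^2 <= |S^* S|, whence |S| <= |S^*| by submultiplicativity; applied to the
    adjoint, this gives equality of the two norms and turns the first inequality into an
    equality. *)
Lemma opnorm_star S : opnorm (mul (star S) S) = opnorm S ^+ 2.
Proof.
have le S' : opnorm S' ^+ 2 <= opnorm (mul (star S') S').
  rewrite -(@sqr_sqrtr _ (opnorm (mul (star S') S'))) ?opnorm_ge0//.
  rewrite ler_pXn2r ?nnegrE ?opnorm_ge0 ?sqrtr_ge0//.
  apply: opnorm_le; first exact: sqrtr_ge0.
  move=> v; rewrite -(@ler_pXn2r _ 2) ?nnegrE ?mulr_ge0 ?sqrtr_ge0//.
  rewrite (le_trans (act_star _ _))// exprMn sqr_sqrtr ?opnorm_ge0//.
  by rewrite expr2 mulrC mulrA ler_wpM2r ?opnorm_bound.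
have le2 S' : opnorm S' <= opnorm (star S').
  have [->|S0] := eqVneq (opnorm S') 0; first exact: opnorm_ge0.
  rewrite -(ler_pM2r (_ : 0 < opnorm S')).
    by rewrite -expr2 (le_trans (le _))// opnormM.
  by rewrite lt_neqAle eq_sym S0 opnorm_ge0.
apply/eqP; rewrite eq_le le andbT (le_trans (opnormM _ _))// expr2.
by rewrite ler_wpM2r ?opnorm_ge0// (le_trans (le2 _))// starK.
Qed.

End operator_norm.

(** * Elementary algebra and norms in a C*-algebra *)

Section cstar_basics.
Context (R : realType) (A : cstarAlgType R).
Implicit Types x y z : A.

Lemma cmul0r x : 0 *c x = 0.
Proof. by have := cmulZl 0 0 x; rewrite !scale0r. Qed.

Lemma cmulr0 x : x *c 0 = 0.
Proof. by have := cmulZr 0 x 0; rewrite !scale0r. Qed.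

Lemma cstar0 : (0 : A)^c* = 0.
Proof. by have := cstarZ 0 (0 : A); rewrite conjC0 !scale0r. Qed.

Lemma cstarN x : (- x)^c* = - x^c*.
Proof. by rewrite -scaleN1r cstarZ conj_Creal ?rpredN ?rpred1 // scaleN1r. Qed.

Lemma cstarB x y : (x - y)^c* = x^c* - y^c*.
Proof. by rewrite cstarD cstarN. Qed.

Lemma cmulNr x y : (- x) *c y = - (x *c y).
Proof. by rewrite -[- x]scaleN1r cmulZl scaleN1r. Qed.

Lemma cmulrN x y : x *c (- y) = - (x *c y).
Proof. by rewrite -[- y]scaleN1r cmulZr scaleN1r. Qed.

Lemma cmulBl x y z : (x - y) *c z = x *c z - y *c z.
Proof. by rewrite cmulDl cmulNr. Qed.

Lemma cmulBr x y z : x *c (y - z) = x *c y - x *c z.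
Proof. by rewrite cmulDr cmulrN. Qed.

Lemma cmul_suml (I : Type) (r : seq I) (P : pred I) (F : I -> A) x :
  (\sum_(i <- r | P i) F i) *c x = \sum_(i <- r | P i) F i *c x.
Proof. by apply: (big_morph (fun y => y *c x)) => [y z|]; rewrite ?cmulDl ?cmul0r. Qed.

Lemma cmul_sumr (I : Type) (r : seq I) (P : pred I) (F : I -> A) x :
  x *c (\sum_(i <- r | P i) F i) = \sum_(i <- r | P i) x *c F i.
Proof. by apply: (big_morph (fun y => x *c y)) => [y z|]; rewrite ?cmulDr ?cmulr0. Qed.

Lemma cstar_sum (I : Type) (r : seq I) (P : pred I) (F : I -> A) :
  (\sum_(i <- r | P i) F i)^c* = \sum_(i <- r | P i) (F i)^c*.
Proof. by apply: (big_morph cstar) => [y z|]; rewrite ?cstarD ?cstar0. Qed.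

Lemma nrmM x y : nrm (x *c y) <= nrm x * nrm y.
Proof. by rewrite -lecR rmorphM /= -!nrmE cnormM. Qed.

Lemma nrm_star_sq x : nrm (x^c* *c x) = nrm x ^+ 2.
Proof. by apply/complexI; rewrite rmorphXn /= -!nrmE cnorm_star. Qed.

Lemma nrm_star x : nrm x^c* = nrm x.
Proof.
have le y : nrm y <= nrm y^c*.
  have [->|y0] := eqVneq y 0; first by rewrite cstar0.
  have y_gt0 : 0 < nrm y by rewrite lt_neqAle nrm_ge0 eq_sym nrm_eq0 y0.
  by rewrite -(ler_pM2r y_gt0) -expr2 -nrm_star_sq nrmM.
by apply/eqP; rewrite eq_le le andbT -{2}(cstarK x) le.
Qed.

Lemma star_mul_eq0 x : x^c* *c x = 0 -> x = 0.
Proof.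
move=> x0; apply/nrm0_eq0/eqP; rewrite -sqrf_eq0.
by rewrite -nrm_star_sq x0 nrm0.
Qed.

Lemma cauchy_nrm_cvg (u : nat -> A) :
  (forall e, 0 < e -> exists N, forall m n, (N <= m)%N -> (N <= n)%N ->
     nrm (u m - u n) < e) ->
  exists l, forall e, 0 < e -> exists N, forall n, (N <= n)%N -> nrm (u n - l) < e.
Proof.
move=> uc.
have /cvg_ex[l ul] : cvg (u @ \oo).
  apply: cauchy_cvg; apply/cauchyP => e e0.
  have eE : e = (complex.Re e)%:C by rewrite RRe_real// gtr0_real.
  have re0 : 0 < complex.Re e by move: e0; rewrite eE ltcR.
  have [N hN] := uc _ re0; exists (u N); exists N => // n /= Nn.
  by rewrite -ball_normE /= nrmE eE ltcR hN.
exists l => e e0.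
have eC0 : 0 < (e%:C : R[i]) by rewrite ltcR.
have /cvgrPdist_lt/(_ _ eC0)[N _ hN] := ul.
by exists N => n Nn; rewrite -ltcR -nrmE distrC hN.
Qed.

End cstar_basics.

(* Proves an equality of two sums that agree up to reordering, in an additive
   group; summands are compared up to conversion. *)
Ltac pull_summand x t :=
  match t with
  | ?x' + _ => let _ := match goal with _ => unify x x' end in constr:(erefl t)
  | ?y + ?x' => let _ := match goal with _ => unify x x' end in constr:(addrC y x')
  | ?y + ?t' => let p := pull_summand x t' in
                constr:(etrans (congr1 (fun s => y + s) p) (addrCA y x _))
  end.

Ltac zsum :=
  rewrite -?addrA;
  repeat (match goal with |- ?x + _ = ?t =>
    let p := pull_summand x t in
    refine (etrans _ (esym p)); refine (congr1 (fun s => x + s) _) end);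
  try reflexivity.


(** * Cauchy sequences of real and complex numbers *)

Section complex_complete.
Context (R : realType).

Lemma cauchy_real_cvg (u : nat -> R) :
  (forall e, 0 < e -> exists N, forall m n, (N <= m)%N -> (N <= n)%N ->
     `|u m - u n| < e) ->
  exists l, forall e, 0 < e -> exists N, forall n, (N <= n)%N -> `|u n - l| < e.
Proof.
move=> uc.
have /cvg_ex[l ul] : cvg (u @ \oo).
  apply: cauchy_cvg; apply/cauchyP => e e0.
  have [N hN] := uc _ e0; exists (u N); exists N => // n /= Nn.
  by rewrite -ball_normE /= hN.
exists l => e e0; have /cvgrPdist_lt/(_ _ e0)[N _ hN] := ul.
by exists N => n Nn; rewrite distrC hN.
Qed.

Lemma nrm_complex_ge (z : R[i]) : `|complex.Re z| <= nrm z /\ `|complex.Im z| <= nrm z.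
Proof.
rewrite nrm_Re normc_def /= -!sqrtr_sqr; split; apply: ler_wsqrtr.
  by rewrite lerDl sqr_ge0.
by rewrite lerDr sqr_ge0.
Qed.

Lemma nrm_complex_le (z : R[i]) : nrm z <= `|complex.Re z| + `|complex.Im z|.
Proof.
rewrite {1}(complexE z) (le_trans (nrmD _ _))//.
by rewrite nrmM_complex nrm_i mul1r !nrm_real.
Qed.

Lemma cauchy_complex_cvg (u : nat -> R[i]) :
  (forall e, 0 < e -> exists N, forall m n, (N <= m)%N -> (N <= n)%N ->
     nrm (u m - u n) < e) ->
  exists l, forall e, 0 < e -> exists N, forall n, (N <= n)%N -> nrm (u n - l) < e.
Proof.
move=> uc.
have ReB (z w : R[i]) : complex.Re (z - w) = complex.Re z - complex.Re w.
  by case: z w => ? ? [].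
have ImB (z w : R[i]) : complex.Im (z - w) = complex.Im z - complex.Im w.
  by case: z w => ? ? [].
have [|a ha] := @cauchy_real_cvg (fun n => complex.Re (u n)).
  move=> e e0; have [N hN] := uc _ e0; exists N => m n Nm Nn.
  by rewrite -ReB (le_lt_trans (nrm_complex_ge _).1)// hN.
have [|b hb] := @cauchy_real_cvg (fun n => complex.Im (u n)).
  move=> e e0; have [N hN] := uc _ e0; exists N => m n Nm Nn.
  by rewrite -ImB (le_lt_trans (nrm_complex_ge _).2)// hN.
exists (Complex a b) => e e0.
have [N1 h1] := ha _ (divr_gt0 e0 (ltr0n _ 2)).
have [N2 h2] := hb _ (divr_gt0 e0 (ltr0n _ 2)).
exists (maxn N1 N2) => n; rewrite geq_max => /andP[N1n N2n].
rewrite (le_lt_trans (nrm_complex_le _))// ReB ImB /= (splitr e) ltrD//.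
  exact: h1.
exact: h2.
Qed.

End complex_complete.

(** * Unitization and continuous functional calculus *)

(** The pair (x, a) stands for x + a. A unit is adjoined even if [A] has one, so that [A] is always
    the kernel of the second projection. *)
Definition unitz (R : realType) (A : cstarAlgType R) := (A * R[i]^o)%type.

Section unitization.
Context (R : realType) (A : cstarAlgType R).
Local Notation U := (unitz A).

HB.instance Definition _ := GRing.Lmodule.on U.

Let umul (x y : U) : U := (x.1 *c y.1 + (y.2 : R[i]) *: x.1 + (x.2 : R[i]) *: y.1, x.2 * y.2).
Let uone : U := (0, 1).
Let ustar (x : U) : U := (x.1^c*, ((x.2 : R[i])^* : R[i])).

Let umulA : associative umul.
Proof.
move=> [x a] [y b] [z c]; congr (_, _) => /=; last by rewrite mulrA.
rewrite !cmulDl !cmulDr !scalerDr !cmulZl !cmulZr !cmulA !scalerA.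
by rewrite [c * a]mulrC [c * b]mulrC; zsum.
Qed.

Let umul1 : left_id uone umul.
Proof. by case=> x a; rewrite /umul /= cmul0r scaler0 scale1r !add0r mul1r. Qed.

Let umulr1 : right_id uone umul.
Proof. by case=> x a; rewrite /umul /= cmulr0 scaler0 scale1r add0r addr0 mulr1. Qed.

Let umulDl : left_distributive umul +%R.
Proof.
move=> [x a] [y b] [z c]; congr (_, _) => /=; last by rewrite mulrDl.
by rewrite cmulDl scalerDr scalerDl; zsum.
Qed.

Let umulDr : right_distributive umul +%R.
Proof.
move=> [x a] [y b] [z c]; congr (_, _) => /=; last by rewrite mulrDr.
by rewrite cmulDr scalerDr scalerDl; zsum.
Qed.

Let uone_neq0 : uone != 0.
Proof. by apply/eqP => -[/eqP]; rewrite oner_eq0. Qed.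

HB.instance Definition _ :=
  GRing.Zmodule_isNzRing.Build U umulA umul1 umulr1 umulDl umulDr uone_neq0.

Let umulZl (k : R[i]) (x y : U) : k *: (x * y) = (k *: x) * y.
Proof.
case: x y => [x a] [y b]; congr (_, _) => /=; last by rewrite -mulrA.
by rewrite !scalerDr cmulZl !scalerA [k * b]mulrC.
Qed.

Let umulZr (k : R[i]) (x y : U) : k *: (x * y) = x * (k *: y).
Proof.
case: x y => [x a] [y b]; congr (_, _) => /=; last by rewrite [RHS]mulrCA.
by rewrite !scalerDr cmulZr !scalerA [k * a]mulrC.
Qed.

HB.instance Definition _ := GRing.Lmodule_isLalgebra.Build R[i] U umulZl.
HB.instance Definition _ := GRing.Lalgebra_isAlgebra.Build R[i] U umulZr.

Let ustarD : {morph ustar : x y / x + y}.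
Proof. by move=> [x a] [y b]; congr (_, _) => /=; rewrite ?cstarD ?rmorphD. Qed.

Let ustarZ (k : R[i]) (x : U) : ustar (k *: x) = k^* *: ustar x.
Proof. by case: x => x a; congr (_, _) => /=; rewrite ?cstarZ ?rmorphM. Qed.

Let ustarK : involutive ustar.
Proof. by move=> [x a]; congr (_, _) => /=; rewrite ?cstarK ?conjCK. Qed.

Let ustarM (x y : U) : ustar (x * y) = ustar y * ustar x.
Proof.
case: x y => [x a] [y b]; congr (_, _) => /=; last by rewrite rmorphM mulrC.
by rewrite !cstarD !cstarZ cstarM; zsum.
Qed.

(** Left multiplication on [A] alone would not be faithful when [A] has a unit, since that unit
    minus the adjoined one acts by zero. The extra scalar coordinate repairs this. *)
Let act (x v : A * R[i]^o) : A * R[i]^o := (x.1 *c v.1 + (x.2 : R[i]) *: v.1, x.2 * v.2).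
Let nV (v : A * R[i]^o) : R := Num.max (nrm v.1) (nrm v.2).

Let nV_ge0 v : 0 <= nV v.
Proof. by rewrite le_max nrm_ge0. Qed.

Let nVZ k v : nV (k *: v) = nrm k * nV v.
Proof. by rewrite /nV maxr_pMr ?nrm_ge0// !nrmZ. Qed.

Let nVD v w : nV (v + w) <= nV v + nV w.
Proof.
rewrite ge_max; apply/andP; split; rewrite (le_trans (nrmD _ _))// lerD//
  le_max lexx// orbT//.
Qed.

Let actDl S S' v : act (S + S') v = act S v + act S' v.
Proof.
congr (_, _) => /=; last by rewrite mulrDl.
by rewrite cmulDl scalerDl; zsum.
Qed.

Let actZl k S v : act (k *: S) v = k *: act S v.
Proof.
congr (_, _) => /=; first by rewrite scalerDr cmulZl scalerA.
by rewrite /GRing.scale/= mulrA.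
Qed.

Let actZr k S v : act S (k *: v) = k *: act S v.
Proof.
congr (_, _) => /=; last by rewrite /GRing.scale/= mulrCA.
by rewrite scalerDr cmulZr !scalerA mulrC.
Qed.

Let actM (S S' : U) v : act (S * S') v = act S (act S' v).
Proof.
congr (_, _) => /=; last by rewrite mulrA.
by rewrite !cmulDl !cmulDr !scalerDr !cmulZl !cmulZr !cmulA !scalerA; zsum.
Qed.

Let act_bounded S : exists2 C, 0 <= C & forall v, nV (act S v) <= C * nV v.
Proof.
exists (nrm S.1 + nrm S.2) => [|v]; first by rewrite addr_ge0 ?nrm_ge0.
have v1 : nrm v.1 <= nV v by rewrite le_max lexx.
have v2 : nrm v.2 <= nV v by rewrite le_max lexx orbT.
rewrite ge_max mulrDl; apply/andP; split => /=.
  rewrite (le_trans (nrmD _ _))// lerD//; last by rewrite nrmZ ler_wpM2l ?nrm_ge0.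
  by rewrite (le_trans (nrmM _ _))// ler_wpM2l ?nrm_ge0.
rewrite nrmM_complex (@le_trans _ _ (nrm S.2 * nV v))//.
  by rewrite ler_wpM2l ?nrm_ge0.
by rewrite lerDr mulr_ge0 ?nrm_ge0.
Qed.

Let act_star (S : U) v : nV (act S v) ^+ 2 <= nV v * nV (act (ustar S * S) v).
Proof.
have nV1 w : nrm w.1 <= nV w by rewrite le_max lexx.
have nV2 w : nrm w.2 <= nV w by rewrite le_max lexx orbT.
have -> : nV (act S v) ^+ 2 = Num.max (nrm (act S v).1 ^+ 2) (nrm (act S v).2 ^+ 2).
  rewrite {1}/nV; case: leP => h.
    by rewrite [RHS]max_r// ler_pXn2r ?nnegrE ?nrm_ge0.
  by rewrite [RHS]max_l// ler_pXn2r ?nnegrE ?nrm_ge0// ltW.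
rewrite ge_max; apply/andP; split.
  rewrite -nrm_star_sq.
  have -> : (act S v).1^c* *c (act S v).1 = v.1^c* *c (act (ustar S * S) v).1.
    rewrite actM /= cstarD cstarM cstarZ !cmulDl !cmulDr !cmulZl !cmulZr -!cmulA.
    by rewrite !cmulDr !scalerDr !cmulZr -?scalerDr.
  by rewrite (le_trans (nrmM _ _))// nrm_star ler_pM ?nrm_ge0.
rewrite actM /= nrmM_complex expr2.
rewrite [leLHS](_ : _ = nrm v.2 * nrm ((ustar S).2 * (S.2 * v.2))).
  by rewrite ler_pM ?nrm_ge0// (le_trans _ (nV2 _))// /act /=.
by rewrite !nrmM_complex /= nrm_conj; ring.
Qed.

Definition unorm (x : U) : R := @opnorm R _ _ act nV x.

Let unormC (x : U) : R[i] := (unorm x)%:C.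

Lemma unorm_ge0 x : 0 <= unorm x.
Proof. exact: (@opnorm_ge0 _ _ _ act nV). Qed.

(** Equivalence with the norm of a direct sum, on which completeness rests. The scalar part is seen
    on the vector (0, 1), and removing it from the action costs the factor 2. *)
Lemma unorm_bounds (x : U) :
  [/\ nrm x.1 <= 2 * unorm x, nrm x.2 <= unorm x & unorm x <= nrm x.1 + nrm x.2].
Proof.
have ub := @opnorm_bound _ _ _ act nV nV_ge0 nVZ actZr act_bounded x.
have x2 : nrm x.2 <= unorm x.
  have := ub (0, 1); rewrite {1}/nV /act /= mulr1 cmulr0 scaler0 addr0.
  rewrite /nV nrm0 [nrm 1]nrm_real normr1 max_r ?nrm_ge0// max_r ?ler01//.
  by rewrite mulr1.
have le_act v : nrm (x.1 *c v) <= 2 * unorm x * nrm v.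
  have -> : x.1 *c v = (act x (v, 0)).1 - x.2 *: v by rewrite /= addrK.
  rewrite (le_trans (nrmD _ _))// nrmN nrmZ mulr2n !mulrDl !mul1r lerD//.
    rewrite (le_trans _ (le_trans (ub (v, 0)) _))//.
      by rewrite le_max lexx.
    by rewrite /nV /= nrm0 max_l ?nrm_ge0.
  by rewrite ler_wpM2r ?nrm_ge0.
split => //.
  have [->|x0] := eqVneq x.1 0; first by rewrite nrm0 mulr_ge0// unorm_ge0.
  have x_gt0 : 0 < nrm x.1 by rewrite lt_neqAle nrm_ge0 eq_sym nrm_eq0 x0.
  rewrite -(ler_pM2r x_gt0) -expr2 -nrm_star -nrm_star_sq cstarK.
  by rewrite (le_trans (le_act _)).
apply: opnorm_le => //; first by rewrite addr_ge0 ?nrm_ge0.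
move=> v; have v1 : nrm v.1 <= nV v by rewrite le_max lexx.
have v2 : nrm v.2 <= nV v by rewrite le_max lexx orbT.
rewrite ge_max mulrDl; apply/andP; split => /=.
  rewrite (le_trans (nrmD _ _))// lerD//; last by rewrite nrmZ ler_wpM2l ?nrm_ge0.
  by rewrite (le_trans (nrmM _ _))// ler_wpM2l ?nrm_ge0.
rewrite nrmM_complex (@le_trans _ _ (nrm x.2 * nV v))//.
  by rewrite ler_wpM2l ?nrm_ge0.
by rewrite lerDr mulr_ge0 ?nrm_ge0.
Qed.

Lemma unorm_in (x : A) : unorm (x, 0) = nrm x.
Proof.
apply/eqP; rewrite eq_le; apply/andP; split.
  by have [_ _] := unorm_bounds (x, 0); rewrite /= nrm0 addr0.
have [->|x0] := eqVneq x 0; first by rewrite nrm0 unorm_ge0.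
have x_gt0 : 0 < nrm x by rewrite lt_neqAle nrm_ge0 eq_sym nrm_eq0 x0.
rewrite -(ler_pM2r x_gt0) -expr2 -nrm_star -nrm_star_sq cstarK.
have := @opnorm_bound _ _ _ act nV nV_ge0 nVZ actZr act_bounded (x, 0) (x^c*, 0).
rewrite {1 3}/nV /act /= !mulr0 scale0r addr0 nrm0 !max_l ?nrm_ge0// nrm_star.
Qed.

Let unormCD x y : unormC (x + y) <= unormC x + unormC y.
Proof. by rewrite -rmorphD lecR; exact: opnormD. Qed.

Let unormCZ (k : R[i]) x : unormC (k *: x) = `|k| * unormC x.
Proof. by rewrite nrmE -rmorphM /=; congr (_%:C); exact: opnormZ. Qed.

Let unormC0 x : unormC x = 0 -> x = 0.
Proof.
move=> /complexI x0; have [] := unorm_bounds x; rewrite x0 mulr0 => h1 h2 _.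
by apply/eqP; rewrite -pair_eqE /pair_eq /= -!nrm_eq0 !eq_le h1 h2 !nrm_ge0.
Qed.

HB.instance Definition _ :=
  Lmodule_isNormed.Build R[i] U unormCD unormCZ unormC0.

Lemma nrm_unorm (x : U) : nrm x = unorm x. Proof. by rewrite nrm_Re. Qed.

Let unitz_complete (F : set_system U) : ProperFilter F -> cauchy F -> cvg F.
Proof.
apply: seq_complete => u uc.
have [|a ha] := @cauchy_nrm_cvg R A (fun n => (u n).1).
  move=> e e0; have [N hN] := uc _ (divr_gt0 e0 (ltr0n _ 2)).
  exists N => m n Nm Nn; have [h _ _] := unorm_bounds (u m - u n).
  rewrite (le_lt_trans h)// -ltr_pdivlMl// mulrC.
    by rewrite -nrm_unorm; exact: hN.
have [|b hb] := @cauchy_complex_cvg R (fun n => (u n).2).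
  move=> e e0; have [N hN] := uc _ e0.
  exists N => m n Nm Nn; have [_ h _] := unorm_bounds (u m - u n).
  by rewrite (le_lt_trans h)// -nrm_unorm; exact: hN.
exists (a, b) => e e0.
have [N1 h1] := ha _ (divr_gt0 e0 (ltr0n _ 2)).
have [N2 h2] := hb _ (divr_gt0 e0 (ltr0n _ 2)).
exists (maxn N1 N2) => n; rewrite geq_max => /andP[N1n N2n].
have [_ _ h] := unorm_bounds (u n - (a, b)).
by rewrite nrm_unorm (le_lt_trans h)//= (splitr e) ltrD// ?h1// h2.
Qed.

HB.instance Definition _ := Uniform_isComplete.Build U unitz_complete.

Let unormM (x y : U) : `|x * y| <= `|x| * `|y|.
Proof. by rewrite !nrmE -rmorphM lecR !nrm_unorm; exact: opnormM. Qed.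

Let unorm_star (x : U) : `|ustar x * x| = `|x| ^+ 2.
Proof.
rewrite !nrmE !nrm_unorm -rmorphXn; congr (_%:C).
by apply: (@opnorm_star R _ _ *%R ustar act nV).
Qed.

HB.instance Definition _ :=
  CompleteNormedModule_isCStarAlgebra.Build R U
    umulA umulDl umulDr (fun k x y => esym (umulZl k x y))
    (fun k x y => esym (umulZr k x y)) ustarD ustarZ ustarK ustarM
    unormM unorm_star.

End unitization.

(** * Real polynomials of an element, and the square root of 1 - z *)

Section real_poly_calculus.
Context (R : realType) (A : cstarAlgType R).
Local Notation U := (unitz A).
Implicit Types (h x y z : U) (p q : {poly R}) (t : R).

Lemma ucmulE x y : x *c y = x * y. Proof. by []. Qed.

Lemma cauchy_unitz_cvg (u : nat -> U) :
  (forall e, 0 < e -> exists N, forall m n, (N <= m)%N -> (N <= n)%N ->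
     nrm (u m - u n) < e) ->
  exists l : U, forall e, 0 < e -> exists N, forall n, (N <= n)%N -> nrm (u n - l) < e.
Proof. exact: cauchy_nrm_cvg. Qed.

Lemma unitz_nrm1 : nrm (1 : U) = 1.
Proof.
have [_] := @unorm_bounds R A 1; rewrite -nrm_unorm /= nrm0 add0r.
rewrite [nrm (1 : R[i]^o)]nrm_real normr1 => h1 h2.
by apply/eqP; rewrite eq_le h1 h2.
Qed.

Lemma unrmM x y : nrm (x * y) <= nrm x * nrm y. Proof. exact: nrmM. Qed.

Lemma ustarM x y : (x * y)^c* = y^c* * x^c*. Proof. exact: cstarM. Qed.

Lemma ustar1 : (1 : U)^c* = 1.
Proof. by congr (_, _); rewrite /= ?cstar0 ?conjC1. Qed.

Definition rsc t : U := t%:C%:A.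

HB.instance Definition _ := GRing.RMorphism.copy rsc (in_alg U \o real_complex R).

Lemma rscl t x : rsc t * x = t%:C *: x. Proof. by rewrite mulr_algl. Qed.

Lemma rscr t x : x * rsc t = t%:C *: x. Proof. by rewrite mulr_algr. Qed.

Lemma rscC t x : rsc t * x = x * rsc t. Proof. by rewrite rscl rscr. Qed.

Lemma nrm_rsc t : nrm (rsc t) = `|t|.
Proof. by rewrite nrmZ nrm_real unitz_nrm1 mulr1. Qed.

Lemma star_rsc t : (rsc t)^c* = rsc t.
Proof. by rewrite cstarZ conjC_real ustar1. Qed.

Lemma nrmX x n : nrm (x ^+ n) <= nrm x ^+ n.
Proof.
elim: n => [|n IH]; first by rewrite !expr0 unitz_nrm1.
by rewrite !exprS (le_trans (unrmM _ _))// ler_wpM2l ?nrm_ge0.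
Qed.

(** Real coefficients keep the values at self-adjoint elements self-adjoint. *)
Definition pev h p : U := locked (horner_alg h) (map_poly (real_complex R) p).

Lemma pev0 h : pev h 0 = 0.
Proof. by rewrite /pev -lock rmorph0 rmorph0. Qed.

Lemma pevD h p q : pev h (p + q) = pev h p + pev h q.
Proof. by rewrite /pev -lock rmorphD rmorphD. Qed.

Lemma pevB h p q : pev h (p - q) = pev h p - pev h q.
Proof. by rewrite /pev -lock rmorphB rmorphB. Qed.

Lemma pevM h p q : pev h (p * q) = pev h p * pev h q.
Proof. by rewrite /pev -lock rmorphM rmorphM. Qed.

Lemma pevX h : pev h 'X = h.
Proof. by rewrite /pev -lock map_polyX horner_algX. Qed.

Lemma pevC h t : pev h t%:P = rsc t.
Proof. by rewrite /pev -lock map_polyC horner_algC. Qed.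

Lemma pev1 h : pev h 1 = 1.
Proof. by rewrite -polyC1 pevC /rsc scale1r. Qed.

Lemma pevXn h p n : pev h (p ^+ n) = pev h p ^+ n.
Proof. by elim: n => [|n IH]; rewrite ?expr0 ?pev1// !exprS pevM IH. Qed.

Lemma pevZ h t p : pev h (t *: p) = t%:C *: pev h p.
Proof. by rewrite -mul_polyC pevM pevC rscl. Qed.

Lemma pevE h p : pev h p = \sum_(i < size p) (p`_i)%:C *: h ^+ i.
Proof.
rewrite -{1}(coefK p) poly_def (big_morph (pev h) (pevD h) (pev0 h)).
by apply: eq_bigr => i _; rewrite pevZ pevXn pevX.
Qed.

Lemma pev_comp h p q : pev h (p \Po q) = pev (pev h q) p.
Proof.
elim/poly_ind : p => [|p t IH]; first by rewrite comp_poly0 !pev0.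
rewrite comp_polyD comp_polyM comp_polyX comp_polyC !pevD !pevM IH.
by rewrite !pevC pevX.
Qed.

Lemma pev_intertwine x h k p : x * h = k * x -> x * pev h p = pev k p * x.
Proof.
move=> xh; elim/poly_ind : p => [|p t IH]; first by rewrite !pev0 mulr0 mul0r.
rewrite !pevD !pevM !pevC !pevX mulrDr mulrDl -rscC; congr (_ + _).
by rewrite mulrA IH -mulrA xh mulrA.
Qed.

Lemma pev_comm h p : h * pev h p = pev h p * h.
Proof. exact: pev_intertwine. Qed.

Lemma pev_star h p : (pev h p)^c* = pev h^c* p.
Proof.
elim/poly_ind : p => [|p t IH]; first by rewrite !pev0 cstar0.
rewrite !pevD !pevM cstarD ustarM IH !pevC !pevX star_rsc.
by rewrite pev_comm.
Qed.

Definition nneg_coef p := forall i, 0 <= p`_i.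

Lemma nneg_coefD p q : nneg_coef p -> nneg_coef q -> nneg_coef (p + q).
Proof. by move=> p0 q0 i; rewrite coefD addr_ge0. Qed.

Lemma nneg_coefM p q : nneg_coef p -> nneg_coef q -> nneg_coef (p * q).
Proof. by move=> p0 q0 i; rewrite coefM sumr_ge0// => j _; rewrite mulr_ge0. Qed.

Lemma nneg_coefZ t p : 0 <= t -> nneg_coef p -> nneg_coef (t *: p).
Proof. by move=> t0 p0 i; rewrite coefZ mulr_ge0. Qed.

Lemma nneg_coefX : nneg_coef 'X.
Proof. by move=> i; rewrite coefX ler0n. Qed.

Lemma nneg_coef_horner p : nneg_coef p -> 0 <= p.[1].
Proof.
by move=> p0; rewrite horner_coef sumr_ge0// => i _; rewrite expr1n mulr1.
Qed.

(** The triangle inequality, coefficient by coefficient, reduces norm estimates to the single real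
    number p(1): a sequence of polynomials that increases coefficientwise is Cauchy at [h] as soon
    as its values at 1 are. *)
Lemma pev_nneg_coef h p : nneg_coef p -> nrm h <= 1 -> nrm (pev h p) <= p.[1].
Proof.
move=> p0 h1; rewrite pevE horner_coef (le_trans (nrm_sum _ _ _))//.
apply: ler_sum => i _; rewrite nrmZ nrm_real ger0_norm ?ler_wpM2l//; try exact: p0.
by rewrite expr1n (le_trans (nrmX _ _))// exprn_ile1// nrm_ge0.
Qed.

Lemma nrm_small0 (V : normedModType R[i]) (v : V) (C : R) :
  (forall e, 0 < e -> nrm v <= C * e) -> v = 0.
Proof.
move=> vC; apply/nrm0_eq0/eqP; rewrite eq_le nrm_ge0 andbT.
have [C0|C0] := leP C 0.
  by rewrite (le_trans (vC _ ltr01))// mulr1.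
apply/ler_addgt0Pl => e e0; rewrite addr0 (le_trans (vC _ (divr_gt0 e0 C0)))//.
by rewrite mulrCA mulfV ?mulr1// gt_eqF.
Qed.

(* The Newton-type iteration q := (X + q^2) / 2 from 0 has nonnegative
   coefficients and converges to 1 - sqrt (1 - X). *)
Definition sqrt_approx n : {poly R} := iter n (fun q => 2^-1 *: ('X + q ^+ 2)) 0.

Lemma sqrt_approx_nneg n : nneg_coef (sqrt_approx n).
Proof.
elim: n => [|n IH]; first by move=> i; rewrite coef0.
by apply: nneg_coefZ; [rewrite invr_ge0|apply/nneg_coefD/nneg_coefM/IH/IH/nneg_coefX].
Qed.

(** If q' follows q, the increment after q' is (q' - q) (q' + q) / 2, so nonnegativity of the
    coefficients propagates. *)
Lemma sqrt_approx_step n : nneg_coef (sqrt_approx n.+1 - sqrt_approx n).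
Proof.
elim: n => [|n IH]; first by rewrite subr0; exact: sqrt_approx_nneg.
rewrite /= -/(sqrt_approx n) -/(sqrt_approx n.+1) -scalerBr opprD addrACA subrr add0r.
rewrite subr_sqr; apply: nneg_coefZ; first by rewrite invr_ge0.
by apply/nneg_coefM/nneg_coefD/sqrt_approx_nneg/(sqrt_approx_nneg n.+1)/IH.
Qed.

Lemma sqrt_approx_mono m n : (m <= n)%N -> nneg_coef (sqrt_approx n - sqrt_approx m).
Proof.
move=> /subnK <-; elim: (n - m)%N => [|k IH]; first by move=> i; rewrite subrr coef0.
rewrite addSn -(subrK (sqrt_approx (k + m)) (sqrt_approx _.+1)) -addrA.
exact/nneg_coefD/IH/sqrt_approx_step.
Qed.

Lemma sqrt_approx_le1 n : (sqrt_approx n).[1] <= 1.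
Proof.
elim: n => [|n IH]; first by rewrite horner0.
have n0 : 0 <= (sqrt_approx n).[1].
  exact/nneg_coef_horner/sqrt_approx_nneg.
rewrite /= -/(sqrt_approx n) hornerZ hornerD hornerX horner_exp.
rewrite mulrC ler_pdivrMr// mul1r -[2]/(1 + 1 : R) lerD2l.
by rewrite exprn_ile1.
Qed.

Lemma sqrt_approx_cauchy (e : R) : 0 < e -> exists N, forall m n,
  (N <= m)%N -> (N <= n)%N -> `|(sqrt_approx m).[1] - (sqrt_approx n).[1]| < e.
Proof.
move=> e0; pose v n := (sqrt_approx n).[1].
have vc : cvg (v @ \oo).
  apply: nondecreasing_is_cvgn; last by exists 1 => _ [n _ <-]; exact: sqrt_approx_le1.
  move=> m n /sqrt_approx_mono/nneg_coef_horner.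
  by rewrite hornerD hornerN subr_ge0.
have /cvgrPdist_lt/(_ _ (divr_gt0 e0 (ltr0n _ 2)))[N _ hN] := vc.
exists N => m n Nm Nn; rewrite -/(v m) -/(v n) -(subrK (lim (v @ \oo)) (v m)) -addrA.
rewrite (le_lt_trans (ler_normD _ _))// (splitr e) ltrD//; last exact: hN.
by rewrite distrC; exact: hN.
Qed.

(** The limit w of the iteration satisfies 2 w = z + w^2, that is (1 - w)^2 = 1 - z. The clause on
    commutation holds because w is a limit of polynomials in z; it is what makes roots of commuting
    elements commute. *)
Lemma sqrt1B z : nrm z <= 1 -> z^c* = z -> exists w : U,
  [/\ w^c* = w, (1 - w) ^+ 2 = 1 - z & forall c, c * z = z * c -> c * w = w * c].
Proof.
move=> z1 zsa; pose u n := pev z (sqrt_approx n).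
have uB m n : nrm (u m - u n) <= `|(sqrt_approx m).[1] - (sqrt_approx n).[1]|.
  wlog mn : m n / (n <= m)%N => [hw|].
    by case/orP: (leq_total n m) => /hw//; rewrite nrmB distrC.
  rewrite /u -pevB (le_trans (pev_nneg_coef _ _))//; first exact: sqrt_approx_mono.
  by rewrite hornerD hornerN ler_norm.
have [|w uw] := @cauchy_unitz_cvg u.
  move=> e e0; have [N hN] := sqrt_approx_cauchy e0; exists N => m n Nm Nn.
  by rewrite (le_lt_trans (uB m n))// hN.
have lim e : 0 < e -> exists n, nrm (u n - w) < e /\ nrm (u n.+1 - w) < e.
  by move=> /uw[N hN]; exists N; rewrite !hN.
have u1 n : nrm (u n) <= 1.
  by rewrite (le_trans (pev_nneg_coef (sqrt_approx_nneg n) z1))// sqrt_approx_le1.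
have w1 : nrm w <= 1.
  apply/ler_addgt0Pl => e /lim[n [uwn _]].
  rewrite -(subrK (u n) w) (le_trans (nrmD _ _))// lerD// nrmB ltW//.
have usa n : (u n)^c* = u n by rewrite pev_star zsa.
exists w; split.
- apply/eqP; rewrite -subr_eq0; apply/eqP/(@nrm_small0 _ _ 2) => e /lim[n [uwn _]].
  rewrite (le_trans (nrm_triangle (u n) _ _))// mulr2n mulrDl !mul1r lerD//.
    by rewrite -usa -cstarB nrm_star nrmB ltW.
  exact: ltW.
- have wE : w = 2^-1%:C *: (z + w ^+ 2).
    apply/eqP; rewrite -subr_eq0; apply/eqP/(@nrm_small0 _ _ 2) => e /lim[n [uwn uwn1]].
    rewrite (le_trans (nrm_triangle (u n.+1) _ _))// mulr2n mulrDl !mul1r lerD//.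
      by rewrite nrmB ltW.
    rewrite /u /= -/(sqrt_approx n) pevZ pevD pevXn pevX -/(u n).
    rewrite -scalerBr opprD addrACA subrr add0r nrmZ nrm_real ger0_norm ?invr_ge0//.
    have -> : u n ^+ 2 - w ^+ 2 = u n * (u n - w) + (u n - w) * w.
      by rewrite mulrBr mulrBl addrA subrK -!expr2.
    rewrite mulrC ler_pdivrMr// (le_trans (nrmD _ _))// mulr_natr mulr2n lerD//.
      by rewrite (le_trans (unrmM _ _))// -[e]mul1r ler_pM ?nrm_ge0// ltW.
    by rewrite (le_trans (unrmM _ _))// -[e]mulr1 ler_pM ?nrm_ge0// ltW.
  have z2 : z = w + w - w ^+ 2.
    apply: (@addIr _ (w ^+ 2)); rewrite subrK; apply: (@scalerI _ _ 2^-1%:C).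
      by rewrite -nrm_eq0 nrm_real normr_eq0 invr_eq0.
    rewrite -wE scalerDr -scalerDl -rmorphD /= -[2^-1 + _]/(2^-1 + 2^-1 : R).
    have -> : (2^-1 + 2^-1 : R) = 1 by field.
    by rewrite scale1r.
  rewrite expr2 mulrBl !mulrBr !mulr1 mul1r -expr2 z2 !opprB !opprD ?opprK; zsum.
- move=> c cz; apply/eqP; rewrite -subr_eq0.
  apply/eqP/(@nrm_small0 _ _ (2 * nrm c)) => e /lim[n [uwn _]].
  have -> : c * w - w * c = c * (w - u n) - (w - u n) * c.
    by rewrite mulrBr mulrBl (pev_intertwine _ cz) opprB addrA subrK.
  rewrite (le_trans (nrmD _ _))// nrmN -(mulrA 2 (nrm c)) ler_add_double//.
    by rewrite (le_trans (unrmM _ _))// ler_wpM2l ?nrm_ge0// nrmB ltW.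
  by rewrite (le_trans (unrmM _ _))// mulrC ler_wpM2l ?nrm_ge0// nrmB ltW.
Qed.

End real_poly_calculus.

(** * The cone of positive elements, without spectra *)

Section positive_cone.
Context (R : realType) (A : cstarAlgType R).
Local Notation U := (unitz A).
Local Notation rsc := (@rsc R A).
Implicit Types (a b h x y z c : U) (s t : R).

Lemma rscM s t : rsc (s * t) = rsc s * rsc t. Proof. exact: rmorphM. Qed.

Lemma rscD s t : rsc (s + t) = rsc s + rsc t. Proof. exact: rmorphD. Qed.

Lemma rsc1 : rsc 1 = 1. Proof. exact: rmorph1. Qed.

Lemma rsc0 : rsc 0 = 0. Proof. exact: rmorph0. Qed.

Lemma rscX t n : rsc (t ^+ n) = rsc t ^+ n. Proof. exact: rmorphXn. Qed.

Lemma star_scale_real t x : (t%:C *: x)^c* = t%:C *: x^c*.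
Proof. by rewrite cstarZ conjC_real. Qed.

Lemma ustarX x n : (x ^+ n)^c* = x^c* ^+ n.
Proof. by elim: n => [|n IH]; rewrite ?expr0 ?ustar1// exprSr exprS ustarM IH. Qed.

Lemma nrm_scale_real t x : nrm (t%:C *: x) = `|t| * nrm x.
Proof. by rewrite nrmZ nrm_real. Qed.

(* [a + i b] is [t] times a unitary. *)
Lemma commuting_norm_le a b t : a^c* = a -> b^c* = b -> a * b = b * a -> 0 <= t ->
  a ^+ 2 + b ^+ 2 = rsc (t ^+ 2) -> nrm b <= t.
Proof.
move=> asa bsa ab t0 abt; pose u := a + 'i *: b.
have us : u^c* = a - 'i *: b.
  by rewrite cstarD cstarZ asa bsa conjC_i scaleNr.
have nu : nrm u = t.
  apply/eqP; rewrite -(@eqrXn2 _ 2) ?nrm_ge0//; apply/eqP.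
  rewrite -nrm_star_sq us ucmulE.
  have ii : 'i * 'i = -1 :> R[i] by rewrite -expr2 sqr_i.
  have -> : (a - 'i *: b) * u = rsc (t ^+ 2).
    rewrite -abt /u mulrBl !mulrDr -!scalerAl -!scalerAr ab scalerA ii.
    rewrite scaleN1r -!expr2 opprD opprK addrA; congr (_ + _).
    by rewrite -addrA subrr addr0.
  by rewrite nrm_rsc ger0_norm// exprn_ge0.
have : nrm (u - u^c*) <= 2 * t.
  by rewrite (le_trans (nrmD _ _))// nrmN nrm_star ler_add_double// nu.
have -> : u - u^c* = (2%:C * 'i) *: b.
  rewrite us /u opprB addrC addrA subrK -scalerDl; congr (_ *: _).
  by rewrite rmorphD mulrDl !mul1r.
by rewrite nrmZ nrmM_complex nrm_i mulr1 nrm_real ger0_norm// ler_pM2l.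
Qed.

(* Positivity without spectra: [x] lies in a ball of radius [t] around [t]. *)
Definition upos x := x^c* = x /\ exists t, nrm (rsc t - x) <= t.

Lemma upos_sa x : upos x -> x^c* = x. Proof. by case. Qed.

(** Write x = t (1 - z) with |z| <= 1 and multiply the root of 1 - z by sqrt t; for t = 0 the
    element is zero. *)
Lemma upos_sqrt x : upos x -> exists y,
  [/\ y^c* = y, y ^+ 2 = x & forall c, c * x = x * c -> c * y = y * c].
Proof.
move=> [xsa [t xt]]; have t0 : 0 <= t := le_trans (nrm_ge0 _) xt.
have [tz|tn0] := eqVneq t 0.
  have x0 : x = 0.
    move: xt; rewrite tz rsc0 sub0r nrmN => xt.
    by apply/eqP; rewrite -nrm_eq0 eq_le nrm_ge0 andbT.
  exists 0; split => [||c _]; first exact: cstar0; first by rewrite x0 expr0n.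
  by rewrite mulr0 mul0r.
pose z := t^-1%:C *: (rsc t - x).
have z1 : nrm z <= 1.
  by rewrite nrm_scale_real ger0_norm ?invr_ge0// mulrC ler_pdivrMr ?mul1r// lt_neqAle eq_sym tn0.
have zE : z = 1 - t^-1%:C *: x.
  rewrite /z scalerBr -[in X in X - _](mulr1 (rsc t)) rscl scalerA -rmorphM /=.
  by rewrite mulVf// scale1r.
have zsa : z^c* = z by rewrite star_scale_real cstarB star_rsc xsa.
have [w [wsa w2 wc]] := sqrt1B z1 zsa.
exists ((Num.sqrt t)%:C *: (1 - w)); split.
- by rewrite star_scale_real cstarB ustar1 wsa.
- rewrite exprZn w2 -rmorphXn /= sqr_sqrtr// zE subKr scalerA -rmorphM /=.
  by rewrite mulfV// scale1r.
- move=> c cx; rewrite -scalerAr -scalerAl mulrBr mulrBl mulr1 mul1r wc//.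
  by rewrite zE mulrBr mulrBl mulr1 mul1r -scalerAr -scalerAl cx.
Qed.

(** For v = y / sqrt t, [sqrt1B] gives a root 1 - w of 1 - v^2 that commutes with v. Then v^2 + (1 -
    w)^2 = 1, so |1 - w| <= 1, and its square (t - y^2) / t has norm at most 1. *)
Lemma usq_ball y t : y^c* = y -> 0 < t -> nrm y ^+ 2 <= t -> nrm (rsc t - y ^+ 2) <= t.
Proof.
move=> ysa t0 yt; pose v := (Num.sqrt t)^-1%:C *: y.
have vsa : v^c* = v by rewrite star_scale_real ysa.
have st0 : 0 < Num.sqrt t by rewrite sqrtr_gt0.
have v2 : v ^+ 2 = t^-1%:C *: y ^+ 2.
  by rewrite exprZn -rmorphXn /= exprVn sqr_sqrtr// ltW.
have v1 : nrm (v ^+ 2) <= 1.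
  rewrite v2 nrm_scale_real ger0_norm ?invr_ge0 ?(ltW t0)// mulrC ler_pdivrMr// mul1r.
  by rewrite (le_trans (nrmX _ _)).
have [|w [wsa w2 wc]] := sqrt1B v1; first by rewrite ustarX vsa.
have s1 : nrm (1 - w) <= 1.
  apply: (@commuting_norm_le v) => //.
  - by rewrite cstarB ustar1 wsa.
  - by rewrite mulrBr mulrBl mulr1 mul1r wc// -exprS -exprSr.
  - by rewrite w2 addrC subrK expr1n rsc1.
have -> : rsc t - y ^+ 2 = t%:C *: (1 - w) ^+ 2.
  rewrite w2 v2 scalerBr scalerA -rmorphM /= mulfV ?gt_eqF// scale1r.
  by rewrite -rscl mulr1.
rewrite nrm_scale_real gtr0_norm// -[leRHS]mulr1 ler_pM2l//.
by rewrite (le_trans (nrmX _ _))// exprn_ile1// nrm_ge0.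
Qed.

Lemma upos_sq y : y^c* = y -> upos (y ^+ 2).
Proof.
move=> ysa; split; first by rewrite ustarX ysa.
exists (nrm y ^+ 2 + 1); apply: usq_ball => //; last by rewrite lerDl.
by rewrite ltr_wpDl// sqr_ge0.
Qed.

Lemma uposD x y : upos x -> upos y -> upos (x + y).
Proof.
move=> [xsa [s xs]] [ysa [t yt]]; split; first by rewrite cstarD xsa ysa.
exists (s + t); rewrite rscD opprD addrACA (le_trans (nrmD _ _))//.
by rewrite lerD.
Qed.

Lemma uposZ t x : 0 <= t -> upos x -> upos (t%:C *: x).
Proof.
move=> t0 [xsa [s xs]]; split; first by rewrite star_scale_real xsa.
exists (t * s); rewrite rscM rscl -scalerBr nrm_scale_real ger0_norm//.
by rewrite ler_wpM2l.
Qed.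

Lemma upos1 : upos 1.
Proof. by rewrite -(expr1n _ 2); apply/upos_sq/ustar1. Qed.

Lemma upos0 : upos 0.
Proof. by split; [exact: cstar0|exists 0; rewrite rsc0 subrr nrm0]. Qed.

Lemma upos_rsc t : 0 <= t -> upos (rsc t).
Proof. by move=> t0; apply/uposZ/upos1. Qed.

Lemma upos_sum (I : Type) (r : seq I) (P : pred I) (F : I -> U) :
  (forall i, P i -> upos (F i)) -> upos (\sum_(i <- r | P i) F i).
Proof. by move=> F0; elim/big_rec : _ => [|i y /F0 ? ?]; [exact: upos0|exact: uposD]. Qed.

Lemma uposM x y : upos x -> upos y -> x * y = y * x -> upos (x * y).
Proof.
move=> /upos_sqrt[a [asa <- ac]] /upos_sqrt[b [bsa <- bc]] xy.
have ab : a * b = b * a by apply/bc/esym/ac.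
have -> : a ^+ 2 * b ^+ 2 = (a * b) ^+ 2.
  by rewrite !expr2 -!mulrA; congr (_ * _); rewrite !mulrA ab.
by apply: upos_sq; rewrite ustarM asa bsa ab.
Qed.

Lemma uposX x n : upos x -> upos (x ^+ n).
Proof.
move=> x0; elim: n => [|n IH]; first exact: upos1.
by rewrite exprS; apply: uposM => //; rewrite -exprS exprSr.
Qed.

(** x is a square y^2 with |y|^2 = |x|, so [usq_ball] applies to every t > 0 that bounds the norm;
    otherwise t = 0 and x = 0. *)
Lemma upos_ball x t : upos x -> nrm x <= t -> nrm (rsc t - x) <= t.
Proof.
move=> /upos_sqrt[y [ysa <- _]].
have y2 : nrm (y ^+ 2) = nrm y ^+ 2 by rewrite -nrm_star_sq ysa.
rewrite y2 => yt; have [t0|] := ltP 0 t; first exact: usq_ball.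
move=> t0; have y0 : y = 0.
  apply/eqP; rewrite -nrm_eq0 -sqrf_eq0 eq_le sqr_ge0 andbT.
  exact: le_trans yt t0.
have -> : t = 0 by apply/eqP; rewrite eq_le t0 (le_trans _ yt)// sqr_ge0.
by rewrite y0 rsc0 expr0n subrr nrm0.
Qed.

Lemma upos_of_nrm x t : x^c* = x -> nrm x <= t -> upos (rsc t - x) /\ upos (rsc t + x).
Proof.
move=> xsa xt; split; split; rewrite ?cstarB ?cstarD ?star_rsc ?xsa//; exists t.
  by rewrite subKr.
by rewrite opprD addNKr nrmN.
Qed.

(** The commuting positive elements t - x and t + x have product t^2 - x^2; with v its root, v^2 +
    x^2 = t^2 and [commuting_norm_le] bounds x. Order bounds thus take the place of the spectral
    radius. *)
Lemma nrm_le_of_upos x t : 0 <= t -> upos (rsc t - x) -> upos (rsc t + x) -> nrm x <= t.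
Proof.
move=> t0 xm xp; have xsa : x^c* = x.
  have := upos_sa xp; rewrite cstarD star_rsc; exact: addrI.
have tx : rsc t * x = x * rsc t by rewrite rscC.
have p : upos ((rsc t - x) * (rsc t + x)).
  by apply: uposM => //; rewrite !mulrDl !mulrDr !mulrN !mulNr tx; zsum.
have pE : (rsc t - x) * (rsc t + x) = rsc (t ^+ 2) - x ^+ 2.
  by rewrite mulrBl !mulrDr tx rscX !expr2 opprD addrA addrK.
have [v [vsa v2 vc]] := upos_sqrt p.
apply: (@commuting_norm_le v) => //; last by rewrite v2 pE subrK.
by apply/esym/vc; rewrite pE mulrBr mulrBl rscC -exprS -exprSr.
Qed.

Lemma upos_anti x : upos x -> upos (- x) -> x = 0.
Proof.
move=> x0 xN; apply/nrm0_eq0/eqP; rewrite eq_le nrm_ge0 andbT.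
by apply: nrm_le_of_upos; rewrite ?rsc0 ?add0r.
Qed.

End positive_cone.

(** * Bernstein polynomials and the Weierstrass theorem on [0, 1] *)

Section bernstein.
Context (R : realType).
Implicit Types (x t : R) (f : R -> R) (n k j : nat).

Definition bernstein n k : {poly R} := 'C(n, k)%:R *: ('X^k * (1 - 'X) ^+ (n - k)).

Lemma bernstein_ge0 n k x : 0 <= x <= 1 -> 0 <= (bernstein n k).[x].
Proof.
move=> /andP[x0 x1]; rewrite hornerZ hornerM !horner_exp hornerD hornerN hornerX hornerC.
by rewrite !mulr_ge0// exprn_ge0// subr_ge0.
Qed.

Lemma mul_bin_bin n k j : (k <= n)%N -> (j <= k)%N ->
  ('C(n, k) * 'C(k, j) = 'C(n, j) * 'C(n - j, k - j))%N.
Proof.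
move=> kn jk; have jn := leq_trans jk kn.
have h1 := bin_fact kn; have h2 := bin_fact jk; have h3 := bin_fact jn.
have := bin_fact (leq_sub2r j kn); rewrite subnBA// subnK// => h4.
apply/eqP; rewrite -(@eqn_pmul2r (j`! * (k - j)`! * (n - k)`!)%N) ?muln_gt0 ?fact_gt0//.
apply/eqP; transitivity (n`!).
  by rewrite -h1 -h2; ring.
by rewrite -h3 -h4; ring.
Qed.

(** Factorial moments of the binomial distribution; read backwards, the Bernstein coefficients of
    X^j are the ratios C(k, j) / C(n, j). *)
Lemma sum_bin_bernstein n j :
  \sum_(k < n.+1) 'C(k, j)%:R *: bernstein n k = 'C(n, j)%:R *: 'X^j.
Proof.
have [jn|nj] := leqP j n; last first.
  rewrite bin_small// scale0r big1// => k _.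
  by rewrite bin_small ?scale0r// (leq_ltn_trans _ nj)// -ltnS.
rewrite -(big_mkord xpredT (fun k => 'C(k, j)%:R *: bernstein n k)).
rewrite (@big_cat_nat _ _ _ j)//= ?(leqW jn)// big_nat big1 ?add0r; last first.
  by move=> k /andP[_ kj]; rewrite bin_small// scale0r.
rewrite -{1}[j]add0n big_addn subSn// big_mkord.
transitivity ('C(n, j)%:R *: ('X^j * (1 - 'X + 'X : {poly R}) ^+ (n - j))).
  rewrite exprDn mulr_sumr scaler_sumr; apply: eq_bigr => i _.
  have ijn : (i + j <= n)%N by rewrite addnC -leq_subRL// -ltnS.
  rewrite scalerA -natrM mulnC mul_bin_bin// ?leq_addl// addnK natrM -scalerA.
  congr (_ *: _); rewrite scaler_nat mulrnAr; congr (_ *+ _).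
  by rewrite addnC subnDA exprD -mulrA [_ * 'X^i]mulrC.
by rewrite subrK expr1n mulr1.
Qed.

Lemma bernstein_sum1 n : \sum_(k < n.+1) bernstein n k = 1.
Proof.
have := @sum_bin_bernstein n 0.
rewrite bin0 scale1r expr0 => <-; apply: eq_bigr => k _.
by rewrite bin0 scale1r.
Qed.

Lemma bin_ratio_le1 n k j : (k <= n)%N -> (j <= n)%N ->
  0 <= ('C(k, j)%:R / 'C(n, j)%:R : R) <= 1.
Proof.
move=> kn jn; rewrite divr_ge0//= ler_pdivrMr ?ltr0n ?bin_gt0//.
by rewrite mul1r ler_nat leq_bin2l.
Qed.

Lemma bin_ratio_approx n k j : (k <= n)%N -> (j < n)%N ->
  `|'C(k, j)%:R / 'C(n, j)%:R - (k%:R / n%:R) ^+ j| <= (j * j)%:R / (n - j)%:R :> R.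
Proof.
move=> kn; elim: j => [|j IH] jn.
  by rewrite !bin0 expr0 divr1 subrr normr0 mul0r.
have jn' : (j < n)%N := ltnW jn.
have n0 : (0 < n)%N := leq_ltn_trans (leq0n _) jn.
set x : R := k%:R / n%:R; set r : R := 'C(k, j)%:R / 'C(n, j)%:R.
have x01 : 0 <= x <= 1.
  by rewrite divr_ge0//= ler_pdivrMr ?ltr0n// mul1r ler_nat.
have /andP[r0 r1] : 0 <= r <= 1 := bin_ratio_le1 kn (ltnW jn').
have rS : 'C(k, j.+1)%:R / 'C(n, j.+1)%:R = r * ((k%:R - j%:R) / (n%:R - j%:R)) :> R.
  have bE m : 'C(m, j.+1)%:R = 'C(m, j)%:R * (m%:R - j%:R) / j.+1%:R :> R.
    apply: (@mulIf _ j.+1%:R); rewrite ?pnatr_eq0// divfK ?pnatr_eq0//.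
    have [mj|jm] := ltnP m j; first by rewrite !bin_small ?mul0r// ltnW.
    by rewrite -natrB// -!natrM mulnC mul_bin_left mulnC.
  have nj : n%:R - j%:R != 0 :> R by rewrite -natrB ?pnatr_eq0 ?subn_eq0 -?ltnNge// ltnW.
  have cn : 'C(n, j)%:R != 0 :> R by rewrite pnatr_eq0 -lt0n bin_gt0 ltnW.
  have j1 : j.+1%:R != 0 :> R by rewrite pnatr_eq0.
  by rewrite !bE /r; field; rewrite nj cn /= addrC natr1.
have close : r * `|(k%:R - j%:R) / (n%:R - j%:R) - x| <= j%:R / (n - j)%:R.
  have [kj|jk] := ltnP k j.
    by rewrite /r bin_small// !mul0r divr_ge0.
  have nj : 0 < (n - j)%:R :> R by rewrite ltr0n subn_gt0.
  have -> : (k%:R - j%:R) / (n%:R - j%:R) - x = - (j%:R / (n - j)%:R) * ((n - k)%:R / n%:R) :> R.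
    have njR : n%:R - j%:R != 0 :> R by rewrite -natrB ?(ltnW jn')// gt_eqF.
    have nR : n%:R != 0 :> R by rewrite pnatr_eq0 -lt0n.
    by rewrite /x !natrB ?(ltnW jn')//; field; rewrite nR njR.
  rewrite normrM normrN !ger0_norm ?divr_ge0//.
  rewrite mulrCA ler_piMr ?divr_ge0// mulr_ile1 ?divr_ge0//.
  by rewrite ler_pdivrMr ?ltr0n// mul1r ler_nat leq_subr.
rewrite rS exprS.
have -> : r * ((k%:R - j%:R) / (n%:R - j%:R)) - x * x ^+ j =
    r * ((k%:R - j%:R) / (n%:R - j%:R) - x) + x * (r - x ^+ j) by ring.
rewrite (le_trans (ler_normD _ _))// (normrM r) (normrM x) (ger0_norm r0) (ger0_norm (proj1 (andP x01))).
apply: (@le_trans _ _ (j%:R / (n - j)%:R + (j * j)%:R / (n - j)%:R)).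
  rewrite lerD// (le_trans _ (IH jn'))// ler_piMl//.
  by case/andP: x01.
rewrite -mulrDl -natrD ler_pM ?invr_ge0//.
  by rewrite ler_nat; nia.
by rewrite lef_pV2 ?posrE ?ltr0n ?subn_gt0// ler_nat leq_sub2l.
Qed.

(* [p] is the Bernstein polynomial of a function on the grid [k / n] that is
   uniformly close to [p]. *)
Lemma poly_bernstein (p : {poly R}) (e : R) : 0 < e -> exists n (g : nat -> R),
  p = \sum_(k < n.+1) g k *: bernstein n k /\
  forall k, (k <= n)%N -> `|g k - p.[k%:R / n%:R]| <= e.
Proof.
move=> e0; pose d := size p; pose C := \sum_(i < d) `|p`_i|.
have C0 : 0 <= C by apply: sumr_ge0 => i _.
have [N hN] : exists N : nat, C * (d * d)%:R / e < N%:R.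
  by exists (Num.bound (C * (d * d)%:R / e)); rewrite archi_boundP// divr_ge0 ?mulr_ge0// ltW.
(* Then n - j > N for every exponent j < d, which brings the error C d^2 / (n - j) below [e]. *)
pose n := (N + d).+1.
exists n, (fun k => \sum_(j < d) p`_j * ('C(k, j)%:R / 'C(n, j)%:R)); split.
  rewrite -[LHS]coefK poly_def -/d.
  under [RHS]eq_bigr do rewrite scaler_suml.
  rewrite exchange_big /=; apply: eq_bigr => j _.
  have jn : (j <= n)%N by rewrite ltnW// ltnS (leq_trans (ltnW (ltn_ord j)))// leq_addl.
  have cn : 'C(n, j)%:R != 0 :> R by rewrite pnatr_eq0 -lt0n bin_gt0.
  under eq_bigr do rewrite mulrCA mulrC -scalerA -scalerA.
  rewrite -scaler_sumr.
  rewrite -(scalerK cn 'X^j) -sum_bin_bernstein scalerA scaler_sumr.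
  rewrite scaler_sumr; apply: eq_bigr => k _.
  by rewrite !scalerA; congr (_ *: _); ring.
move=> k kn; rewrite horner_coef -sumrB.
rewrite (le_trans (ler_norm_sum _ _ _))//.
apply: (@le_trans _ _ (\sum_(j < d) `|p`_j| * ((d * d)%:R / N%:R))).
  apply: ler_sum => j _; rewrite -mulrBr normrM ler_wpM2l//.
  have jd : (j <= d)%N := ltnW (ltn_ord j).
  rewrite (le_trans (bin_ratio_approx _ _))//; first by rewrite ltnS (leq_trans jd)// leq_addl.
  have [N0|N0] := posnP N.
    move: hN; rewrite N0 mulr0n => hN; exfalso; move: hN; rewrite ltNge.
    by rewrite divr_ge0 ?mulr_ge0// ltW.
  rewrite ler_pM ?invr_ge0//; first by rewrite ler_nat leq_mul.
  rewrite lef_pV2 ?posrE ?ltr0n ?subn_gt0//; last by rewrite ltnS (leq_trans jd)// leq_addl.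
  by rewrite ler_nat /n; lia.
rewrite -mulr_suml -/C; have [N0|N0] := posnP N.
  by rewrite N0 invr0 !mulr0 ltW.
by rewrite mulrA ler_pdivrMr ?ltr0n// [e * _]mulrC -ler_pdivrMr// ltW.
Qed.

Lemma bernstein_variance n x : (0 < n)%N ->
  \sum_(k < n.+1) (k%:R / n%:R - x) ^+ 2 * (bernstein n k).[x] = x * (1 - x) / n%:R.
Proof.
move=> n0; have n0R : n%:R != 0 :> R by rewrite pnatr_eq0 -lt0n.
have moment j :
    \sum_(k < n.+1) 'C(k, j)%:R * (bernstein n k).[x] = 'C(n, j)%:R * x ^+ j.
  have := congr1 (fun p : {poly R} => p.[x]) (sum_bin_bernstein n j).
  rewrite hornerZ hornerXn horner_sum => <-.
  by apply: eq_bigr => k _; rewrite hornerZ.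
have m0 : \sum_(k < n.+1) (bernstein n k).[x] = 1.
  have := moment 0%N; rewrite bin0 mul1r expr0 => <-.
  by apply: eq_bigr => k _; rewrite bin0 mul1r.
have m1 : \sum_(k < n.+1) k%:R * (bernstein n k).[x] = n%:R * x.
  have := moment 1%N; rewrite bin1 expr1 => <-.
  by apply: eq_bigr => k _; rewrite bin1.
have bin2E m : m%:R ^+ 2 = 2 * 'C(m, 2)%:R + m%:R :> R.
  rewrite -natrM -natrX -natrD; congr (_%:R).
  have := mul_bin_left m 1; rewrite bin1 => ->.
  by case: m => // m; rewrite subn1 /=; ring.
have m2 : \sum_(k < n.+1) k%:R ^+ 2 * (bernstein n k).[x] =
    (n%:R ^+ 2 - n%:R) * x ^+ 2 + n%:R * x.
  under eq_bigr do rewrite bin2E mulrDl -mulrA.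
  rewrite big_split /= -mulr_sumr m1; congr (_ + _).
  by rewrite moment bin2E addrK mulrA.
transitivity (\sum_(k < n.+1) (n%:R ^- 2 * (k%:R ^+ 2 * (bernstein n k).[x]) -
    (2 * x / n%:R) * (k%:R * (bernstein n k).[x]) + x ^+ 2 * (bernstein n k).[x])).
  by apply: eq_bigr => k _; field.
rewrite big_split sumrB /= -!mulr_sumr m0 m1 m2; field.
exact: n0R.
Qed.

Lemma unif_continuous01 f (e : R) : continuous f -> 0 < e -> exists2 d, 0 < d &
  forall x y, 0 <= x <= 1 -> `|x - y| < d -> `|f x - f y| < e.
Proof.
move=> fc e0; have K := @segment_compact R 0 1.
(* The radius is the parameter of the near-covering, so that radii valid near each point become a
   uniform one. *)
have /compact_near_coveringP/(_ _ (0^'+) (fun d x => forall y, `|x - y| < d -> `|f x - f y| < e)) := K.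
case.
- move=> x _; have e2 : 0 < e / 2 by rewrite divr_gt0.
  have /cvgrPdist_lt/(_ _ e2)/nbhs_ballP[d /= d0 hd] := fc x.
  have d2 : 0 < d / 2 by rewrite divr_gt0.
  near=> x' d'; move=> y x'y /=.
  have xx' : `|x - x'| < d / 2.
    by near: x'; apply: nbhsx_ballx.
  have d'd : d' < d / 2 by near: d'; exact: nbhs_right_lt.
  rewrite -(subrKA (f x)) (le_lt_trans (ler_normD _ _))// (splitr e) ltrD//.
    by rewrite distrC hd// -ball_normE /= (lt_trans xx')// ltr_pdivrMr// ltr_pMr// ltr1n.
  rewrite hd// -ball_normE /= -(subrKA x') (le_lt_trans (ler_normD _ _))//.
  by rewrite (splitr d) ltrD// (lt_trans x'y).
move=> d /= d0 hd; exists (d / 2); first by rewrite divr_gt0.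
move=> x y x01; apply: (hd (d / 2)) => //=; rewrite ?divr_gt0//.
  by rewrite sub0r normrN gtr0_norm ?divr_gt0// ltr_pdivrMr// ltr_pMr// ltr1n.
Unshelve. all: by end_near. Qed.

(** Bernstein's argument: terms with k / n near x are controlled by uniform continuity, the others
    by Chebyshev's inequality and the variance. *)
Lemma weierstrass01 f (e : R) : continuous f -> 0 < e -> exists p : {poly R},
  forall x, 0 <= x <= 1 -> `|f x - p.[x]| <= e.
Proof.
move=> fc e0; have e2 : 0 < e / 2 by rewrite divr_gt0.
have [d d0 hd] := unif_continuous01 fc e2.
have [M M0 hM] : exists2 M : R, 0 < M & forall x, 0 <= x <= 1 -> `|f x| <= M.
  have [|M [_ hM]] := @compact_bounded _ _ (f @` `[0, 1]).
    apply: continuous_compact; last exact: segment_compact.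
    exact: continuous_subspaceT.
  exists (Num.max M 0 + 1) => [|x x01]; first by rewrite ltr_wpDl// le_max lexx orbT.
  apply: hM; first by rewrite ltr_pwDr// le_max lexx.
  by exists x.
(* For |x - k / n| >= d one has |f x - f (k / n)| <= 2 M <= C (x - k / n)^2, and the variance x (1 -
   x) / n makes the total at most C / n. *)
pose C := 2 * M / d ^+ 2.
have C0 : 0 <= C by rewrite divr_ge0 ?mulr_ge0 ?exprn_ge0// ltW.
have [n n0 hn] : exists2 n : nat, (0 < n)%N & C / n%:R <= e / 2.
  exists (Num.bound (C / (e / 2))).+1 => //.
  have h : C / (e / 2) < (Num.bound (C / (e / 2)))%:R.
    by apply: archi_boundP; rewrite divr_ge0// ltW.
  rewrite ler_pdivrMr ?ltr0n// mulrC -ler_pdivrMr// ltW//.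
  by rewrite (lt_trans h)// ltr_nat.
exists (\sum_(k < n.+1) f (k%:R / n%:R) *: bernstein n k) => x x01.
have b0 k := bernstein_ge0 n k x01.
have s1 : \sum_(k < n.+1) (bernstein n k).[x] = 1.
  by rewrite -horner_sum bernstein_sum1 hornerC.
rewrite -[f x]mulr1 -{1}s1 mulr_sumr horner_sum -sumrB.
rewrite (le_trans (ler_norm_sum _ _ _))//.
apply: (@le_trans _ _ (\sum_(k < n.+1) (e / 2 * (bernstein n k).[x] +
    C * ((k%:R / n%:R - x) ^+ 2 * (bernstein n k).[x])))).
  apply: ler_sum => k _; rewrite (hornerZ (f _)) -mulrBl normrM (ger0_norm (b0 _)) mulrA -mulrDl.
  rewrite ler_wpM2r//; have [xk|xk] := ltP `|x - k%:R / n%:R| d.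
    by rewrite (le_trans (ltW (hd _ _ x01 xk)))// lerDl mulr_ge0// sqr_ge0.
  apply: (@le_trans _ _ (2 * M)).
    rewrite (le_trans (ler_normB _ _))// ler_add_double// hM//.
    by rewrite divr_ge0//= ler_pdivrMr ?ltr0n// mul1r ler_nat -ltnS.
  apply: (@le_trans _ _ (C * (k%:R / n%:R - x) ^+ 2)); last by rewrite lerDr ltW.
  rewrite /C mulrAC ler_pdivlMr ?exprn_gt0// ler_pM2l ?mulr_gt0//.
  by rewrite -[(_ - x) ^+ 2]real_normK ?num_real// distrC ler_pXn2r// nnegrE ltW.
rewrite big_split /= -!mulr_sumr s1 mulr1 bernstein_variance// [leRHS]splitr lerD2l.
rewrite (le_trans _ hn)// mulrA ler_wpM2r ?invr_ge0// ler_piMr//.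
case/andP: x01 => x0 x1; rewrite mulr_ile1// ?subr_ge0// gerBl//.
Qed.

End bernstein.

(** * Operations on continuous functions, and approximation on symmetric intervals *)

Section continuous_real_functions.
Context (R : realType).
Implicit Types (f g : R -> R) (t : R).

Lemma cont_cst t : continuous (fun _ : R => t).
Proof. by move=> x; exact: cvg_cst. Qed.

Lemma cont_id : continuous (fun x : R => x).
Proof. by move=> x; exact: cvg_id. Qed.

Lemma contD f g : continuous f -> continuous g -> continuous (fun x : R => f x + g x).
Proof. by move=> fc gc x; apply: cvgD; [exact: fc|exact: gc]. Qed.

Lemma contN f : continuous f -> continuous (fun x : R => - f x).
Proof. by move=> fc x; apply: cvgN; exact: fc. Qed.

Lemma contM f g : continuous f -> continuous g -> continuous (fun x : R => f x * g x).
Proof. by move=> fc gc x; apply: cvgM; [exact: fc|exact: gc]. Qed.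

Lemma contX f n : continuous f -> continuous (fun x : R => f x ^+ n).
Proof.
move=> fc; elim: n => [|n IH].
  by rewrite (_ : (fun _ => _) = fun=> 1); [exact: cont_cst|apply/funext].
rewrite (_ : (fun _ => _) = fun x => f x * f x ^+ n); first exact: contM.
by apply/funext => x; rewrite exprS.
Qed.

Lemma cont_comp f g : continuous f -> continuous g -> continuous (fun x : R => f (g x)).
Proof. by move=> fc gc x; exact: (continuous_comp (gc x) (fc (g x))). Qed.

Lemma cont_norm f : continuous f -> continuous (fun x : R => `|f x|).
Proof. by move=> fc x; apply: cvg_norm; exact: fc. Qed.

Lemma cont_sqrt f : continuous f -> continuous (fun x : R => Num.sqrt (f x)).
Proof. by move=> fc; apply: (cont_comp (@sqrt_continuous R)). Qed.

Lemma cont_max f g : continuous f -> continuous g -> continuous (fun x : R => Num.max (f x) (g x)).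
Proof.
move=> fc gc.
rewrite (_ : (fun _ => _) = fun x => (f x + g x + `|f x + (- g x)|) * 2^-1).
  by apply: contM; [exact/contD/cont_norm/contD/contN/gc/fc/contD|exact: cont_cst].
by apply/funext => x; rewrite maxr_absE.
Qed.

Lemma cont_inv f : (forall x, f x != 0) -> continuous f -> continuous (fun x => (f x)^-1).
Proof. by move=> f0 fc x; apply: cvgV; [exact: f0|exact: fc]. Qed.

Lemma cont_horner (p : {poly R}) : continuous (fun x : R => p.[x]).
Proof. by move=> x; exact: continuous_horner. Qed.

Lemma cont_bounded f (r : R) : continuous f -> exists2 M, 0 < M &
  forall x : R, `|x| <= r -> `|f x| <= M.
Proof.
move=> fc.
have [|M [_ hM]] := @compact_bounded _ _ (f @` `[- r, r]).
  apply: continuous_compact; last exact: segment_compact.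
  exact: continuous_subspaceT.
exists (Num.max M 0 + 1) => [|x xr]; first by rewrite ltr_wpDl// le_max lexx orbT.
apply: hM; first by rewrite ltr_pwDr// le_max lexx.
by exists x => //=; rewrite in_itv /= -ler_norml.
Qed.

Lemma weierstrass f (r e : R) : continuous f -> 0 < e -> exists p : {poly R},
  forall x : R, `|x| <= r -> `|f x - p.[x]| <= e.
Proof.
(* The maximum with 1 keeps the affine change of variable onto [0, 1] invertible for every [r]. *)
move=> fc e0; pose s := Num.max r 1.
have s0 : 0 < s by rewrite lt_max ltr01 orbT.
have [||p hp] := @weierstrass01 _ (fun t => f (2 * s * t - s)) e => //.
  by apply: cont_comp => //; apply: contD; [apply: contM; [exact: cont_cst|exact: cont_id]|exact: cont_cst].
exists (p \Po ((2 * s)^-1 *: ('X + s%:P))) => x xr.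
have xs : `|x| <= s by rewrite le_max xr.
rewrite horner_comp hornerZ hornerD hornerX hornerC.
have {1}-> : x = 2 * s * ((2 * s)^-1 * (x + s)) - s.
  by field; rewrite gt_eqF.
apply: hp; move: xs; rewrite ler_norml => /andP[sx xs].
rewrite mulr_ge0 ?invr_ge0 ?mulr_ge0 ?(ltW s0)//=; last by lra.
by rewrite ler_pdivrMl ?mulr_gt0//; lra.
Qed.

End continuous_real_functions.

Lemma natr_ratio01 (R : realFieldType) (m n : nat) : (m <= n)%N ->
  0 <= (m%:R / n%:R : R) <= 1.
Proof.
move=> mn; rewrite divr_ge0//=; have [->|n0] := posnP n; first by rewrite invr0 mulr0.
by rewrite ler_pdivrMr ?ltr0n// mul1r ler_nat.
Qed.

(** * Continuous functional calculus in the unitization *)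

Section functional_calculus.
Context (R : realType) (A : cstarAlgType R).
Local Notation U := (unitz A).
Local Notation rsc := (@rsc R A).
Implicit Types (a h x y z : U) (s t : R) (f g : R -> R) (p q : {poly R}).

(** In the Bernstein basis p(h) is a combination of positive elements that sum to 1, with
    coefficients within e of values of p on a grid. Hence M + e - p(h) and M + e + p(h) are sums of
    positive elements and [nrm_le_of_upos] concludes. This is the spectral estimate, obtained
    without spectra. *)
Lemma pev_norm01 h p (M : R) : upos h -> upos (1 - h) ->
  (forall x : R, 0 <= x <= 1 -> `|p.[x]| <= M) -> nrm (pev h p) <= M.
Proof.
move=> h0 h1 pM; apply/ler_addgt0Pl => e e0.
have [n [g [pE gp]]] := poly_bernstein p e0.
have b0 k : upos (pev h (bernstein R n k)).
  rewrite pevZ pevM !pevXn pevB pev1 pevX; apply: uposZ => //.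
  apply: uposM; [exact: uposX|exact: uposX|].
  have hc : h * (1 - h) = (1 - h) * h by rewrite mulrBr mulrBl mulr1 mul1r.
  by apply: commrX; apply/commr_sym/commrX.
have gM (k : 'I_n.+1) : `|g k| <= M + e.
  have kn : (k <= n)%N by rewrite -ltnS.
  rewrite -(subrK p.[k%:R / n%:R] (g k)) (le_trans (ler_normD _ _))// addrC lerD//.
    exact/pM/natr_ratio01.
  exact: gp.
have peE : pev h p = \sum_(k < n.+1) (g k)%:C *: pev h (bernstein R n k).
  rewrite pE (big_morph (pev h) (pevD h) (pev0 h)).
  by apply: eq_bigr => k _; rewrite pevZ.
have oneE t : rsc t = \sum_(k < n.+1) t%:C *: pev h (bernstein R n k).
  rewrite -scaler_sumr -(big_morph (pev h) (pevD h) (pev0 h)) bernstein_sum1.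
  by rewrite pev1.
rewrite addrC; apply: nrm_le_of_upos.
- by rewrite (le_trans _ (gM ord0)).
- rewrite oneE peE -sumrB; apply: upos_sum => k _.
  rewrite -scalerBl -rmorphB /=; apply: uposZ => //; rewrite subr_ge0.
  by rewrite (le_trans (ler_norm _)).
- rewrite oneE peE -big_split; apply: upos_sum => k _ /=.
  rewrite -scalerDl -rmorphD /=; apply: uposZ => //; rewrite -lerBlDr sub0r.
  by rewrite (le_trans _ (gM k))// -normrN ler_norm.
Qed.

Lemma pev_norm h p (M : R) : h^c* = h ->
  (forall x : R, `|x| <= nrm h -> `|p.[x]| <= M) -> nrm (pev h p) <= M.
Proof.
move=> hsa pM; have [h0|h0] := eqVneq h 0.
  have -> : pev h p = rsc p.[0].
    rewrite h0; elim/poly_ind : p {pM} => [|p t _]; first by rewrite pev0 horner0 rsc0.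
    by rewrite pevD pevM pevX pevC mulr0 add0r hornerD hornerM hornerX mulr0 add0r hornerC.
  by rewrite nrm_rsc pM// normr0 nrm_ge0.
set r := nrm h in pM *.
have r0 : 0 < r by rewrite lt_neqAle nrm_ge0 eq_sym nrm_eq0 h0.
have [hm hp] := upos_of_nrm hsa (lexx r).
have r20 : 0 <= (2 * r)^-1 by rewrite invr_ge0 mulr_ge0// ltW.
have half : (2 * r)^-1%:C *: rsc (2 * r) = 1.
  by rewrite -rscl -rscM mulVf ?rsc1// mulf_neq0 ?gt_eqF.
pose h' := pev h ((2 * r)^-1 *: ('X + r%:P)).
have h'E : h' = (2 * r)^-1%:C *: (rsc r + h).
  by rewrite /h' pevZ pevD pevX pevC addrC.
have h'0 : upos h' by rewrite h'E; exact: uposZ.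
have h'1 : upos (1 - h').
  have -> : 1 - h' = (2 * r)^-1%:C *: (rsc r - h).
    rewrite h'E -half -scalerBr; congr (_ *: _).
    by rewrite mulr2n mulrDl mul1r rscD opprD addrA addrK.
  exact: uposZ.
(* The affine map sends [-r, r] onto [0, 1] and [h] to [h'], which reduces the claim to
   [pev_norm01]. *)
have -> : p = (p \Po ((2 * r) *: 'X - r%:P)) \Po ((2 * r)^-1 *: ('X + r%:P)).
  rewrite -comp_polyA comp_polyB comp_polyZ comp_polyX comp_polyC scalerA.
  by rewrite mulfV ?mulf_neq0 ?gt_eqF// scale1r addrK comp_polyXr.
rewrite pev_comp -/h'; apply: pev_norm01 => // x /andP[x0 x1].
rewrite horner_comp hornerD hornerN hornerC hornerZ hornerX; apply: pM.
rewrite ler_norml; apply/andP; split.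
  by rewrite lerBrDl subrr !mulr_ge0// ltW.
by have := ler_wpM2l (ltW r0) x1; lra.
Qed.

(** Says that [l] is f(h), with [-|h|, |h|] in the role of the spectrum. Quantifying over all
    polynomials frees the definition from a chosen approximating sequence. *)
Definition is_fc h f (l : U) := forall (e : R) p,
  (forall x : R, `|x| <= nrm h -> `|f x - p.[x]| <= e) -> nrm (l - pev h p) <= e.

Lemma is_fc_ex h f : h^c* = h -> continuous f -> exists l, is_fc h f l.
Proof.
move=> hsa fc.
have d0 n : 0 < n.+1%:R^-1 :> R by rewrite invr_gt0 ltr0n.
have /choice[p hp] n := weierstrass (nrm h) fc (d0 n).
have close (q1 q2 : {poly R}) e1 e2 :
    (forall x : R, `|x| <= nrm h -> `|f x - q1.[x]| <= e1) ->
    (forall x : R, `|x| <= nrm h -> `|f x - q2.[x]| <= e2) ->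
    nrm (pev h q1 - pev h q2) <= e1 + e2.
  move=> h1 h2; rewrite -pevB; apply: pev_norm => // x xh.
  rewrite hornerD hornerN -(subrKA (f x)) (le_trans (ler_normD _ _))// lerD ?h2//.
  by rewrite distrC h1.
have archi (e : R) : 0 < e -> exists N, forall n, (N <= n)%N -> n.+1%:R^-1 < e.
  move=> e0; have [N _ hN] := near_infty_natSinv_lt (PosNum e0).
  by exists N.
have [|l hl] := @cauchy_unitz_cvg R A (fun n => pev h (p n)).
  move=> e e0; have [N hN] := archi _ (divr_gt0 e0 (ltr0n _ 2)).
  exists N => m n Nm Nn; rewrite (le_lt_trans (close _ _ _ _ (hp m) (hp n)))//.
  by rewrite (splitr e) ltrD// hN.
exists l => e q hq; apply/ler_addgt0Pr => d d_gt0.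
have [N1 h1] := archi _ (divr_gt0 d_gt0 (ltr0n _ 2)).
have [N2 h2] := hl _ (divr_gt0 d_gt0 (ltr0n _ 2)).
set n := maxn N1 N2.
rewrite (le_trans (nrm_triangle (pev h (p n)) _ _))//.
rewrite (splitr d) addrCA lerD//.
  by rewrite nrmB ltW// h2// leq_maxr.
by rewrite (le_trans (close _ _ _ _ (hp n) hq))// [_ + e]addrC lerD2l ltW// h1// leq_maxl.
Qed.

(** A total function: the default 0 is never resorted to for self-adjoint [h] and continuous [f]. *)
Definition fcU h f : U := xget (0 : U) (is_fc h f).

Lemma fcUP h f : h^c* = h -> continuous f -> is_fc h f (fcU h f).
Proof. by move=> hsa fc; apply: xgetPex; exact: is_fc_ex. Qed.

(** The usual way to identify f(h): for each small d, one polynomial close to both sides.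
    Restricting to d <= 1 turns the quadratic errors of products into linear ones. *)
Lemma fcU_lim h f l (C : R) : h^c* = h -> continuous f ->
  (forall d, 0 < d -> d <= 1 -> exists p, (forall x : R, `|x| <= nrm h -> `|f x - p.[x]| <= C * d) /\
     nrm (l - pev h p) <= C * d) -> fcU h f = l.
Proof.
move=> hsa fc hl; apply/eqP; rewrite -subr_eq0; apply/eqP/(@nrm_small0 _ _ _ (2 * C)) => d0 d0_gt0.
pose d := Num.min d0 1.
have [||p [hp lp]] := hl d; rewrite ?lt_min ?d0_gt0//= ?ge_min ?lexx ?orbT//.
rewrite (le_trans (nrm_triangle (pev h p) _ _))//.
rewrite (@le_trans _ _ (2 * (C * d)))//.
  by rewrite ler_add_double//; [exact: fcUP|rewrite nrmB].
rewrite -mulrA ler_pM2l// ler_wpM2l//; last by rewrite ge_min lexx.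
have := le_trans (nrm_ge0 _) lp.
by rewrite pmulr_lge0// lt_min d0_gt0/=.
Qed.

Lemma fcU_pev h p : h^c* = h -> fcU h (fun x : R => p.[x]) = pev h p.
Proof.
move=> hsa; apply: (@fcU_lim _ _ _ 1) => //; first exact: cont_horner.
move=> d d0 _; exists p; split=> [x _|]; by rewrite subrr ?normr0 ?nrm0 mul1r ltW.
Qed.

Lemma fcU_norm h f (M : R) : h^c* = h -> continuous f ->
  (forall x : R, `|x| <= nrm h -> `|f x| <= M) -> nrm (fcU h f) <= M.
Proof.
move=> hsa fc fM; have := fcUP hsa fc (e := M) (p := 0); rewrite pev0 subr0.
by apply=> x xh; rewrite horner0 subr0 fM.
Qed.

Lemma fcU_eq h f g : (forall x : R, `|x| <= nrm h -> f x = g x) -> fcU h f = fcU h g.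
Proof.
move=> fg; congr (xget _ _); apply/funext => l; apply/propext.
by split=> hl e p hp; apply: hl => x xh; rewrite ?fg ?hp// -fg// hp.
Qed.

Lemma fcUD h f g : h^c* = h -> continuous f -> continuous g ->
  fcU h (fun x : R => f x + g x) = fcU h f + fcU h g.
Proof.
move=> hsa fc gc; apply: (@fcU_lim _ _ _ 2) => //; first exact: contD.
move=> d d0 _; have [p hp] := weierstrass (nrm h) fc d0.
have [q hq] := weierstrass (nrm h) gc d0.
exists (p + q); split => [x xh|].
  by rewrite hornerD opprD addrACA (le_trans (ler_normD _ _))// ler_add_double ?hp ?hq.
by rewrite pevD opprD addrACA (le_trans (nrmD _ _))// ler_add_double//; exact: fcUP.
Qed.

Lemma fcUM h f g : h^c* = h -> continuous f -> continuous g ->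
  fcU h (fun x : R => f x * g x) = fcU h f * fcU h g.
Proof.
move=> hsa fc gc.
have [Mf Mf0 hMf] := cont_bounded (nrm h) fc.
have [Mg Mg0 hMg] := cont_bounded (nrm h) gc.
have nF := fcU_norm hsa fc hMf; have nG := fcU_norm hsa gc hMg.
apply: (@fcU_lim _ _ _ (Mg + (Mf + 1))) => //; first exact: contM.
move=> d d0 d1; have [p hp] := weierstrass (nrm h) fc d0.
have [q hq] := weierstrass (nrm h) gc d0.
have fp := fcUP hsa fc hp; have gq := fcUP hsa gc hq.
exists (p * q); split => [x xh|].
  have -> : f x * g x - (p * q).[x] = (f x - p.[x]) * g x + p.[x] * (g x - q.[x]).
    by rewrite hornerM; ring.
  rewrite (le_trans (ler_normD _ _))// !normrM mulrDl lerD//.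
    by rewrite mulrC ler_pM ?hMg ?hp.
  rewrite ler_pM ?hq//; rewrite -[p.[x]](subrK (f x)) (le_trans (ler_normD _ _))// addrC.
  by rewrite lerD ?hMf// distrC (le_trans (hp x xh)).
rewrite pevM.
have -> : fcU h f * fcU h g - pev h p * pev h q =
    (fcU h f - pev h p) * fcU h g + pev h p * (fcU h g - pev h q).
  by rewrite mulrBl mulrBr addrA subrK.
rewrite (le_trans (nrmD _ _))// [leRHS]mulrDl lerD//.
  by rewrite (le_trans (unrmM _ _))// mulrC ler_pM ?nrm_ge0.
rewrite (le_trans (unrmM _ _))// ler_pM ?nrm_ge0//.
rewrite -[pev h p](subrK (fcU h f)) (le_trans (nrmD _ _))// addrC lerD//.
by rewrite nrmB (le_trans fp).
Qed.

Lemma fcU_cst h t : h^c* = h -> fcU h (fun _ => t) = rsc t.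
Proof.
move=> hsa; rewrite -(pevC h) -fcU_pev//; apply: fcU_eq => x _.
by rewrite hornerC.
Qed.

Lemma fcU_id h : h^c* = h -> fcU h (fun x : R => x) = h.
Proof.
move=> hsa; rewrite -[RHS]pevX -fcU_pev//; apply: fcU_eq => x _.
by rewrite hornerX.
Qed.

Lemma fcUZ h t f : h^c* = h -> continuous f -> fcU h (fun x : R => t * f x) = t%:C *: fcU h f.
Proof. by move=> hsa fc; rewrite fcUM ?fcU_cst ?rscl//; exact: cont_cst. Qed.

Lemma fcUN h f : h^c* = h -> continuous f -> fcU h (fun x : R => - f x) = - fcU h f.
Proof.
move=> hsa fc; rewrite (_ : (fun x : R => - f x) = fun x : R => (-1) * f x).
  by rewrite fcUZ// rmorphN rmorph1 scaleN1r.
by apply/funext => x; rewrite mulN1r.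
Qed.

Lemma fcUB h f g : h^c* = h -> continuous f -> continuous g ->
  fcU h (fun x : R => f x - g x) = fcU h f - fcU h g.
Proof. by move=> hsa fc gc; rewrite fcUD ?fcUN//; exact: contN. Qed.

Lemma fcUX h f n : h^c* = h -> continuous f ->
  fcU h (fun x : R => f x ^+ n) = fcU h f ^+ n.
Proof.
move=> hsa fc; elim: n => [|n IH]; first by rewrite expr0 -(rsc1 A) -(@fcU_cst h).
rewrite exprS -IH -fcUM//; last exact: contX.
by apply: fcU_eq => x _; rewrite exprS.
Qed.

(** True for polynomials, and stable under limits. For k = h it is commutation; for different [h]
    and [k] it will replace the comparison of the spectra of y^* y and y y^*. *)
Lemma fcU_intertwine x h (k : U) f : h^c* = h -> k^c* = k -> continuous f ->
  x * h = k * x -> x * fcU h f = fcU k f * x.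
Proof.
move=> hsa ksa fc xh; apply/eqP; rewrite -subr_eq0; apply/eqP.
apply: (@nrm_small0 _ _ _ (2 * nrm x)) => d d0.
have [p hp] := weierstrass (Num.max (nrm h) (nrm k)) fc d0.
have fh : nrm (fcU h f - pev h p) <= d.
  by apply: fcUP => // t th; apply: hp; rewrite le_max th.
have fk : nrm (fcU k f - pev k p) <= d.
  by apply: fcUP => // t th; apply: hp; rewrite le_max th orbT.
have -> : x * fcU h f - fcU k f * x = x * (fcU h f - pev h p) - (fcU k f - pev k p) * x.
  by rewrite mulrBr mulrBl (pev_intertwine _ xh) opprB addrA subrK.
rewrite (le_trans (nrmD _ _))// nrmN -(mulrA 2 (nrm x)) ler_add_double//.
  by rewrite (le_trans (unrmM _ _))// ler_wpM2l ?nrm_ge0.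
by rewrite (le_trans (unrmM _ _))// mulrC ler_wpM2l ?nrm_ge0.
Qed.

Lemma fcU_sa h f : h^c* = h -> continuous f -> (fcU h f)^c* = fcU h f.
Proof.
move=> hsa fc; apply/esym; apply: (@fcU_lim _ _ _ 1) => // d d0 _.
have [p hp] := weierstrass (nrm h) fc d0; exists p; split => [x xh|]; rewrite mul1r ?hp//.
by rewrite -[pev h p]cstarK pev_star hsa -cstarB nrm_star; exact: fcUP.
Qed.

Lemma fcU_comp h f g : h^c* = h -> continuous f -> continuous g ->
  fcU (fcU h g) f = fcU h (fun x : R => f (g x)).
Proof.
move=> hsa fc gc; have gsa := fcU_sa hsa gc.
have fgc : continuous (fun x : R => f (g x)) by exact: cont_comp.
have [M M0 hM] := cont_bounded (nrm h) gc.
have nG := fcU_norm hsa gc hM.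
apply: (@fcU_lim _ _ _ 1) => // d d0 _.
have [p hp] := weierstrass M fc d0; exists p; rewrite mul1r; split => [x xG|].
  by rewrite hp// (le_trans xG).
have -> : pev (fcU h g) p = fcU h (fun x : R => p.[g x]).
  elim/poly_ind : p {hp} => [|p t IH].
    rewrite pev0 -(rsc0 A) -(@fcU_cst h)//; apply: fcU_eq => x _.
    by rewrite horner0.
  rewrite pevD pevM pevX pevC IH -fcUM//; last exact/(cont_comp (@cont_horner _ p)).
  rewrite -(@fcU_cst h)// -fcUD//; last 2 first.
  - by apply: contM => //; exact/(cont_comp (@cont_horner _ p)).
  - exact: cont_cst.
  by apply: fcU_eq => x _; rewrite hornerD hornerM hornerX hornerC.
have pgc : continuous (fun x : R => p.[g x]) by exact/(cont_comp (@cont_horner _ p)).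
rewrite -fcUB//; apply: fcU_norm => //; first exact/contD/contN.
by move=> x xh; apply: hp; apply: hM.
Qed.

Lemma fcU_upos h f : h^c* = h -> continuous f ->
  (forall x : R, `|x| <= nrm h -> 0 <= f x) -> upos (fcU h f).
Proof.
move=> hsa fc f0; rewrite (@fcU_eq _ _ (fun x : R => Num.sqrt (f x) ^+ 2)).
  have sfc := cont_sqrt fc.
  by rewrite fcUX//; apply/upos_sq/fcU_sa.
by move=> x xh; rewrite sqr_sqrtr// f0.
Qed.

(** With a = k^2 and k self-adjoint, f(a) is the value at k of f(t^2), which sees f on [0, |a|]
    only. This stands in for the fact that a positive element has nonnegative spectrum. *)
Lemma upos_fcU_eq a f g : upos a -> continuous f -> continuous g ->
  (forall x : R, 0 <= x <= nrm a -> f x = g x) -> fcU a f = fcU a g.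
Proof.
move=> /upos_sqrt[k [ksa <- _]] fc gc fg.
have xc : continuous (fun x : R => x ^+ 2) by apply/contX/cont_id.
have -> : k ^+ 2 = fcU k (fun x : R => x ^+ 2) by rewrite fcUX ?fcU_id//; exact: cont_id.
rewrite !fcU_comp//; apply: fcU_eq => x xk; apply: fg; rewrite sqr_ge0 /=.
rewrite -(_ : nrm k ^+ 2 = nrm (k ^+ 2)); last by rewrite -nrm_star_sq ksa.
by rewrite -real_normK ?num_real// ler_pXn2r ?nnegrE ?nrm_ge0.
Qed.

End functional_calculus.

(** * Positivity of x^* x *)

Section star_positivity.
Context (R : realType) (A : cstarAlgType R).
Local Notation U := (unitz A).
Local Notation rsc := (@rsc R A).
Implicit Types (x y z h : U).

(** Let n be the negative part of h = x^* x, and y = x n. Then y^* y = - n^3 = - p, while q = y y^*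
    is positive because q - p is half a sum of two squares. Now y intertwines p with - q, and the
    function max(t, 0) fixes p and kills - q; so y p = 0, hence p^2 = 0 and n = 0. *)
Lemma upos_star x : upos (x^c* * x).
Proof.
set h := x^c* * x; have hsa : h^c* = h by rewrite /h ustarM cstarK.
pose neg (t : R) := Num.max (- t) 0; pose pos (t : R) := Num.max t 0.
have negc : continuous neg by exact/cont_max/cont_cst/contN/cont_id.
have posc : continuous pos by exact/cont_max/cont_cst/cont_id.
have idc := @cont_id R.
have neg0 t : 0 <= neg t by rewrite le_max lexx orbT.
pose n := fcU h neg; have nsa : n^c* = n by exact: fcU_sa.
pose p := fcU h (fun t => neg t ^+ 3).
have n3c : continuous (fun t => neg t ^+ 3) by exact: contX.
have psa : p^c* = p by exact: fcU_sa.
have p0 : upos p by apply: fcU_upos => // t _; rewrite exprn_ge0.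
pose y := x * n.
have yy : y^c* * y = - p.
  have -> : y^c* * y = n * h * n by rewrite /y ustarM nsa !mulrA.
  rewrite -{1}(fcU_id hsa) -fcUM// -fcUM//; last exact: contM.
  rewrite -fcUN//; apply: fcU_eq => t _.
  rewrite /neg; case: leP => _; first by ring.
  by ring.
pose q := y * y^c*; have qsa : q^c* = q by rewrite /q ustarM cstarK.
have q0 : upos q.
  (* Multiples of the real and imaginary parts of y, for which a^2 + b^2 = 2 (y y^* + y^* y) = 2 (q
     - p). *)
  pose a := y + y^c*; pose b := 'i *: (y - y^c*).
  have asa : a^c* = a by rewrite cstarD cstarK addrC.
  have bsa : b^c* = b by rewrite cstarZ conjC_i cstarB cstarK scaleNr -scalerN opprB.
  have ab : a ^+ 2 + b ^+ 2 = (q - p) + (q - p).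
    have -> : b ^+ 2 = - (y - y^c*) ^+ 2.
      by rewrite exprZn sqr_i scaleN1r.
    rewrite -yy /a /q !expr2 !mulrDl !mulrDr !mulNr !mulrN !opprD !opprK.
    rewrite -/q; set u := y * y; set v := y^c* * y^c*; set w := y^c* * y; set s := y * y^c*.
    transitivity ((u - u) + (v - v) + (s + w + (s + w))); first by zsum.
    by rewrite !subrr !add0r.
  have -> : q = 2^-1%:C *: (a ^+ 2 + b ^+ 2) + p.
    rewrite ab scalerDr -scalerDl -rmorphD /=.
    have -> : (2^-1 + 2^-1 : R) = 1 by field.
    by rewrite scale1r subrK.
  by apply: uposD => //; apply: uposZ => //; apply: uposD; exact: upos_sq.
have yp : y * p = 0.
  have -> : p = fcU p pos.
    rewrite -{1}(fcU_id psa); apply: upos_fcU_eq => // t /andP[t0 _].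
    by rewrite /pos max_l.
  rewrite (@fcU_intertwine _ _ y p (- q))//; last 2 first.
  - by rewrite cstarN qsa.
  - by rewrite mulNr /q -[y * y^c* * y]mulrA yy mulrN opprK.
  rewrite -[- q](_ : fcU q (fun t => - t) = _); last by rewrite fcUN// fcU_id.
  rewrite fcU_comp//; last exact: contN.
  rewrite (@upos_fcU_eq _ _ q _ (fun _ => 0))//; last 2 first.
  - exact: cont_cst.
  - by move=> t /andP[t0 _]; rewrite /pos max_r// oppr_le0.
  by rewrite fcU_cst// rsc0 mul0r.
have pz : p = 0.
  apply: star_mul_eq0; rewrite psa ucmulE -{1}[p]opprK -yy mulNr -mulrA yp.
  by rewrite mulr0 oppr0.
have nz : n = 0.
  have n3 : n ^+ 3 = 0 by rewrite -fcUX.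
  apply: star_mul_eq0; apply: star_mul_eq0; rewrite cstarM cstarK nsa !ucmulE.
  by rewrite -!expr2 -exprM exprS n3 mulr0.
have -> : h = fcU h pos.
  rewrite -{1}(fcU_id hsa) -[RHS]subr0 -nz -fcUB//; apply: fcU_eq => t _.
  by rewrite /pos /neg; case: (leP t 0) => t0; case: (leP (- t) 0) => t1; lra.
by apply: fcU_upos => // t _; rewrite le_max lexx orbT.
Qed.

Lemma upos_conj x y : upos y -> upos (x^c* * y * x).
Proof.
move=> /upos_sqrt[z [zsa <- _]].
have -> : x^c* * z ^+ 2 * x = (z * x)^c* * (z * x) by rewrite ustarM zsa expr2 !mulrA.
exact: upos_star.
Qed.

Lemma upos_nrm_sub x : upos x -> upos (rsc (nrm x) - x).
Proof. by move=> x0; have [] := upos_of_nrm (upos_sa x0) (lexx _). Qed.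

Lemma upos_le_nrm x y : upos x -> upos (y - x) -> nrm x <= nrm y.
Proof.
move=> x0 xy; have y0 : upos y by rewrite -(subrK x y); exact: uposD.
apply: nrm_le_of_upos; first exact: nrm_ge0.
  by rewrite -(subrKA y); apply: uposD => //; exact: upos_nrm_sub.
by apply: uposD => //; apply/upos_rsc/nrm_ge0.
Qed.

End star_positivity.

(** * Functional calculus inside an algebra without unit *)

Section nonunital_calculus.
Context (R : realType) (A : cstarAlgType R).
Local Notation U := (unitz A).
Local Notation rsc := (@rsc R A).
Implicit Types (a b h k x y z : A) (f g : R -> R) (t : R).

Definition inU a : U := (a, 0).

Lemma inU_inj : injective inU. Proof. by move=> x y []. Qed.

Lemma inU0 : inU 0 = 0. Proof. by []. Qed.

Lemma inUD x y : inU (x + y) = inU x + inU y.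
Proof. by congr (_, _); rewrite /= addr0. Qed.

Lemma inUN x : inU (- x) = - inU x.
Proof. by congr (_, _); rewrite /= oppr0. Qed.

Lemma inUB x y : inU (x - y) = inU x - inU y.
Proof. by rewrite inUD inUN. Qed.

Lemma inUM x y : inU (x *c y) = inU x * inU y.
Proof. by congr (_, _); rewrite /= ?mulr0// !scale0r !addr0. Qed.

Lemma inUZ (k : R[i]) x : inU (k *: x) = k *: inU x.
Proof. by congr (_, _); rewrite /= scaler0. Qed.

Lemma inU_star x : inU x^c* = (inU x)^c*.
Proof. by congr (_, _); rewrite /= conjC0. Qed.

Lemma nrm_inU x : nrm (inU x) = nrm x.
Proof. by rewrite nrm_unorm unorm_in. Qed.

Lemma inU_sum (I : Type) (r : seq I) (P : pred I) (F : I -> A) :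
  inU (\sum_(i <- r | P i) F i) = \sum_(i <- r | P i) inU (F i).
Proof. exact: (big_morph inU inUD inU0). Qed.

(* Continuous functions vanishing at [0] operate on algebras without unit. *)
Definition czero f := continuous f /\ f 0 = 0.

Lemma czero_id : czero (fun t => t). Proof. by split; [exact: cont_id|]. Qed.

Lemma czero0 : czero (fun=> 0). Proof. by split; [exact: cont_cst|]. Qed.

Lemma czeroD f g : czero f -> czero g -> czero (fun t => f t + g t).
Proof. by move=> [fc f0] [gc g0]; split; [exact: contD|rewrite f0 g0 addr0]. Qed.

Lemma czeroN f : czero f -> czero (fun t => - f t).
Proof. by move=> [fc f0]; split; [exact: contN|rewrite f0 oppr0]. Qed.

Lemma czeroB f g : czero f -> czero g -> czero (fun t => f t - g t).
Proof. by move=> fc gc; apply/czeroD/czeroN. Qed.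

Lemma czeroMl f g : czero f -> continuous g -> czero (fun t => f t * g t).
Proof. by move=> [fc f0] gc; split; [exact: contM|rewrite f0 mul0r]. Qed.

Lemma czeroMr f g : continuous f -> czero g -> czero (fun t => f t * g t).
Proof. by move=> fc [gc g0]; split; [exact: contM|rewrite g0 mulr0]. Qed.

Lemma czeroM f g : czero f -> czero g -> czero (fun t => f t * g t).
Proof. by move=> fc [gc _]; exact: czeroMl. Qed.

Lemma czeroX f n : czero f -> czero (fun t => f t ^+ n.+1).
Proof. by move=> [fc f0]; split; [exact: contX|rewrite f0 expr0n]. Qed.

Lemma czero_sqrt f : czero f -> czero (fun t => Num.sqrt (f t)).
Proof. by move=> [fc f0]; split; [exact: cont_sqrt|rewrite f0 sqrtr0]. Qed.

Lemma czero_cut (e : R) : 0 <= e -> czero (fun t => Num.max (t - e) 0).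
Proof.
move=> e0; split; first by apply/cont_max/cont_cst/contD/cont_cst/cont_id.
by rewrite sub0r max_r// oppr_le0.
Qed.

Definition fc a f : A := (fcU (inU a) f).1.

Let inU_sa a : a^c* = a -> (inU a)^c* = inU a.
Proof. by rewrite -inU_star => ->. Qed.

(** The scalar part of p(a) is p(0); in the limit that of f(a) is f(0) = 0, so f(a) lies in [A]. *)
Lemma inU_fc a f : a^c* = a -> czero f -> inU (fc a f) = fcU (inU a) f.
Proof.
move=> /inU_sa asa [fcont f0]; rewrite /fc [RHS]surjective_pairing; congr (_, _).
apply/esym; apply: (@nrm_small0 R R[i]^o _ 2) => d d0.
have [p hp] := weierstrass (nrm (inU a)) fcont d0.
have pe : (pev (inU a) p).2 = (p.[0])%:C :> R[i].
  elim/poly_ind : p {hp} => [|p t IH]; first by rewrite pev0 horner0.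
  rewrite pevD pevM pevX pevC hornerD hornerM hornerX mulr0 add0r hornerC.
  by rewrite /= mulr0 add0r /GRing.scale/= mulr1.
have [_ + _] := unorm_bounds (fcU (inU a) f - pev (inU a) p).
rewrite -nrm_unorm => /le_trans/(_ (fcUP asa fcont hp)) h.
have {}h : nrm ((fcU (inU a) f).2 - (pev (inU a) p).2 : R[i]^o) <= d by exact: h.
rewrite -[(fcU (inU a) f).2](subrK ((pev (inU a) p).2 : R[i]^o)).
rewrite (le_trans (nrmD _ _))// ler_add_double// pe.
by rewrite [leLHS]nrm_real -normrN -[- _]add0r -{1}f0 hp// normr0 nrm_ge0.
Qed.

Lemma fcB a f g : a^c* = a -> czero f -> czero g ->
  fc a (fun t => f t - g t) = fc a f - fc a g.
Proof.
move=> asa fc0 gc0; apply: inU_inj; rewrite inUB !inU_fc//; last exact: czeroB.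
by case: fc0 gc0 => fc0 _ [gc0 _]; apply: fcUB => //; exact: inU_sa.
Qed.

Lemma fcM a f g : a^c* = a -> czero f -> czero g ->
  fc a (fun t => f t * g t) = fc a f *c fc a g.
Proof.
move=> asa fc0 gc0; apply: inU_inj; rewrite inUM !inU_fc//; last exact: czeroM.
by case: fc0 gc0 => fc0 _ [gc0 _]; apply: fcUM => //; exact: inU_sa.
Qed.

Lemma fcZ a t f : a^c* = a -> czero f -> fc a (fun s => t * f s) = t%:C *: fc a f.
Proof.
move=> asa fc0; apply: inU_inj; rewrite inUZ !inU_fc//; last first.
  by apply: czeroMr => //; exact: cont_cst.
by case: fc0 => fc0 _; apply: fcUZ => //; exact: inU_sa.
Qed.

Lemma fc_id a : a^c* = a -> fc a (fun t => t) = a.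
Proof.
move=> asa; apply: inU_inj; rewrite inU_fc//; last exact: czero_id.
by rewrite fcU_id//; exact: inU_sa.
Qed.

Lemma fc0 a : a^c* = a -> fc a (fun=> 0) = 0.
Proof.
move=> asa; apply: inU_inj; rewrite inU_fc//; last exact: czero0.
by rewrite fcU_cst ?rsc0//; exact: inU_sa.
Qed.

Lemma fc_eq a f g : (forall t, `|t| <= nrm a -> f t = g t) -> fc a f = fc a g.
Proof. by move=> fg; congr fst; apply: fcU_eq => t; rewrite nrm_inU; exact: fg. Qed.

Lemma fc_sa a f : a^c* = a -> czero f -> (fc a f)^c* = fc a f.
Proof.
move=> asa fc0; apply: inU_inj; rewrite inU_star inU_fc//.
by case: fc0 => fc0 _; apply: fcU_sa => //; exact: inU_sa.
Qed.

(** One direction is [upos_star]; for the other, the square root function vanishes at 0, hence the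
    root of [a] lies in [A]. *)
Lemma cposP a : cpos a <-> upos (inU a).
Proof.
split=> [[y ->]|a0]; first by rewrite inUM inU_star; exact: upos_star.
have asa : a^c* = a by apply: inU_inj; rewrite inU_star; exact: upos_sa.
have idc := czero_id; have sc := czero_sqrt idc.
exists (fc a Num.sqrt); rewrite fc_sa// -fcM//; apply: inU_inj.
rewrite inU_fc//; last exact: czeroM.
rewrite -{1}(fcU_id (upos_sa a0)).
apply: upos_fcU_eq => //; [exact: cont_id|by case: (czeroM sc sc)|].
by move=> t /andP[t0 _]; rewrite -expr2 sqr_sqrtr.
Qed.

Lemma cpos_sa a : cpos a -> a^c* = a.
Proof. by move=> [y ->]; rewrite cstarM cstarK. Qed.

Lemma cpos0 : cpos (0 : A).
Proof. by exists 0; rewrite cmulr0. Qed.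

Lemma cposD a b : cpos a -> cpos b -> cpos (a + b).
Proof. by move=> /cposP a0 /cposP b0; apply/cposP; rewrite inUD; exact: uposD. Qed.

Lemma cposZ t a : 0 <= t -> cpos a -> cpos (t%:C *: a).
Proof. by move=> t0 /cposP a0; apply/cposP; rewrite inUZ; exact: uposZ. Qed.

Lemma cpos_sum (I : Type) (r : seq I) (P : pred I) (F : I -> A) :
  (forall i, P i -> cpos (F i)) -> cpos (\sum_(i <- r | P i) F i).
Proof. by move=> F0; elim/big_rec : _ => [|i y /F0 ? ?]; [exact: cpos0|exact: cposD]. Qed.

Lemma cpos_conj x a : cpos a -> cpos (x^c* *c a *c x).
Proof. by move=> [y ->]; exists (y *c x); rewrite cstarM !cmulA. Qed.

Lemma cpos_le_nrm a b : cpos a -> cpos (b - a) -> nrm a <= nrm b.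
Proof.
move=> /cposP a0 /cposP; rewrite inUB -(nrm_inU a) -(nrm_inU b).
exact: upos_le_nrm.
Qed.

Lemma cpos_anti a : cpos a -> cpos (- a) -> a = 0.
Proof.
by move=> /cposP a0 /cposP; rewrite inUN => aN; apply: inU_inj; exact: upos_anti.
Qed.

Lemma cpos_fc_eq a f g : cpos a -> czero f -> czero g ->
  (forall t, 0 <= t <= nrm a -> f t = g t) -> fc a f = fc a g.
Proof.
move=> /cposP a0 [fc0 _] [gc0 _] fg; congr fst; apply: upos_fcU_eq => // t.
by rewrite nrm_inU; exact: fg.
Qed.

Lemma cpos_fc a f : cpos a -> czero f -> (forall t, 0 <= t <= nrm a -> 0 <= f t) ->
  cpos (fc a f).
Proof.
move=> a0 f0 fpos; have asa := cpos_sa a0.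
have sf : czero (fun t => Num.sqrt (f t)) := czero_sqrt f0.
exists (fc a (fun t => Num.sqrt (f t))); rewrite fc_sa// -fcM//.
by apply: cpos_fc_eq => //; [exact: czeroM|move=> t /fpos ft; rewrite -expr2 sqr_sqrtr].
Qed.

Lemma cpos_fc_nrm a f (M : R) : cpos a -> czero f ->
  (forall t, 0 <= t <= nrm a -> `|f t| <= M) -> nrm (fc a f) <= M.
Proof.
move=> a0 f0 fM; have asa := cpos_sa a0.
have M0 : 0 <= M by rewrite (le_trans _ (fM 0 _))// lexx nrm_ge0.
(* Clamping [f] to [-M, M] does not change it on [0, |a|] and extends the bound to the symmetric
   interval that [fcU_norm] asks for. *)
pose g t := Num.max (Num.min (f t) M) (- M).
have gf t : `|f t| <= M -> g t = f t.
  by rewrite ler_norml /g => /andP[f1 f2]; rewrite min_l// max_l.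
have gM t : `|g t| <= M.
  rewrite ler_norml /g le_max lexx orbT/= ge_max ge_min lexx orbT/=.
  by lra.
have gc : czero g.
  split; last by rewrite gf ?f0.2// normr0.
  have minE : (fun t => Num.min (f t) M) = (fun t => - Num.max (- f t) (- M)).
    by apply/funext => t; rewrite oppr_max !opprK.
  apply: cont_max; last exact: cont_cst.
  by rewrite minE; apply/contN/cont_max/cont_cst/contN; case: f0.
rewrite (@cpos_fc_eq _ _ g)//; last by move=> t /fM/gf.
rewrite -nrm_inU inU_fc//; apply: fcU_norm => //; first exact: inU_sa.
by case: gc.
Qed.

Lemma fc_cpos a f : a^c* = a -> czero f -> (forall t, `|t| <= nrm a -> 0 <= f t) ->
  cpos (fc a f).
Proof.
move=> asa f0 fpos; apply/cposP; rewrite inU_fc//; apply: fcU_upos.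
- exact: inU_sa.
- by case: f0.
- by rewrite nrm_inU.
Qed.

End nonunital_calculus.

(** * Functional calculus and morphisms *)

Section morphisms.
Context (R : realType) (A B : cstarAlgType R) (phi : A -> B).
Hypotheses (phiD : forall x y, phi (x + y) = phi x + phi y)
  (phiZ : forall k x, phi (k *: x) = k *: phi x)
  (phiM : forall x y, phi (x *c y) = phi x *c phi y)
  (phi_star : forall x, phi x^c* = (phi x)^c*)
  (phi_nrm : forall x, nrm (phi x) <= nrm x).

Lemma morph0 : phi 0 = 0.
Proof. by have := phiZ 0 0; rewrite !scale0r. Qed.

Lemma morphN x : phi (- x) = - phi x.
Proof. by rewrite -(scaleN1r x) phiZ scaleN1r. Qed.

Let phiU (x : unitz A) : unitz B := (phi x.1, x.2).

(** A mere bound on the extension to unitizations, enough for limits of polynomials; 3 = 2 + 1 comes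
    from [unorm_bounds]. *)
Let phiU_nrm x : nrm (phiU x) <= 3 * nrm x.
Proof.
have [_ _] := unorm_bounds (phiU x); rewrite -nrm_unorm => h; apply: le_trans h _ => /=.
have [h1 h2 _] := unorm_bounds x; rewrite -nrm_unorm in h1 h2.
have := phi_nrm x.1; lra.
Qed.

Let phiU_pev h p : phiU (pev h p) = pev (phiU h) p.
Proof.
elim/poly_ind : p => [|p t IH]; first by rewrite !pev0; congr (_, _); exact: morph0.
rewrite !pevD !pevM !pevC !pevX -IH; congr (_, _) => /=.
by rewrite phiD !phiD phiM !phiZ morph0.
Qed.

Lemma morph_fc a f : a^c* = a -> czero f -> phi (fc a f) = fc (phi a) f.
Proof.
move=> asa f0; have pasa : (phi a)^c* = phi a by rewrite -phi_star asa.
apply: inU_inj; rewrite inU_fc//.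
have -> : inU (phi (fc a f)) = phiU (fcU (inU a) f) by rewrite -inU_fc.
have iasa : (inU a)^c* = inU a by rewrite -inU_star asa.
have ipasa : (inU (phi a))^c* = inU (phi a) by rewrite -inU_star pasa.
have [f0c _] := f0.
apply/esym; apply: (@fcU_lim _ _ _ _ _ 3) => // d d0 _.
have [p hp] := weierstrass (nrm a) f0c d0; exists p; split => [x|].
  rewrite nrm_inU => xa; rewrite (le_trans (hp _ (le_trans xa (phi_nrm a))))//.
  by lra.
have -> : phiU (fcU (inU a) f) - pev (inU (phi a)) p = phiU (fcU (inU a) f - pev (inU a) p).
  rewrite -[inU (phi a)]/(phiU (inU a)) -phiU_pev.
  by congr (_, _); rewrite /= phiD morphN.
rewrite (le_trans (phiU_nrm _))// ler_pM2l//; apply: fcUP => //.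
by rewrite nrm_inU.
Qed.

End morphisms.

(** * The C*-algebra of n x n matrices *)

Section matrix_algebra.
Context (R : realType) (A : cstarAlgType R).

Lemma rnormE (x : A) : rnorm x = nrm x. Proof. by rewrite nrm_Re. Qed.

Lemma cmulmxE m n p (X : 'M[A]_(m, n)) (Y : 'M[A]_(n, p)) i j :
  cmulmx X Y i j = \sum_k X i k *c Y k j.
Proof. by rewrite mxE. Qed.

Lemma cstarmxE m n (X : 'M[A]_(m, n)) i j : cstarmx X i j = (X j i)^c*.
Proof. by rewrite mxE. Qed.

Lemma cmulmxA m n p q (X : 'M[A]_(m, n)) (Y : 'M[A]_(n, p)) (Z : 'M[A]_(p, q)) :
  cmulmx X (cmulmx Y Z) = cmulmx (cmulmx X Y) Z.
Proof.
apply/matrixP => i j; rewrite !cmulmxE.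
transitivity (\sum_k \sum_l X i k *c (Y k l *c Z l j)).
  by apply: eq_bigr => k _; rewrite cmulmxE cmul_sumr.
rewrite exchange_big; apply: eq_bigr => l _; rewrite cmulmxE cmul_suml.
by apply: eq_bigr => k _; rewrite cmulA.
Qed.

Lemma cmulmxDl m n p (X Y : 'M[A]_(m, n)) (Z : 'M[A]_(n, p)) :
  cmulmx (X + Y) Z = cmulmx X Z + cmulmx Y Z.
Proof.
apply/matrixP => i j; rewrite [RHS]mxE !cmulmxE -big_split /=.
by apply: eq_bigr => k _; rewrite mxE cmulDl.
Qed.

Lemma cmulmxDr m n p (X : 'M[A]_(m, n)) (Y Z : 'M[A]_(n, p)) :
  cmulmx X (Y + Z) = cmulmx X Y + cmulmx X Z.
Proof.
apply/matrixP => i j; rewrite [RHS]mxE !cmulmxE -big_split /=.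
by apply: eq_bigr => k _; rewrite mxE cmulDr.
Qed.

Lemma cstarmxK m n : cancel (@cstarmx R A m n) (@cstarmx R A n m).
Proof. by move=> X; apply/matrixP => i j; rewrite !cstarmxE cstarK. Qed.

Lemma cstarmxD m n (X Y : 'M[A]_(m, n)) : cstarmx (X + Y) = cstarmx X + cstarmx Y.
Proof. by apply/matrixP => i j; rewrite !mxE cstarD. Qed.

Lemma cstarmxM m n p (X : 'M[A]_(m, n)) (Y : 'M[A]_(n, p)) :
  cstarmx (cmulmx X Y) = cmulmx (cstarmx Y) (cstarmx X).
Proof.
apply/matrixP => i j; rewrite cstarmxE !cmulmxE cstar_sum.
by apply: eq_bigr => k _; rewrite !cstarmxE cstarM.
Qed.

End matrix_algebra.

(** Aliases that carry the module structures and the C*-norm built below, apart from the structures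
    of plain matrices. *)
Definition ccol (R : realType) (A : cstarAlgType R) n := 'M[A]_(n, 1).
Definition cmx (R : realType) (A : cstarAlgType R) n := 'M[A]_n.

Section matrix_cstar.
Context (R : realType) (A : cstarAlgType R) (n : nat).
Local Notation D := (cmx A n).
Local Notation V := (ccol A n).

HB.instance Definition _ := GRing.Zmodule.on V.
HB.instance Definition _ := GRing.Zmodule.on D.

Let vscale (k : R[i]) (v : V) : V := map_mx ( *:%R k) v.
Let mscale (k : R[i]) (X : D) : D := map_mx ( *:%R k) X.

Let vscaleA a b v : vscale a (vscale b v) = vscale (a * b) v.
Proof. by apply/matrixP => i j; rewrite !mxE scalerA. Qed.
Let vscale1 : left_id 1 vscale.
Proof. by move=> v; apply/matrixP => i j; rewrite !mxE scale1r. Qed.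
Let vscaleDr : right_distributive vscale +%R.
Proof. by move=> a v w; apply/matrixP => i j; rewrite !mxE scalerDr. Qed.
Let vscaleDl v : {morph vscale^~ v : a b / a + b}.
Proof. by move=> a b; apply/matrixP => i j; rewrite !mxE scalerDl. Qed.

HB.instance Definition _ :=
  GRing.Zmodule_isLmodule.Build R[i] V vscaleA vscale1 vscaleDr vscaleDl.

Let mscaleA a b v : mscale a (mscale b v) = mscale (a * b) v.
Proof. by apply/matrixP => i j; rewrite !mxE scalerA. Qed.
Let mscale1 : left_id 1 mscale.
Proof. by move=> v; apply/matrixP => i j; rewrite !mxE scale1r. Qed.
Let mscaleDr : right_distributive mscale +%R.
Proof. by move=> a v w; apply/matrixP => i j; rewrite !mxE scalerDr. Qed.
Let mscaleDl v : {morph mscale^~ v : a b / a + b}.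
Proof. by move=> a b; apply/matrixP => i j; rewrite !mxE scalerDl. Qed.

HB.instance Definition _ :=
  GRing.Zmodule_isLmodule.Build R[i] D mscaleA mscale1 mscaleDr mscaleDl.

Let ip (v w : V) : A := \sum_k (v k ord0)^c* *c w k ord0.

Let ipDl u v w : ip (u + v) w = ip u w + ip v w.
Proof. by rewrite -big_split; apply: eq_bigr => k _; rewrite mxE cstarD cmulDl. Qed.

Let ipDr u v w : ip u (v + w) = ip u v + ip u w.
Proof. by rewrite -big_split; apply: eq_bigr => k _; rewrite mxE cmulDr. Qed.

Let ipZl k v w : ip (k *: v) w = k^* *: ip v w.
Proof. by rewrite scaler_sumr; apply: eq_bigr => i _; rewrite mxE cstarZ cmulZl. Qed.

Let ipZr k v w : ip v (k *: w) = k *: ip v w.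
Proof. by rewrite scaler_sumr; apply: eq_bigr => i _; rewrite mxE cmulZr. Qed.

Let ip_star v w : (ip v w)^c* = ip w v.
Proof. by rewrite cstar_sum; apply: eq_bigr => i _; rewrite cstarM cstarK. Qed.

Let vmul (v : V) (a : A) : V := map_mx (fun x => x *c a) v.

Let ip_vmull v w a : ip (vmul v a) w = a^c* *c ip v w.
Proof. by rewrite cmul_sumr; apply: eq_bigr => i _; rewrite mxE cstarM cmulA. Qed.

Let ip_vmulr v w a : ip v (vmul w a) = ip v w *c a.
Proof. by rewrite cmul_suml; apply: eq_bigr => i _; rewrite mxE cmulA. Qed.

Let ip_pos v : cpos (ip v v).
Proof. by apply: cpos_sum => i _; exists (v i ord0). Qed.

Let act (X : D) (v : V) : V := cmulmx X v.
Let nV (v : V) : R := colnorm v.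

Let nVE v : nV v = Num.sqrt (nrm (ip v v)).
Proof.
rewrite /nV /colnorm rnormE cmulmxE; congr (Num.sqrt (nrm _)).
by apply: eq_bigr => i _; rewrite cstarmxE.
Qed.

Let nV_ge0 v : 0 <= nV v. Proof. exact: sqrtr_ge0. Qed.

Let nV2 v : nV v ^+ 2 = nrm (ip v v).
Proof. by rewrite nVE sqr_sqrtr ?nrm_ge0. Qed.

Let nVZ k v : nV (k *: v) = nrm k * nV v.
Proof.
apply/eqP; rewrite -(@eqrXn2 _ 2) ?mulr_ge0 ?nrm_ge0//; apply/eqP.
by rewrite exprMn !nV2 ipZl ipZr !nrmZ nrm_conj mulrA -expr2.
Qed.

(* Cauchy-Schwarz: expand [<v a - s w, v a - s w> >= 0] for [a = <v, w>] and
   [s >= |<v, v>|]. *)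
Let ip_CS v w : nrm (ip v w) <= nV v * nV w.
Proof.
rewrite -(@ler_pXn2r _ 2) ?nnegrE ?mulr_ge0 ?nrm_ge0// exprMn !nV2.
set a := ip v w; set t := nrm (ip v v).
have key s : 0 < s -> t <= s -> nrm a ^+ 2 <= s * nrm (ip w w).
  move=> s0 ts; have h1 := ip_pos (vmul v a + (- s)%:C *: w).
  have h2 : cpos (s%:C *: (a^c* *c a) - a^c* *c ip v v *c a).
    apply/cposP; rewrite inUB inUZ !inUM inU_star.
    have -> : s%:C *: ((inU a)^c* * inU a) - (inU a)^c* * inU (ip v v) * inU a =
        (inU a)^c* * (rsc A s - inU (ip v v)) * inU a.
      by rewrite mulrBr rscr mulrBl -scalerAl.
    apply: upos_conj; have [] := @upos_of_nrm _ _ (inU (ip v v)) s => //.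
    - by rewrite -inU_star ip_star.
    - by rewrite nrm_inU.
  have h3 : cpos ((s ^+ 2)%:C *: ip w w - s%:C *: (a^c* *c a)).
    have -> : (s ^+ 2)%:C *: ip w w - s%:C *: (a^c* *c a) =
        ip (vmul v a + (- s)%:C *: w) (vmul v a + (- s)%:C *: w) +
        (s%:C *: (a^c* *c a) - a^c* *c ip v v *c a).
      rewrite !ipDl !ipDr !ipZl !ipZr !ip_vmull !ip_vmulr !conjC_real -/a -(ip_star v w) -/a.
      rewrite scalerA -rmorphM /= mulrNN -expr2 cmulA rmorphN !scaleNr.
      set X := a^c* *c ip v v *c a; set Y := s%:C *: _; set Z := _ *: ip w w.
      transitivity ((X - X) + (Y - Y) + (Z - Y)); first by rewrite !subrr !add0r.
      by zsum.
    exact: cposD.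
  have : nrm (s%:C *: (a^c* *c a)) <= nrm ((s ^+ 2)%:C *: ip w w).
    by apply: cpos_le_nrm => //; apply: cposZ; [exact: ltW|exists a].
  rewrite !nrmZ !nrm_real nrm_star_sq !ger0_norm ?exprn_ge0 ?(ltW s0)//.
  by rewrite expr2 -mulrA ler_pM2l.
have t0 : 0 <= t := nrm_ge0 _.
apply/ler_addgt0Pr => e e0; have w0 := nrm_ge0 (ip w w).
pose d := e / (nrm (ip w w) + 1).
have d0 : 0 < d by rewrite divr_gt0// ltr_wpDl.
rewrite (le_trans (key (t + d) _ _)) ?ltr_wpDl ?lerDl ?(ltW d0)//.
rewrite mulrDl lerD2l /d mulrAC ler_pdivrMr ?ltr_wpDl// ler_pM2l// lerDl//.
Qed.

Let nVD v w : nV (v + w) <= nV v + nV w.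
Proof.
rewrite -(@ler_pXn2r _ 2) ?nnegrE ?addr_ge0// nV2 ipDl !ipDr sqrrD.
rewrite (le_trans (nrmD _ _))// (le_trans (lerD (nrmD _ _) (nrmD _ _)))// -!nV2.
have h1 := ip_CS v w; have h2 := ip_CS w v; rewrite [nV w * _]mulrC in h2.
by rewrite mulr2n; lra.
Qed.

Let actDl S S' v : act (S + S') v = act S v + act S' v.
Proof. exact: cmulmxDl. Qed.

Let actZl k S v : act (k *: S) v = k *: act S v.
Proof.
apply/matrixP => i j; rewrite [RHS]mxE !cmulmxE scaler_sumr.
by apply: eq_bigr => l _; rewrite mxE cmulZl.
Qed.

Let actZr k S v : act S (k *: v) = k *: act S v.
Proof.
apply/matrixP => i j; rewrite [RHS]mxE !cmulmxE scaler_sumr.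
by apply: eq_bigr => l _; rewrite mxE cmulZr.
Qed.

Let actM (S S' : D) v : act (cmulmx S S') v = act S (act S' v).
Proof. by rewrite /act cmulmxA. Qed.

Let nV_entry (v : V) k : nrm (v k ord0) <= nV v.
Proof.
rewrite -(@ler_pXn2r _ 2) ?nnegrE ?nrm_ge0// nV2 -nrm_star_sq.
apply: cpos_le_nrm; first by exists (v k ord0).
rewrite /ip (bigD1 k)//= addrC addrK.
by apply: cpos_sum => i _; exists (v i ord0).
Qed.

Let nV_le_sum (v : V) : nV v <= \sum_k nrm (v k ord0).
Proof.
rewrite -(@ler_pXn2r _ 2) ?nnegrE ?sumr_ge0// => [|i _]; last exact: nrm_ge0.
rewrite nV2 (le_trans (nrm_sum _ _ _))// expr2 mulr_suml; apply: ler_sum => i _.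
rewrite nrm_star_sq expr2 ler_wpM2l ?nrm_ge0// (bigD1 i)//= lerDl sumr_ge0// => j _.
exact: nrm_ge0.
Qed.

Let act_bound (S : D) v : nV (act S v) <= (\sum_i \sum_j nrm (S i j)) * nV v.
Proof.
rewrite (le_trans (nV_le_sum _))// mulr_suml; apply: ler_sum => i _.
rewrite cmulmxE (le_trans (nrm_sum _ _ _))// mulr_suml; apply: ler_sum => j _.
by rewrite (le_trans (nrmM _ _))// ler_wpM2l ?nrm_ge0.
Qed.

Let act_bounded S : exists2 C, 0 <= C & forall v, nV (act S v) <= C * nV v.
Proof.
exists (\sum_i \sum_j nrm (S i j)); last exact: act_bound.
by do 2!apply: sumr_ge0 => ? _; exact: nrm_ge0.
Qed.

Let ip_adj (S : D) v w : ip (act S v) w = ip v (act (cstarmx S) w).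
Proof.
have ipE u u' : ip u u' = cmulmx (cstarmx u) u' ord0 ord0.
  by rewrite cmulmxE; apply: eq_bigr => i _; rewrite cstarmxE.
by rewrite !ipE /act cstarmxM -cmulmxA.
Qed.

Let act_star (S : D) v : nV (act S v) ^+ 2 <= nV v * nV (act (cmulmx (cstarmx S) S) v).
Proof. by rewrite nV2 ip_adj -actM ip_CS. Qed.

Let mnorm (X : D) : R := @opnorm R _ _ act nV X.

Let mnorm_ge0 X : 0 <= mnorm X. Proof. exact: opnorm_ge0. Qed.

(** Apply X to the column with the adjoint of X_ij in place j: its i-th coordinate has norm
    |X_ij|^2, while the column has norm at most |X_ij|. *)
Let mnorm_entry (X : D) i j : nrm (X i j) <= mnorm X.
Proof.
have [->|X0] := eqVneq (X i j) 0; first by rewrite nrm0.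
have X_gt0 : 0 < nrm (X i j) by rewrite lt_neqAle nrm_ge0 eq_sym nrm_eq0 X0.
pose v : V := \col_k if k == j then (X i j)^c* else 0.
have nv : nV v <= nrm (X i j).
  rewrite (le_trans (nV_le_sum _))// (bigD1 j)//= mxE eqxx nrm_star big1 ?addr0// => k kj.
  by rewrite mxE (negbTE kj) nrm0.
rewrite -(ler_pM2r X_gt0) -expr2 -nrm_star -nrm_star_sq cstarK.
have -> : X i j *c (X i j)^c* = act X v i ord0.
  rewrite cmulmxE (bigD1 j)//= mxE eqxx big1 ?addr0// => k kj.
  by rewrite mxE (negbTE kj) cmulr0.
rewrite (le_trans (nV_entry _ _))//.
rewrite (le_trans (@opnorm_bound _ _ _ act nV nV_ge0 nVZ actZr act_bounded X v))//.
by apply: ler_wpM2l; [exact: mnorm_ge0|rewrite nrm_star].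
Qed.

Let mnorm_le_sum (X : D) : mnorm X <= \sum_i \sum_j nrm (X i j).
Proof.
apply: opnorm_le => //.
by do 2!apply: sumr_ge0 => ? _; exact: nrm_ge0.
Qed.

Let mnormC (X : D) : R[i] := (mnorm X)%:C.

Let mnormCD x y : mnormC (x + y) <= mnormC x + mnormC y.
Proof. by rewrite -rmorphD lecR; exact: opnormD. Qed.

Let mnormCZ (k : R[i]) x : mnormC (k *: x) = `|k| * mnormC x.
Proof. by rewrite nrmE -rmorphM /=; congr (_%:C); exact: opnormZ. Qed.

Let mnormC0 x : mnormC x = 0 -> x = 0.
Proof.
move=> /complexI x0; apply/matrixP => i j; rewrite mxE; apply/nrm0_eq0/eqP.
by rewrite eq_le nrm_ge0 andbT -x0.
Qed.

HB.instance Definition _ :=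
  Lmodule_isNormed.Build R[i] D mnormCD mnormCZ mnormC0.

Lemma nrm_mxnorm (X : D) : nrm X = mxnorm X. Proof. by rewrite nrm_Re. Qed.

Lemma nrm_entry (X : D) i j : nrm (X i j) <= nrm X.
Proof. by rewrite nrm_mxnorm; exact: mnorm_entry. Qed.

Lemma nrm_le_entries (X : D) : nrm X <= \sum_i \sum_j nrm (X i j).
Proof. by rewrite nrm_mxnorm; exact: mnorm_le_sum. Qed.

Lemma nrm_le_entry (X : D) (e : R) : 0 <= e ->
  (forall i j, nrm (X i j) <= e) -> nrm X <= (n * n)%:R * e.
Proof.
move=> e0 Xe; rewrite (le_trans (nrm_le_entries X))//.
rewrite (@le_trans _ _ (\sum_(i < n) \sum_(j < n) e))//.
  by do 2!apply: ler_sum => ? _.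
by rewrite !sumr_const !card_ord -mulrnA mulr_natl.
Qed.

Let cmx_complete (F : set_system D) : ProperFilter F -> cauchy F -> cvg F.
Proof.
apply: seq_complete => u uc.
have /choice[l hl] ij : exists l : A, forall e, 0 < e ->
    exists N, forall k, (N <= k)%N -> nrm (u k ij.1 ij.2 - l) < e.
  apply: cauchy_nrm_cvg => e e0; have [N hN] := uc _ e0; exists N => p q Np Nq.
  rewrite (le_lt_trans _ (hN p q Np Nq))//.
  by have := nrm_entry (u p - u q) ij.1 ij.2; rewrite !mxE.
exists (\matrix_(i, j) l (i, j)) => e e0.
pose C : R := (n * n).+1%:R; have C0 : 0 < C by rewrite ltr0n.
have /choice[N hN] ij := hl ij _ (divr_gt0 e0 C0).
exists (\max_ij N ij)%N => k Nk.
rewrite (@le_lt_trans _ _ ((n * n)%:R * (e / C)))//.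
  apply: nrm_le_entry; first by rewrite ltW ?divr_gt0.
  move=> i j; rewrite !mxE ltW// (hN (i, j))// (leq_trans _ Nk)//.
  exact: (leq_bigmax_cond (F := N)).
by rewrite mulrA ltr_pdivrMr// mulrC ltr_pM2l// /C ltr_nat.
Qed.

HB.instance Definition _ := Uniform_isComplete.Build D cmx_complete.

Let mmulA : associative (@cmulmx R A n n n). Proof. exact: cmulmxA. Qed.
Let mmulDl : left_distributive (@cmulmx R A n n n : D -> D -> D) +%R.
Proof. by move=> X Y Z; exact: cmulmxDl. Qed.
Let mmulDr : right_distributive (@cmulmx R A n n n : D -> D -> D) +%R.
Proof. by move=> X Y Z; exact: cmulmxDr. Qed.
Let mmulZl (k : R[i]) (X Y : D) : cmulmx (k *: X : D) Y = k *: (cmulmx X Y : D).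
Proof.
apply/matrixP => i j; rewrite [RHS]mxE !cmulmxE scaler_sumr.
by apply: eq_bigr => l _; rewrite mxE cmulZl.
Qed.
Let mmulZr (k : R[i]) (X Y : D) : cmulmx X (k *: Y : D) = k *: (cmulmx X Y : D).
Proof.
apply/matrixP => i j; rewrite [RHS]mxE !cmulmxE scaler_sumr.
by apply: eq_bigr => l _; rewrite mxE cmulZr.
Qed.
Let mstarD : {morph (@cstarmx R A n n : D -> D) : X Y / X + Y}.
Proof. by move=> X Y; exact: cstarmxD. Qed.
Let mstarZ (k : R[i]) (X : D) : cstarmx (k *: X : D) = k^* *: (cstarmx X : D).
Proof. by apply/matrixP => i j; rewrite !mxE cstarZ. Qed.

Let mnormM (X Y : D) : `|(cmulmx X Y : D)| <= `|X| * `|Y|.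
Proof.
rewrite !nrmE !nrm_mxnorm -rmorphM lecR.
by apply: (@opnormM R D V (@cmulmx R A n n n) act nV).
Qed.

Let mnorm_star (X : D) : `|(cmulmx (cstarmx X) X : D)| = `|X| ^+ 2.
Proof.
rewrite !nrmE !nrm_mxnorm -rmorphXn; congr (_%:C).
by apply: (@opnorm_star R D V (@cmulmx R A n n n) (@cstarmx R A n n) act nV) => //; exact: cstarmxK.
Qed.

HB.instance Definition _ :=
  CompleteNormedModule_isCStarAlgebra.Build R D
    mmulA mmulDl mmulDr mmulZl mmulZr mstarD mstarZ (@cstarmxK R A n n) (@cstarmxM R A n n n)
    mnormM mnorm_star.

Lemma cmx_mulE (X Y : D) : X *c Y = cmulmx X Y. Proof. by []. Qed.

Lemma cmx_starE (X : D) : X^c* = cstarmx X. Proof. by []. Qed.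

Lemma cmx_scaleE (k : R[i]) (X : D) i j : (k *: X) i j = k *: X i j.
Proof. by rewrite mxE. Qed.

Lemma cposmxE (X : D) : cposmx X <-> cpos X. Proof. by []. Qed.

End matrix_cstar.

(** * Automatic contractivity of bounded morphisms *)

Section contractive_morphisms.
Context (R : realType) (A B : cstarAlgType R) (phi : A -> B) (C : R).
Hypotheses (phiM : forall x y, phi (x *c y) = phi x *c phi y)
  (phi_star : forall x, phi x^c* = (phi x)^c*)
  (phi_bounded : forall x, nrm (phi x) <= C * nrm x).

(** The C*-identity, iterated, gives |phi y|^(2^n) <= C |y|^(2^n) for all n. A ratio |phi x| / |x|
    above 1 would have these powers bounded, contrary to Bernoulli's inequality. *)
Lemma morph_contractive x : nrm (phi x) <= nrm x.
Proof.
have pow n y : nrm (phi y) ^+ (2 ^ n) <= C * nrm y ^+ (2 ^ n).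
  elim: n y => [|n IH] y; first by rewrite expn0 !expr1.
  by rewrite expnS !exprM -!nrm_star_sq -phi_star -phiM IH.
have [x0|x0] := eqVneq (nrm x) 0.
  by rewrite x0; have := phi_bounded x; rewrite x0 mulr0.
have xgt0 : 0 < nrm x by rewrite lt_neqAle eq_sym x0 nrm_ge0.
rewrite leNgt; apply/negP => lt; pose r := nrm (phi x) / nrm x.
have r1 : 1 < r by rewrite ltr_pdivlMr// mul1r.
have rC n : r ^+ (2 ^ n) <= C.
  by rewrite exprMn exprVn ler_pdivrMr ?exprn_gt0.
have bern n : 1 + n%:R * (r - 1) <= r ^+ n.
  elim: n => [|n IH]; first by rewrite mul0r addr0 expr0.
  rewrite exprS (le_trans _ (ler_wpM2l _ IH)) ?(le_trans ler01 (ltW r1))//.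
  have n0 : 0 <= n%:R :> R by []; have := sqr_ge0 (r - 1); rewrite -natr1; nra.
pose n := Num.bound (C / (r - 1)).
have r10 : 0 < r - 1 by rewrite subr_gt0.
have hn : C / (r - 1) < n%:R.
  apply: archi_boundP; rewrite divr_ge0 ?(ltW r10)//.
  by have := rC 0%N; rewrite expn0 expr1; apply: le_trans; rewrite (le_trans ler01)// ltW.
have := le_trans (bern (2 ^ n)%N) (rC n); apply/negP; rewrite -ltNge.
rewrite (@lt_le_trans _ _ (n%:R * (r - 1)))//; first by rewrite -ltr_pdivrMr.
rewrite (@le_trans _ _ ((2 ^ n)%:R * (r - 1)))//; last by rewrite lerDr.
by rewrite ler_wpM2r ?(ltW r10)// ler_nat ltnW// ltn_expl.
Qed.

End contractive_morphisms.

(** * Cuntz comparison *)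

Section cuntz_comparison.
Context (R : realType) (D : cstarAlgType R).
Implicit Types (a b c x y : D) (e : R) (I J K : finType).

(* Cuntz comparison of the diagonal matrices with entries [p] and [q]. *)
Definition fle I J (p : I -> D) (q : J -> D) := forall e, 0 < e ->
  exists X : J -> I -> D, forall i i',
    nrm (\sum_j (X j i)^c* *c q j *c X j i' - (if i == i' then p i else 0)) <= e.

Definition cle a b := forall e, 0 < e -> exists x, nrm (x^c* *c b *c x - a) <= e.

(** The witnesses multiply as matrices. [Y] is chosen after [X], since its error is multiplied by
    the sums of |X j i| |X j' i'|, all bounded by C. *)
Lemma fle_trans I J K (p : I -> D) (q : J -> D) (r : K -> D) :
  fle p q -> fle q r -> fle p r.
Proof.
move=> pq qr e e0; have [X hX] := pq _ (divr_gt0 e0 (ltr0n _ 2)).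
pose C := \sum_i \sum_i' \sum_j \sum_j' nrm (X j i) * nrm (X j' i').
have XX0 i i' j j' : 0 <= nrm (X j i) * nrm (X j' i') by rewrite mulr_ge0 ?nrm_ge0.
have Cii i i' : \sum_j \sum_j' nrm (X j i) * nrm (X j' i') <= C.
  rewrite /C (bigD1 i)//= (bigD1 i')//= -addrA lerDl addr_ge0//.
    by do 3!apply: sumr_ge0 => ? _.
  by do 4!apply: sumr_ge0 => ? _.
have C0 : 0 <= C by do 4!apply: sumr_ge0 => ? _.
have d0 : 0 < e / 2 / (C + 1) by rewrite !divr_gt0// ltr_wpDl.
have [Y hY] := qr _ d0.
exists (fun k i => \sum_j Y k j *c X j i) => i i'.
pose S j j' := \sum_k (Y k j)^c* *c r k *c Y k j'.
have -> : \sum_k (\sum_j Y k j *c X j i)^c* *c r k *c (\sum_j Y k j *c X j i') =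
    \sum_j \sum_j' (X j i)^c* *c S j j' *c X j' i'.
  transitivity (\sum_k \sum_j \sum_j' (X j i)^c* *c ((Y k j)^c* *c r k *c Y k j') *c X j' i').
    apply: eq_bigr => k _; rewrite cstar_sum !cmul_suml; apply: eq_bigr => j _.
    by rewrite cmul_sumr; apply: eq_bigr => j' _; rewrite cstarM !cmulA.
  rewrite exchange_big; apply: eq_bigr => j _; rewrite exchange_big.
  by apply: eq_bigr => j' _; rewrite /S cmul_sumr cmul_suml.
have -> : \sum_j \sum_j' (X j i)^c* *c S j j' *c X j' i' =
    \sum_j (X j i)^c* *c q j *c X j i' +
    \sum_j \sum_j' (X j i)^c* *c (S j j' - (if j == j' then q j else 0)) *c X j' i'.
  rewrite -big_split; apply: eq_bigr => j _ /=.
  have -> : (X j i)^c* *c q j *c X j i' =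
      \sum_j' (X j i)^c* *c (if j == j' then q j else 0) *c X j' i'.
    rewrite (bigD1 j)//= eqxx big1 ?addr0// => j' jj'.
    by rewrite eq_sym (negbTE jj') cmulr0 cmul0r.
  by rewrite -big_split; apply: eq_bigr => j' _ /=; rewrite -cmulDl -cmulDr addrC subrK.
rewrite addrAC (splitr e) (le_trans (nrmD _ _))// lerD//.
rewrite (@le_trans _ _ (C * (e / 2 / (C + 1))))//; last first.
  by rewrite mulrCA ler_piMr ?divr_ge0 ?(ltW e0)// ler_pdivrMr ?mul1r ?lerDl// ltr_wpDl.
rewrite (@le_trans _ _ ((\sum_j \sum_j' nrm (X j i) * nrm (X j' i')) * (e / 2 / (C + 1))))//.
  rewrite mulr_suml (le_trans (nrm_sum _ _ _))//; apply: ler_sum => j _.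
  rewrite mulr_suml (le_trans (nrm_sum _ _ _))//; apply: ler_sum => j' _.
  rewrite (le_trans (nrmM _ _))// mulrAC ler_wpM2r ?nrm_ge0//.
  by rewrite (le_trans (nrmM _ _))// nrm_star ler_wpM2l ?nrm_ge0//; exact: hY.
by rewrite ler_wpM2r// ltW.
Qed.

Lemma cle_fle a b : cle a b <-> fle (fun _ : unit => a) (fun _ : unit => b).
Proof.
split=> ab e e0; have [x hx] := ab e e0.
  by exists (fun _ _ => x) => i i'; rewrite (bigD1 tt)//= big1 ?addr0 ?eq_sym// => -[].
exists (x tt tt); have := hx tt tt.
by rewrite (bigD1 tt)//= big1 ?addr0// => -[].
Qed.

Lemma cle_trans b a c : cle a b -> cle b c -> cle a c.
Proof. by rewrite !cle_fle; exact: fle_trans. Qed.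

Lemma fle_card I J I' J' a b : #|I'| = #|I| -> #|J'| = #|J| ->
  fle (fun _ : I => a) (fun _ : J => b) -> fle (fun _ : I' => a) (fun _ : J' => b).
Proof.
move=> cI cJ ab e e0; have [X hX] := ab e e0.
pose f (i : I') : I := enum_val (cast_ord cI (enum_rank i)).
pose g (j : J') : J := enum_val (cast_ord cJ (enum_rank j)).
have fI : injective f.
  by move=> i i' /enum_val_inj/cast_ord_inj/enum_rank_inj.
have gB : bijective g.
  exists (fun j => enum_val (cast_ord (esym cJ) (enum_rank j))) => j.
    by rewrite /g enum_valK cast_ordK enum_rankK.
  by rewrite /g enum_valK cast_ordKV enum_rankK.
exists (fun j i => X (g j) (f i)) => i i'.
have := hX (f i) (f i'); rewrite (inj_eq fI) => h; apply: le_trans h.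
by rewrite [in leRHS](reindex g)//=; apply: onW_bij.
Qed.

Lemma fle_pointwise I (p q : I -> D) : (forall i, cle (p i) (q i)) -> fle p q.
Proof.
move=> pq e e0; have /choice[x hx] i := pq i e e0.
exists (fun j i => if j == i then x i else 0) => i i'.
rewrite (bigD1 i)//= eqxx big1 ?addr0 => [|j /negbTE ji].
  by case: eqVneq => [<-//|_]; rewrite cmulr0 subr0 nrm0 ltW.
by rewrite ji cstar0 !cmul0r.
Qed.

Definition fsum I J (p : I -> D) (q : J -> D) (s : I + J) : D :=
  match s with inl i => p i | inr j => q j end.

Lemma fle_sum I J I' J' (p : I -> D) (q : J -> D) (p' : I' -> D) (q' : J' -> D) :
  fle p q -> fle p' q' -> fle (fsum p p') (fsum q q').
Proof.
move=> pq pq' e e0; have [X hX] := pq e e0; have [X' hX'] := pq' e e0.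
exists (fun s t => match s, t with inl j, inl i => X j i | inr j, inr i => X' j i
                   | _, _ => 0 end) => i i'.
have z1 (c x : D) : (0 : D)^c* *c c *c x = 0 by rewrite cstar0 !cmul0r.
have z2 (c x : D) : x *c c *c 0 = 0 by rewrite cmulr0.
rewrite big_sumType /=; case: i i' => [i|i] [i'|i'] /=.
- by rewrite [X in _ + X - _]big1 ?addr0//; exact: hX.
- by rewrite !big1 ?addr0 ?subrr ?nrm0 ?ltW.
- by rewrite !big1 ?addr0 ?subrr ?nrm0 ?ltW.
- by rewrite big1 ?add0r//; exact: hX'.
Qed.

Lemma fle_prod I J K (p : I -> D) (q : J -> D) : fle p q ->
  fle (fun i : I * K => p i.1) (fun j : J * K => q j.1).
Proof.
move=> pq e e0; have [X hX] := pq e e0.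
exists (fun s t => if s.2 == t.2 then X s.1 t.1 else 0) => -[i k] [i' k'] /=.
rewrite -(pair_bigA _ (fun j l => (if l == k then X j i else 0)^c* *c q j *c
  (if l == k' then X j i' else 0))) /=.
have -> : \sum_j \sum_l (if l == k then X j i else 0)^c* *c q j *c (if l == k' then X j i' else 0) =
    if k == k' then \sum_j (X j i)^c* *c q j *c X j i' else 0.
  case: eqVneq => [<-|kk'].
    apply: eq_bigr => j _; rewrite (bigD1 k)//= eqxx big1 ?addr0// => l /negbTE lk.
    by rewrite lk cmulr0.
  rewrite big1// => j _; rewrite big1// => l _.
  by case: (eqVneq l k) => [->|_]; rewrite ?(negbTE kk') ?cmulr0// cstar0 !cmul0r.
rewrite -pair_eqE /pair_eq /= andbC; case: eqVneq => [_|_] /=; first exact: hX.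
by rewrite subrr nrm0 ltW.
Qed.

(** The element usually written (a - e)_+. *)
Definition cut e a : D := fc a (fun t => Num.max (t - e) 0).

Lemma cut_cpos e a : 0 <= e -> cpos a -> cpos (cut e a).
Proof.
move=> e0 a0; apply: cpos_fc => //; first exact: czero_cut.
by move=> t _; rewrite le_max lexx orbT.
Qed.

Lemma cut_close e a : 0 <= e -> cpos a -> nrm (cut e a - a) <= e.
Proof.
move=> e0 a0; have asa := cpos_sa a0.
rewrite -[X in _ - X](fc_id asa) -fcB//; last 2 first.
- exact: czero_cut.
- exact: czero_id.
apply: cpos_fc_nrm => //; first exact/czeroB/czero_id/czero_cut.
move=> t /andP[t0 _]; rewrite distrC ger0_norm; last by rewrite subr_ge0 ge_max t0 andbT lerBlDr lerDl.
by rewrite lerBlDr -lerBlDl le_max lexx.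
Qed.

Lemma cle_closed a b : (forall e, 0 < e -> exists2 a', nrm (a' - a) <= e & cle a' b) ->
  cle a b.
Proof.
move=> ab e e0; have e2 : 0 < e / 2 by rewrite divr_gt0.
have [a' aa' /(_ _ e2)[x hx]] := ab _ e2; exists x.
by rewrite (le_trans (nrm_triangle a' _ _))// (splitr e) lerD.
Qed.

Lemma cle_conj x a : cle (x^c* *c a *c x) a.
Proof. by move=> e e0; exists x; rewrite subrr nrm0 ltW. Qed.

(** With k^2 = (t - e)_+ / g(t) one gets k(a) g(a) k(a) = (a - e)_+, which is within e of [a].
    Evaluating the denominator at max(t, e) keeps it positive and changes nothing where the
    numerator is nonzero. *)
Lemma cle_fc a (g : R -> R) : cpos a -> czero g -> (forall t, 0 < t -> 0 < g t) ->
  cle a (fc a g).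
Proof.
move=> a0 gz g0 e e0; have asa := cpos_sa a0.
pose k t := Num.sqrt (Num.max (t - e) 0 / g (Num.max t e)).
have gm t : 0 < g (Num.max t e) by rewrite g0// lt_max e0 orbT.
have kz : czero k.
  apply/czero_sqrt/czeroMl; first exact/czero_cut/ltW.
  apply: cont_inv => [t|]; first by rewrite gt_eqF.
  by apply: (@cont_comp _ g); [case: gz|exact/cont_max/cont_cst/cont_id].
exists (fc a k); rewrite fc_sa// -!fcM//; last exact: czeroM.
rewrite (_ : fc a _ = cut e a); first exact/cut_close/a0/ltW.
apply: fc_eq => t _; rewrite mulrAC -expr2 sqr_sqrtr; last first.
  by rewrite divr_ge0 ?le_max ?lexx ?orbT// ltW.
case: (leP (t - e) 0) => te; first by rewrite !mul0r.
rewrite (_ : Num.max t e = t); last by rewrite max_l// -subr_ge0 ltW.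
by rewrite mulrAC -mulrA mulfV ?mulr1// gt_eqF// g0// (lt_trans e0)// -subr_gt0.
Qed.

Lemma cle_refl a : cpos a -> cle a a.
Proof.
move=> a0; rewrite -{2}(fc_id (cpos_sa a0)); apply: cle_fc => //; exact: czero_id.
Qed.

(* With [G] close to [1] on the part of [b] above [e], the error
   [a^(1/2) (1 - G)(b) a^(1/2)] has the same norm as
   [(1 - G)(b)^(1/2) a (1 - G)(b)^(1/2) <= ((1 - G) id)(b) <= e]. *)
Lemma cle_le a b : cpos a -> cpos (b - a) -> cle a b.
Proof.
move=> a0 ab e e0; have asa := cpos_sa a0.
have b0 : cpos b by rewrite -(subrK a b); exact: cposD.
have bsa := cpos_sa b0; have /cposP bU := b0.
pose k t := Num.sqrt (Num.max (t - e) 0) / Num.max t e.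
pose G t := Num.max (t - e) 0 / Num.max t e.
have m0 t : 0 < Num.max t e by rewrite lt_max e0 orbT.
have mc : continuous (fun t => (Num.max t e)^-1).
  by apply: cont_inv => [t|]; [rewrite gt_eqF|exact/cont_max/cont_cst/cont_id].
have kz : czero k by apply: czeroMl => //; exact/czero_sqrt/czero_cut/ltW.
have Gz : czero G by apply: czeroMl => //; exact/czero_cut/ltW.
have kG : fc b k *c b *c fc b k = fc b G.
  rewrite -{2}(fc_id bsa) -fcM//; last exact: czero_id.
  rewrite -fcM//; last by apply: czeroM => //; exact: czero_id.
  apply: fc_eq => t _; rewrite /k /G.
  case: (leP (t - e) 0) => te; first by rewrite sqrtr0 !mul0r.
  rewrite (_ : Num.max t e = t); last by rewrite max_l// -subr_ge0 ltW.
  have t0 : t != 0 by rewrite gt_eqF// (lt_trans e0)// -subr_gt0.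
  by rewrite -[in RHS](sqr_sqrtr (ltW te)); field.
pose s := fc a Num.sqrt; have sz : czero (@Num.sqrt R) := czero_sqrt (@czero_id R).
have ssa : s^c* = s by exact: fc_sa.
have ss : s *c s = a.
  rewrite /s -fcM// -[RHS](fc_id asa); apply: cpos_fc_eq => //.
  - exact: czeroM.
  - exact: czero_id.
  - by move=> t /andP[t0 _]; rewrite -expr2 sqr_sqrtr.
exists (fc b k *c s); rewrite cstarM ssa fc_sa// !cmulA.
rewrite -(cmulA s) -(cmulA s (_ *c _)) kG.
have [Gc _] := Gz.
have G1 t : G t <= 1.
  rewrite /G ler_pdivrMr// mul1r ge_max le_max lerBlDr lerDl (ltW e0) /=.
  by rewrite le_max (ltW e0) orbT.
pose r := fcU (inU b) (fun t => Num.sqrt (1 - G t)).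
have G1c : continuous (fun t => 1 - G t) by exact/contD/contN/Gc/cont_cst.
have rc := cont_sqrt G1c.
have bUsa : (inU b)^c* = inU b by rewrite -inU_star bsa.
have rsa : r^c* = r by exact: fcU_sa.
have rr : r * r = 1 - inU (fc b G).
  rewrite /r -fcUM// inU_fc// -(rsc1 D) -(fcU_cst 1 bUsa) -fcUB//; last exact: cont_cst.
  by apply: fcU_eq => t _; rewrite -expr2 sqr_sqrtr// subr_ge0.
have -> : nrm (s *c fc b G *c s - a) = nrm (r * inU a * r).
  rewrite -nrm_inU inUB !inUM -nrmN opprB -{1}ss inUM.
  have -> : inU s * inU s - inU s * inU (fc b G) * inU s = (r * inU s)^c* * (r * inU s).
    rewrite ustarM rsa -inU_star ssa (mulrA _ r) -(mulrA (inU s) r r) rr.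
    by rewrite mulrBr mulrBl mulr1.
  rewrite [LHS]nrm_star_sq -nrm_star -nrm_star_sq cstarK ucmulE.
  by rewrite ustarM rsa -inU_star ssa -ss inUM !mulrA.
rewrite (@le_trans _ _ (nrm (r * inU b * r)))//.
  apply: upos_le_nrm.
    by rewrite -{1}rsa; apply/upos_conj/cposP.
  by rewrite -mulrBl -mulrBr -inUB -{1}rsa; apply/upos_conj/cposP.
have -> : r * inU b * r = fcU (inU b) (fun t => (1 - G t) * t).
  rewrite -{1}(fcU_id bUsa) /r -fcUM//; last exact: cont_id.
  rewrite -fcUM//; last exact/contM/cont_id.
  apply: fcU_eq => t _; rewrite mulrAC -expr2 sqr_sqrtr// subr_ge0//.
have Ge t : 0 <= t -> (1 - G t) * t <= e.
  move=> t0; rewrite /G; case: (leP (t - e) 0) => te.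
    by rewrite mul0r subr0 mul1r -subr_le0.
  rewrite (_ : Num.max t e = t); last by rewrite max_l// -subr_ge0 ltW.
  have tn0 : t != 0 by rewrite gt_eqF// (lt_trans e0)// -subr_gt0.
  by rewrite mulrBl divfK// mul1r subKr.
have z : czero (fun t => (1 - G t) * t) by apply: czeroMr => //; exact: czero_id.
rewrite -inU_fc// nrm_inU; apply: cpos_fc_nrm => // t /andP[t0 _].
by rewrite ger0_norm ?Ge// mulr_ge0// subr_ge0.
Qed.

(** Put d = (a - e)_+. Then d^3 = d a d - e d^2 <= d b d since a - b <= e, and d <~ d^3 because t^3
    > 0 for t > 0. Closeness in norm thus becomes exact comparison at the cost of a cut. *)
Lemma cle_cut e a b : 0 <= e -> cpos a -> cpos b -> nrm (a - b) <= e -> cle (cut e a) b.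
Proof.
move=> e0 a0 b0 abe; have asa := cpos_sa a0; set d := cut e a.
have d0 : cpos d by exact: cut_cpos.
have dsa := cpos_sa d0; have dz := czero_cut e0.
have id := @czero_id R.
have d3E : d *c d *c d = fc d (fun t => t ^+ 3).
  rewrite -{1 2 3}(fc_id dsa) -!fcM//; last exact: czeroM.
  by apply: fc_eq => t _; rewrite !exprS expr0 mulr1 mulrA.
apply: (@cle_trans (d *c d *c d)).
  rewrite d3E; apply: cle_fc => //; first exact: (czeroX 2).
  by move=> t t0; rewrite exprn_gt0.
apply: (@cle_trans (d^c* *c b *c d)); last exact: cle_conj.
apply: cle_le; first by rewrite -{1}dsa; exact: cpos_conj.
have [_ h] : upos (rsc D e - inU (a - b)) /\ upos (rsc D e + inU (a - b)).
  by apply: upos_of_nrm; rewrite ?nrm_inU// -inU_star cstarB asa (cpos_sa b0).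
have [h' _] : upos (rsc D e - inU (a - b)) /\ upos (rsc D e + inU (a - b)).
  by apply: upos_of_nrm; rewrite ?nrm_inU// -inU_star cstarB asa (cpos_sa b0).
have d3' : d *c d *c d = d *c a *c d - e%:C *: (d *c d).
  rewrite -{1}(fc_id asa) /d /cut -!fcM//; last 2 first.
  - exact: czeroM.
  - exact: czeroM.
  rewrite -fcZ//; last exact: czeroM.
  rewrite -fcB//; last 2 first.
  - by apply: czeroM => //; exact: czeroM.
  - by apply: czeroMr; [exact: cont_cst|exact: czeroM].
  apply: fc_eq => t _; case: (leP (t - e) 0) => te; last by ring.
  by rewrite !mul0r mulr0 subr0.
apply/cposP; rewrite d3' dsa opprB inUD inUB inUZ !inUM.
have -> : inU d * inU b * inU d + (e%:C *: (inU d * inU d) - inU d * inU a * inU d) =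
    (inU d)^c* * (rsc D e - inU (a - b)) * inU d.
  rewrite -inU_star dsa inUB !mulrBr !mulrBl rscr -scalerAl !opprB.
  by zsum.
exact: upos_conj.
Qed.

End cuntz_comparison.

Lemma sum_unit (V : nmodType) (F : unit -> V) : \sum_j F j = F tt.
Proof. by rewrite (bigD1 tt)//= big1 ?addr0// => -[]. Qed.

(** * Comparison of conjugates, sums and orthogonal elements *)

Section comparison_tools.
Context (R : realType) (D : cstarAlgType R).
Implicit Types (a b c x y z h : D) (e t : R) (I J K : finType).

Lemma cle_scale t a : cpos a -> 0 < t -> cle (t%:C *: a) a.
Proof.
move=> a0 t0; have ta0 : cpos (t%:C *: a) := cposZ (ltW t0) a0.
have tsa := cpos_sa ta0.
have -> : cle (t%:C *: a) a = cle (t%:C *: a) (fc (t%:C *: a) (fun s => t^-1 * s)).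
  by rewrite fcZ ?fc_id//; [rewrite scalerA -rmorphM /= mulVf ?gt_eqF// scale1r|exact: czero_id].
apply: cle_fc => //; first by apply: czeroMr; [exact: cont_cst|exact: czero_id].
by move=> s s0; rewrite mulr_gt0// invr_gt0.
Qed.

Lemma cle_fc_le a (f : R -> R) (C : R) : cpos a -> czero f -> 0 < C ->
  (forall t, 0 <= t <= nrm a -> 0 <= f t <= C * t) -> cle (fc a f) a.
Proof.
move=> a0 f0 C0 fC; have asa := cpos_sa a0.
apply: (@cle_trans _ _ (C%:C *: a)); last exact: cle_scale.
have cz : czero (fun t => C * t) by apply: czeroMr; [exact: cont_cst|exact: czero_id].
apply: cle_le; first by apply: cpos_fc => // t /fC/andP[].
have -> : C%:C *: a = fc a (fun t => C * t) by rewrite fcZ ?fc_id//; exact: czero_id.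
rewrite -fcB//; apply: cpos_fc => //; first exact: czeroB.
by move=> t /fC/andP[_]; rewrite subr_ge0.
Qed.

Lemma cle_sqr a : cpos a -> cle a (a *c a).
Proof.
move=> a0; have asa := cpos_sa a0.
have -> : a *c a = fc a (fun t => t * t).
  by rewrite fcM ?fc_id//; exact: czero_id.
apply: cle_fc => //; first by apply: czeroM; exact: czero_id.
by move=> t t0; rewrite mulr_gt0.
Qed.

(** The square of z z^* is z (z^* z) z^*, and a positive element is below its square. *)
Lemma cle_swap z : cle (z *c z^c*) (z^c* *c z).
Proof.
have z0 : cpos (z *c z^c*) by exists z^c*; rewrite cstarK.
apply: cle_trans (cle_sqr z0) _.
have -> : z *c z^c* *c (z *c z^c*) = (z^c*)^c* *c (z^c* *c z) *c z^c*.
  by rewrite cstarK !cmulA.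
exact: cle_conj.
Qed.

Lemma sqr_cle a : cpos a -> cle (a *c a) a.
Proof.
move=> a0; have asa := cpos_sa a0.
have -> : a *c a = fc a (fun t => t * t).
  by rewrite fcM ?fc_id//; exact: czero_id.
have cz := @czero_id R.
apply: (@cle_fc_le _ _ (nrm a + 1)) => //; first exact: czeroM.
  by rewrite ltr_wpDl// nrm_ge0.
move=> t /andP[t0 ta]; rewrite mulr_ge0//= ler_wpM2r//.
by rewrite (le_trans ta)// lerDl.
Qed.

(** For b = u^* u, [cle_swap] turns a b a into u a^2 u^*, which is below a^2 and hence below [a]. *)
Lemma cle_her a b : cpos a -> cpos b -> cle (a *c b *c a) a.
Proof.
move=> a0 [u ->]; have asa := cpos_sa a0.
have -> : a *c (u^c* *c u) *c a = (a *c u^c*) *c (a *c u^c*)^c*.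
  by rewrite cstarM cstarK asa !cmulA.
apply: cle_trans (cle_swap _) _; rewrite cstarM cstarK asa.
have -> : u *c a *c (a *c u^c*) = (u^c*)^c* *c (a *c a) *c u^c* by rewrite cstarK !cmulA.
exact: cle_trans (cle_conj _ _) (sqr_cle a0).
Qed.

(** The relation says that x intertwines h with 0, and f(0) = 0. *)
Lemma fcU_orth (x : unitz D) h (f : R -> R) : h^c* = h -> czero f ->
  x * inU h = 0 -> x * inU (fc h f) = 0.
Proof.
move=> hsa fz xh; rewrite inU_fc//; have [fcont f0] := fz.
rewrite (@fcU_intertwine _ _ x _ 0)//; last by rewrite mul0r.
- rewrite (@fcU_eq _ _ 0 _ (fun=> 0)).
    by rewrite fcU_cst ?cstar0// rsc0 mul0r.
  by move=> t; rewrite nrm0 normr_le0 => /eqP ->.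
- by rewrite -inU_star hsa.
- by rewrite cstar0.
Qed.

Lemma fc_orth x h (f : R -> R) : h^c* = h -> czero f ->
  x *c h = 0 -> x *c fc h f = 0.
Proof.
move=> hsa fz xh; apply: inU_inj; rewrite inUM.
by apply: fcU_orth => //; rewrite -inUM xh.
Qed.

Lemma fc_unit x h (f : R -> R) : h^c* = h -> czero f ->
  x *c h = h -> x *c fc h f = fc h f.
Proof.
move=> hsa fz xh; have := @fcU_orth (1 - inU x) h f hsa fz.
rewrite !mulrBl !mul1r -!inUM xh subrr => /(_ erefl) /eqP.
by rewrite subr_eq0 => /eqP /inU_inj.
Qed.

(** One copy of [c] absorbs any number of orthogonal elements on which it acts as a unit; these
    elements are their own witnesses. *)
Lemma fle_orth_unit K (w : K -> D) c : (forall k, (w k)^c* = w k) ->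
  (forall k, c *c w k = w k) -> (forall k k', k != k' -> w k *c w k' = 0) ->
  fle (fun k => w k *c w k) (fun _ : unit => c).
Proof.
move=> wsa cw ww e e0; exists (fun _ k => w k) => k k'.
rewrite sum_unit.
rewrite wsa -cmulA cw; case: eqVneq => [->|kk']; first by rewrite subrr nrm0 ltW.
by rewrite ww// subrr nrm0 ltW.
Qed.

(** With f^2 = (t - e)_+ / t above e, f(b) b f(b) is the cut of [b]. Such elements are the standard
    witnesses for sums below. *)
Lemma approx_unit b e : cpos b -> 0 < e -> exists f : R -> R, czero f /\
  nrm (fc b f *c b *c fc b f - b) <= e.
Proof.
move=> b0 e0; have bsa := cpos_sa b0.
pose k t := Num.sqrt (Num.max (t - e) 0 / Num.max t e).
have kz : czero k.
  apply/czero_sqrt/czeroMl; first exact/czero_cut/ltW.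
  apply: cont_inv => [t|]; first by rewrite gt_eqF// lt_max e0 orbT.
  exact/cont_max/cont_cst/cont_id.
exists k; split => //.
rewrite -{2}(fc_id bsa) -fcM//; last exact: czero_id.
rewrite -fcM//; last by apply: czeroM => //; exact: czero_id.
rewrite (_ : fc b _ = cut e b); first exact/cut_close/b0/ltW.
apply: fc_eq => t _; rewrite mulrAC -expr2 sqr_sqrtr; last first.
  by rewrite divr_ge0 ?le_max ?lexx ?orbT// (ltW e0) orbT.
case: (leP (t - e) 0) => te; first by rewrite !mul0r.
rewrite (_ : Num.max t e = t); last by rewrite max_l// -subr_ge0 ltW.
by rewrite divfK// gt_eqF// (lt_trans e0)// -subr_gt0.
Qed.

(** The same approximate unit g of a + b, placed in both slots, gives g a g + g b g = g (a + b)
    g. *)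
Lemma fle_split K a b : cpos a -> cpos b ->
  fle (fun _ : K => a + b) (fsum (fun _ : K => a) (fun _ : K => b)).
Proof.
move=> a0 b0 e e0; have [f [fz hf]] := approx_unit (cposD a0 b0) e0.
set g := fc (a + b) f in hf; have gsa : g^c* = g by apply: fc_sa => //; exact/cpos_sa/cposD.
exists (fun s k => match s with inl k' => if k' == k then g else 0
                  | inr k' => if k' == k then g else 0 end) => i i'.
have one (q : D) : \sum_k (if k == i then g else 0)^c* *c q *c (if k == i' then g else 0) =
    if i == i' then g *c q *c g else 0.
  rewrite (bigD1 i)//= eqxx big1 ?addr0 => [|k /negbTE ->].
    by rewrite gsa; case: eqVneq => // _; rewrite cmulr0.
  by rewrite cstar0 !cmul0r.
rewrite big_sumType /= !one; case: eqVneq => _; last by rewrite addr0 subrr nrm0 ltW.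
by rewrite -cmulDl -cmulDr.
Qed.

(** The witnesses are approximate units of [a] and of [b]; being functions of these, they inherit
    the orthogonality, and the cross terms vanish. *)
Lemma fle_orth_sum a b : cpos a -> cpos b -> a *c b = 0 ->
  fle (fsum (fun _ : unit => a) (fun _ : unit => b)) (fun _ : unit => a + b).
Proof.
move=> a0 b0 ab e e0; have asa := cpos_sa a0; have bsa := cpos_sa b0.
have ba : b *c a = 0 by rewrite -[b *c a]cstarK cstarM asa bsa ab cstar0.
have [f [fz hf]] := approx_unit a0 e0; have [g [gz hg]] := approx_unit b0 e0.
set u := fc a f in hf; set v := fc b g in hg.
have usa : u^c* = u by exact: fc_sa.
have vsa : v^c* = v by exact: fc_sa.
have bu : b *c u = 0 by exact: fc_orth.
have av : a *c v = 0 by exact: fc_orth.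
have ub : u *c b = 0 by rewrite -[LHS]cstarK cstarM usa bsa bu cstar0.
have va : v *c a = 0 by rewrite -[LHS]cstarK cstarM vsa asa av cstar0.
exists (fun _ s => match s with inl _ => u | inr _ => v end) => i i'.
rewrite sum_unit.
case: i i' => [[]|[]] [[]|[]] /=; rewrite ?eqxx ?usa ?vsa ?cmulDr ?cmulDl ?ub ?va
  ?cmul0r ?addr0 ?add0r //.
- by rewrite -cmulA av cmulr0 subrr nrm0 ltW.
- by rewrite -cmulA bu cmulr0 subrr nrm0 ltW.
Qed.

Lemma fle_into_orth_sum K (p q : K -> D) : (forall k, cpos (q k)) ->
  (forall k k', k != k' -> q k *c q k' = 0) -> (forall k, cle (p k) (q k)) ->
  fle p (fun _ : unit => \sum_k q k).
Proof.
move=> q0 qq pq; apply: fle_trans (fle_pointwise pq) _ => e e0.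
have /choice[f hf] k := approx_unit (q0 k) e0.
pose u k := fc (q k) (f k); have usa k : (u k)^c* = u k.
  by apply: fc_sa; [exact/cpos_sa/q0|have [] := hf k].
have qu k k' : k != k' -> q k *c u k' = 0.
  move=> kk'; apply: fc_orth; [exact/cpos_sa/q0|by have [] := hf k'|exact: qq].
have Su k : (\sum_l q l) *c u k = q k *c u k.
  rewrite cmul_suml (bigD1 k)//= big1 ?addr0// => l lk; exact: qu.
exists (fun _ k => u k) => i i'.
rewrite sum_unit.
rewrite usa -cmulA Su; case: eqVneq => [<-|ii'].
  by rewrite cmulA; have [] := hf i.
rewrite subr0 cmulA.
have -> : u i *c q i' = 0.
  by rewrite -[LHS]cstarK cstarM usa (cpos_sa (q0 _)) qu ?cstar0// eq_sym.
by rewrite cmul0r nrm0 ltW.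
Qed.

End comparison_tools.

(** * The diagonal embedding, and exact comparison from approximate relations *)

Section diagonal_embedding.
Context (R : realType) (D : cstarAlgType R) (n : nat).
Implicit Types (a b : D).

Definition dg a : cmx D n := \matrix_(i, j) if i == j then a else 0.

Lemma dgE a i j : dg a i j = if i == j then a else 0. Proof. by rewrite mxE. Qed.

Lemma dgD a b : dg (a + b) = dg a + dg b.
Proof. by apply/matrixP => i j; rewrite !mxE; case: eqP; rewrite ?addr0. Qed.

Lemma dgZ (k : R[i]) a : dg (k *: a) = k *: dg a.
Proof. by apply/matrixP => i j; rewrite !mxE; case: eqP; rewrite ?scaler0. Qed.

Lemma dg_mull a (X : cmx D n) i j : (dg a *c X) i j = a *c X i j.
Proof.
rewrite cmulmxE (bigD1 i)//= dgE eqxx big1 ?addr0// => k /negbTE ki.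
by rewrite dgE eq_sym ki cmul0r.
Qed.

Lemma dg_mulr a (X : cmx D n) i j : (X *c dg a) i j = X i j *c a.
Proof.
rewrite cmulmxE (bigD1 j)//= dgE eqxx big1 ?addr0// => k /negbTE kj.
by rewrite dgE kj cmulr0.
Qed.

Lemma dgM a b : dg (a *c b) = dg a *c dg b.
Proof.
by apply/matrixP => i j; rewrite dg_mull !dgE; case: eqP; rewrite ?cmulr0.
Qed.

Lemma dg_star a : dg a^c* = (dg a)^c*.
Proof.
by apply/matrixP => i j; rewrite cstarmxE !dgE eq_sym; case: eqP; rewrite ?cstar0.
Qed.

(** Entries only bound the norm up to n^2; [morph_contractive] removes the factor. *)
Lemma dg_nrm a : nrm (dg a) <= nrm a.
Proof.
apply: (@morph_contractive _ _ _ dg (n * n)%:R dgM dg_star) => x.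
apply: nrm_le_entry => [|i j]; first exact: nrm_ge0.
by rewrite dgE; case: eqP => // _; rewrite nrm0 nrm_ge0.
Qed.

Lemma dg_fc a (f : R -> R) : a^c* = a -> czero f -> dg (fc a f) = fc (dg a) f.
Proof. exact: (morph_fc dgD dgZ dgM dg_star dg_nrm). Qed.

Lemma dg_cpos a : cpos a -> cpos (dg a).
Proof. by move=> [y ->]; exists (dg y); rewrite dgM dg_star. Qed.

End diagonal_embedding.

(** Makes an approximate relation exact by cutting [a]. The sums are the entries of a positive
    matrix S over D within N^2 e of diag(a, ..., a); [cle_cut], applied in M_N(D), compares the cut
    diagonal with S, and multiplying the witness by [X] leads from S to the copies of [c]. *)
Lemma fle_cut (R : realType) (D : cstarAlgType R) (N : nat) (J : finType)
    (a c : D) (X : J -> 'I_N -> D) (e : R) : cpos a -> cpos c -> 0 <= e ->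
  (forall i i', nrm (\sum_j (X j i)^c* *c c *c X j i' - (if i == i' then a else 0)) <= e) ->
  fle (fun _ : 'I_N => cut ((N * N)%:R * e) a) (fun _ : J => c).
Proof.
(* N = 0 is vacuous; it is set apart because positivity of S is shown with matrices that have a
   first row. *)
case: N X => [|N] X a0 c0 e0 hX; first by move=> d d0; exists (fun _ _ => 0) => -[].
set M := N.+1; pose E := cmx D M.
pose S : E := \matrix_(i, i') \sum_j (X j i)^c* *c c *c X j i'.
have S0 : cpos S.
  have [y cE] := c0.
  (* A square matrix with y X_j as first row and zeros elsewhere, so that S is the sum of the Y_j^*
     Y_j. *)
  pose Y j : E := \matrix_(r, i) if r == ord0 then y *c X j i else 0.
  have -> : S = \sum_j (Y j)^c* *c Y j.
    apply/matrixP => i i'; rewrite mxE summxE; apply: eq_bigr => j _.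
    rewrite cmulmxE (bigD1 ord0)//= big1 ?addr0 => [|r /negbTE r0].
      by rewrite cstarmxE !mxE eqxx cE cstarM !cmulA.
    by rewrite cstarmxE !mxE r0 cmulr0.
  by apply: cpos_sum => j _; exists (Y j).
have aS : nrm (dg M a - S) <= (M * M)%:R * e.
  rewrite nrmB; apply: nrm_le_entry => // i i'.
  have -> : (S - dg M a) i i' = S i i' - dg M a i i' by rewrite !mxE.
  by rewrite dgE mxE; exact: hX.
have Me0 : 0 <= (M * M)%:R * e by rewrite mulr_ge0.
have := cle_cut Me0 (dg_cpos M a0) S0 aS.
have -> : cut ((M * M)%:R * e) (dg M a) = dg M (cut ((M * M)%:R * e) a).
  by rewrite /cut dg_fc//; [exact: cpos_sa|exact: czero_cut].
move=> h d d0; have [Z hZ] := h d d0.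
exists (fun j i => \sum_l X j l *c Z l i) => i i'.
have sub (P Q : E) : (P - Q) i i' = P i i' - Q i i' by rewrite !mxE.
suff hE : (Z^c* *c S *c Z) i i' = \sum_j (\sum_l X j l *c Z l i)^c* *c c *c (\sum_l X j l *c Z l i').
  by have := le_trans (nrm_entry _ i i') hZ; rewrite sub hE dgE.
transitivity (\sum_j \sum_k' (\sum_k (Z k i)^c* *c ((X j k)^c* *c c *c X j k')) *c Z k' i').
  rewrite cmulmxE exchange_big; apply: eq_bigr => k' _ /=.
  rewrite cmulmxE -cmul_suml; congr (_ *c _).
  rewrite exchange_big; apply: eq_bigr => k _.
  by rewrite cstarmxE mxE cmul_sumr.
apply: eq_bigr => j _; rewrite cmul_sumr; apply: eq_bigr => k' _.
rewrite cmulA; congr (_ *c _); rewrite cstar_sum !cmul_suml; apply: eq_bigr => k _.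
by rewrite cstarM !cmulA.
Qed.

Ltac solve_czero :=
  repeat first [assumption | exact: czero_id | apply: czeroM].

(** * Minimal projections and splitting *)

Section minimal_projections.
Context (R : realType) (D : cstarAlgType R).
Implicit Types (a b c h p x y u : D).

Definition minproj p := [/\ p^c* = p, p *c p = p, p != 0 &
  forall x, exists k : R[i], p *c x *c p = k *: p].

Definition her y x := exists2 u, cpos u & x = y *c u *c y.

Lemma her_cpos y x : cpos y -> her y x -> cpos x.
Proof. by move=> y0 [u u0 ->]; rewrite -{1}(cpos_sa y0); exact: cpos_conj. Qed.

Lemma her_trans x y z : cpos y -> her y x -> her x z -> her y z.
Proof.
move=> y0 [u u0 ->] [v v0 ->]; have usa := cpos_sa u0; have ysa := cpos_sa y0.
exists ((y *c u)^c* *c v *c (y *c u)); first exact: cpos_conj.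
by rewrite cstarM usa ysa !cmulA.
Qed.

Lemma pow3_eq0 x : x^c* = x -> x *c x *c x = 0 -> x = 0.
Proof.
move=> xsa x3; apply: star_mul_eq0; apply: star_mul_eq0.
by rewrite cstarM !xsa cmulA x3 cmul0r.
Qed.

(* [her y x] is membership in y A_+ y; [splittable y] says that the hereditary
   subalgebra of [y] has nonzero orthogonal positive elements. *)
Definition splittable y := exists x1 x2,
  [/\ her y x1, her y x2, x1 != 0, x2 != 0 & x1 *c x2 = 0].

Section unsplittable.
Variables (y : D).
Hypotheses (y0 : cpos y) (yn0 : y != 0) (ysplit : ~ splittable y).

Let ysa : y^c* = y := cpos_sa y0.

Let her_orth x1 x2 : her y x1 -> her y x2 -> x1 *c x2 = 0 -> x1 = 0 \/ x2 = 0.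
Proof.
move=> h1 h2 x12; have [->|n1] := eqVneq x1 0; first by left.
have [->|n2] := eqVneq x2 0; first by right.
by exfalso; apply: ysplit; exists x1, x2.
Qed.

Let sa_her h := exists2 u, u^c* = u & h = y *c u *c y.

Let sa_her_sa h : sa_her h -> h^c* = h.
Proof. by move=> [u usa ->]; rewrite !cstarM usa ysa !cmulA. Qed.

Let her_sa_her h f : sa_her h -> cpos f -> her y (h *c f *c h).
Proof.
move=> [u usa ->] f0; exists ((y *c u)^c* *c f *c (y *c u)); first exact: cpos_conj.
by rewrite cstarM usa ysa !cmulA.
Qed.

Let fc_sqM h (f : R -> R) : h^c* = h -> czero f ->
  h *c fc h f *c h = fc h (fun t => t * f t * t).
Proof.
move=> hsa fz; have idz := @czero_id R.
by rewrite -{1 3}(fc_id hsa) -!fcM//; exact: czeroM.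
Qed.

(** Multiplication by h on both sides brings functions of h into the form y u y; disjoint supports
    make them orthogonal, and [y] cannot be split. In effect h has at most one spectral value
    besides 0. *)
Let disjoint_fc h (f g : R -> R) : sa_her h -> czero f -> czero g ->
  (forall t, `|t| <= nrm h -> 0 <= f t) -> (forall t, `|t| <= nrm h -> 0 <= g t) ->
  (forall t, f t * g t = 0) ->
  fc h (fun t => t * f t * t) = 0 \/ fc h (fun t => t * g t * t) = 0.
Proof.
move=> hh fz gz f0 g0 fg; have hsa := sa_her_sa hh; have idz := @czero_id R.
rewrite -!fc_sqM//; apply: her_orth.
- by apply: her_sa_her => //; exact: fc_cpos.
- by apply: her_sa_her => //; exact: fc_cpos.
rewrite !fc_sqM// -fcM//; [|solve_czero..].
rewrite -[RHS](fc0 hsa); apply: fc_eq => t _.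
transitivity (t ^+ 4 * (f t * g t)); first by ring.
by rewrite fg mulr0.
Qed.

(** Since |h| = 1, the part of h above 1 - d does not vanish, so the part between 0 and 1 - d does.
    Letting d tend to 0 gives h^3 (1 - h) = 0, hence (h - h^2)^3 = 0 and h = h^2. *)
Let projection_her h : sa_her h -> cpos h -> nrm h = 1 -> h *c h = h.
Proof.
move=> hh h0 h1; have hsa := cpos_sa h0; have idz := @czero_id R.
have normz : czero (fun t : R => `|t|).
  by split; [exact/cont_norm/cont_id|rewrite normr0].
have key (d : R) : 0 < d -> d < 1 ->
    fc h (fun t => t * (`|t| * Num.max (1 - d - `|t|) 0) * t) = 0.
  move=> d0 d1; have d10 : 0 < 1 - d by rewrite subr_gt0.
  have gz : czero (fun t => `|t| * Num.max (1 - d - `|t|) 0).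
    apply: czeroMl => //; apply/cont_max/cont_cst/contD/contN.
      exact: cont_cst.
    exact/cont_norm/cont_id.
  have cz := czero_cut (ltW d10).
  have [] := disjoint_fc hh gz cz.
  - by move=> t _; rewrite mulr_ge0// le_max lexx orbT.
  - by move=> t _; rewrite le_max lexx orbT.
  - move=> t; case: (leP (t - (1 - d)) 0) => te; first by rewrite mulr0.
    have t0 : 0 <= t by rewrite ltW// (lt_trans d10)// -subr_gt0.
    by rewrite ger0_norm// [Num.max (1 - d - t) 0]max_r ?mulr0 ?mul0r//; lra.
  - by [].
  move=> f0; exfalso.
  (* Undoes the factors t on both sides: t^2 (t - (1 - d))_+ q(t) = (t - (1 - d))_+. *)
  pose q t : R := t / Num.max t (1 - d) ^+ 3.
  have m0 t : 0 < Num.max t (1 - d) by rewrite lt_max d10 orbT.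
  have qz : czero q.
    apply: czeroMl => //; apply: cont_inv => [t|]; first by rewrite gt_eqF// exprn_gt0.
    exact/contX/cont_max/cont_cst/cont_id.
  have : cut (1 - d) h = 0.
    have -> : cut (1 - d) h = fc h (fun t => t * Num.max (t - (1 - d)) 0 * t) *c fc h q.
      rewrite -fcM//; last by solve_czero.
      apply: fc_eq => t _; rewrite /q; case: (leP (t - (1 - d)) 0) => te.
        by rewrite mulr0 !mul0r.
      rewrite max_l; last by rewrite -subr_ge0 ltW.
      by field; rewrite gt_eqF// (lt_trans d10)// -subr_gt0.
    by rewrite f0 cmul0r.
  move=> c0; have := cut_close (ltW d10) h0.
  by rewrite c0 sub0r nrmN h1 leNgt gtrBl d0.
have h34 : fc h (fun t => t ^+ 3 * (1 - t)) = 0.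
  have z34 : czero (fun t : R => t ^+ 3 * (1 - t)).
    by apply: czeroMl; [exact: (czeroX 2)|exact/contD/contN/cont_id/cont_cst].
  apply: (@nrm_small0 _ _ _ 1) => d d0; rewrite mul1r.
  have [d1|d1] := ltP d 1; last first.
    apply: le_trans d1; apply: cpos_fc_nrm => // t; rewrite h1 => /andP[t0 t1].
    rewrite ger0_norm ?mulr_ge0 ?exprn_ge0 ?subr_ge0// mulr_ile1 ?exprn_ge0 ?subr_ge0//.
      by rewrite exprn_ile1.
    by rewrite gerBl.
  have kz : czero (fun t : R => t * (`|t| * Num.max (1 - d - `|t|) 0) * t).
    apply: czeroM => //; apply: czeroM => //; apply: czeroMl => //.
    apply/cont_max/cont_cst/contD/contN; first exact: cont_cst.
    exact/cont_norm/cont_id.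
  rewrite -[X in nrm X]subr0 -(key d d0 d1) -fcB//.
  apply: cpos_fc_nrm => //; first exact: czeroB.
  move=> t; rewrite h1 => /andP[t0 t1]; rewrite (ger0_norm t0).
  have -> : t ^+ 3 * (1 - t) - t * (t * Num.max (1 - d - t) 0) * t =
      t ^+ 3 * (1 - t - Num.max (1 - d - t) 0) by ring.
  rewrite normrM ger0_norm ?exprn_ge0// (@le_trans _ _ (1 * d))//; last by rewrite mul1r.
  rewrite ler_pM ?exprn_ge0 ?exprn_ile1//.
  by case: (leP (1 - d - t) 0) => td; rewrite ler_norml; apply/andP; split; lra.
pose q := h - h *c h.
have qE : q = fc h (fun t => t - t * t).
  by rewrite fcB//; [rewrite fc_id// fcM// fc_id|solve_czero].
have qz : czero (fun t : R => t - t * t) by apply: czeroB => //; exact: czeroM.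
have q3 : q *c q *c q = 0.
  (* (t - t^2)^3 is t^3 (1 - t) times 1 - (2 t - t^2); the product is expanded so that only
     functions vanishing at 0 occur. *)
  have -> : q *c q *c q = fc h (fun t => t ^+ 3 * (1 - t)) - fc h (fun t => t ^+ 3 * (1 - t)) *c
      fc h (fun t => 2 * t - t * t).
    rewrite qE -!fcM//; last 3 first.
    - by apply: czeroMl; [exact: (czeroX 2)|exact/contD/contN/cont_id/cont_cst].
    - apply: czeroB; last exact: czeroM.
      by apply: czeroMr => //; exact: cont_cst.
    - exact: czeroM.
    rewrite -fcB//; last 2 first.
    - by apply: czeroMl; [exact: (czeroX 2)|exact/contD/contN/cont_id/cont_cst].
    - apply: czeroM; last apply: czeroB; last exact: czeroM.
        by apply: czeroMl; [exact: (czeroX 2)|exact/contD/contN/cont_id/cont_cst].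
      by apply: czeroMr => //; exact: cont_cst.
    by apply: fc_eq => t _; ring.
  by rewrite h34 cmul0r subr0.
have : q = 0 by apply: pow3_eq0 => //; rewrite qE fc_sa.
by move=> /eqP; rewrite subr_eq0 eq_sym => /eqP.
Qed.

Let sa_herZ (t : R) h : sa_her h -> sa_her (t%:C *: h).
Proof.
move=> [u usa ->]; exists (t%:C *: u); first by rewrite cstarZ conjC_real usa.
by rewrite cmulZr cmulZl.
Qed.

Let normalize h : cpos h -> h != 0 -> sa_her h ->
  let p := (nrm h)^-1%:C *: h in [/\ cpos p, p *c p = p, p != 0 & sa_her p].
Proof.
move=> h0 hn0 hh p; have hgt0 : 0 < nrm h by rewrite lt_neqAle eq_sym nrm_eq0 hn0 nrm_ge0.
have np : nrm p = 1 by rewrite nrmZ nrm_real ger0_norm ?invr_ge0 ?nrm_ge0// mulVf ?gt_eqF.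
have pp : sa_her p by exact: sa_herZ.
have p0 : cpos p by apply: cposZ => //; rewrite invr_ge0 nrm_ge0.
split => //; first exact: projection_her.
by rewrite -nrm_eq0 np oner_eq0.
Qed.

(** The normalized cube of [y] is a projection p. A nonzero positive g in p D p normalizes to a
    projection r <= p, and r is orthogonal to p - r, so r = p. Positive and negative parts, then
    real and imaginary parts, reduce every element to this case. *)
Lemma unsplittable_minproj : exists p, minproj p.
Proof.
have idz := @czero_id R.
(* The cube, rather than [y], since it has the form y u y. *)
pose h := y *c y *c y.
have h0 : cpos h by rewrite /h -{1}ysa; exact: cpos_conj.
have hn0 : h != 0 by apply/eqP => /(pow3_eq0 ysa)/eqP; apply/negP.
have hh : sa_her h by exists y.
have [p0 pp pn0 [u usa pE]] := normalize h0 hn0 hh; set p := _ *: h in p0 pp pn0 pE.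
clearbody p; have psa := cpos_sa p0.
have php x : x^c* = x -> sa_her (p *c x *c p).
  move=> xsa; exists (u *c y *c x *c y *c u); last by rewrite pE !cmulA.
  by rewrite !cstarM usa ysa xsa !cmulA.
have php' x : cpos x -> her y (p *c x *c p).
  move=> x0; apply: her_sa_her => //; by exists u.
have pos_case g : cpos g -> p *c g = g -> g *c p = g -> sa_her g -> exists k : R[i], g = k *: p.
  move=> g0 pg gp gh; have [->|gn0] := eqVneq g 0; first by exists 0; rewrite scale0r.
  have [r0 rr rn0 rh] := normalize g0 gn0 gh; set r := _ *: g in r0 rr rn0 rh.
  have pr : p *c r = r by rewrite cmulZr pg.
  have rp : r *c p = r by rewrite cmulZl gp.
  have rsa := cpos_sa r0.
  have prE : (p - r) *c (p - r) = p - r.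
    by rewrite cmulBl !cmulBr pp pr rp rr subrr subr0.
  have pr0 : cpos (p - r) by exists (p - r); rewrite cstarB psa rsa prE.
  have [] := @her_orth r (p - r).
  - by rewrite -rp -pr; exact: php'.
  - have -> : p - r = p *c (p - r) *c p by rewrite cmulBr cmulBl !pp pr rp.
    exact: php'.
  - by rewrite cmulBr rp rr subrr.
  - by move=> /eqP; rewrite (negbTE rn0).
  - move=> /eqP; rewrite subr_eq0 => /eqP prq; exists (nrm g)%:C.
    rewrite prq /r scalerA -rmorphM /= mulfV ?scale1r//.
    by rewrite nrm_eq0.
have sa_case x : x^c* = x -> exists k : R[i], p *c x *c p = k *: p.
  move=> xsa; set g := p *c x *c p; have gh : sa_her g by exact: php.
  have gsa := sa_her_sa gh.
  have pg : p *c g = g by rewrite /g !cmulA pp.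
  have gp : g *c p = g by rewrite /g -!cmulA pp.
  pose pos (t : R) := Num.max t 0; pose neg (t : R) := Num.max (- t) 0.
  have posz : czero pos by split; [exact/cont_max/cont_cst/cont_id|exact: maxxx].
  have negz : czero neg.
    by split; [exact/cont_max/cont_cst/contN/cont_id|rewrite /neg oppr0 maxxx].
  have pos0 t : 0 <= pos t by rewrite le_max lexx orbT.
  have neg0 t : 0 <= neg t by rewrite le_max lexx orbT.
  have pn t : pos t * neg t = 0.
    rewrite /pos /neg; case: (leP t 0) => t0; first by rewrite mul0r.
    by rewrite max_r ?mulr0// oppr_le0 ltW.
  have gE : g = fc g pos - fc g neg.
    rewrite -fcB// -{1}(fc_id gsa); apply: fc_eq => t _.
    by rewrite /pos /neg; case: (leP t 0) => t0; case: (leP (- t) 0) => t1; lra.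
  (* For the positive and the negative part, t f(t) t equals f(t)^3, so the alternative of
     [disjoint_fc] makes one of the two parts of g vanish. *)
  have cube (f : R -> R) : czero f -> (forall t, f t * f t * f t = t * f t * t) ->
      fc g (fun t => t * f t * t) = 0 -> fc g f = 0.
    move=> fz ff f3; apply: pow3_eq0; first exact: fc_sa.
    rewrite -!fcM//; last exact: czeroM.
    by rewrite -f3; apply: fc_eq => t _.
  have posc t : pos t * pos t * pos t = t * pos t * t.
    by rewrite /pos; case: (leP t 0) => t0; rewrite ?mulr0 ?mul0r.
  have negc t : neg t * neg t * neg t = t * neg t * t.
    by rewrite /neg; case: (leP (- t) 0) => t0; [rewrite ?mulr0 ?mul0r|ring].
  have [|||/(cube _ posz posc) f0|/(cube _ negz negc) f0] := disjoint_fc gh posz negz; try by move=> t _.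
  - exact: pn.
  - have [||||k kE] := pos_case (- g).
    + by rewrite gE f0 sub0r opprK; apply: fc_cpos.
    + by rewrite cmulrN pg.
    + by rewrite cmulNr gp.
    + by rewrite -scaleN1r -[-1](rmorphN1 (real_complex R)); exact: sa_herZ.
    + by exists (- k); rewrite scaleNr -kE opprK.
  - by apply: pos_case => //; rewrite gE f0 subr0; exact: fc_cpos.
exists p; split => // x.
pose x1 := 2^-1%:C *: (x + x^c*); pose x2 := (2^-1%:C * - 'i) *: (x - x^c*).
have xE : x = x1 + 'i *: x2.
  rewrite /x1 /x2 scalerA mulrCA mulrN -expr2 sqr_i opprK mulr1 -scalerDr.
  rewrite addrACA subrr addr0 -mulr2n -[x *+ 2]scaler_nat scalerA.
  rewrite -(rmorph_nat (real_complex R) 2) -rmorphM /= mulVf// scale1r.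
  by [].
have [k1 h1] : exists k : R[i], p *c x1 *c p = k *: p.
  by apply: sa_case; rewrite cstarZ conjC_real cstarD cstarK addrC.
have [k2 h2] : exists k : R[i], p *c x2 *c p = k *: p.
  apply: sa_case; rewrite cstarZ rmorphM /= conjC_real rmorphN /= conjC_i opprK.
  by rewrite cstarB cstarK /x2 mulrN scaleNr -scalerN opprB.
clearbody x1 x2.
by exists (k1 + 'i * k2); rewrite xE cmulDr cmulDl h1 cmulZr cmulZl h2 scalerA -scalerDl.
Qed.

End unsplittable.

End minimal_projections.

(** * Orthogonal families, common lower bounds and the reserve inside [b] *)

Section reserve.
Context (R : realType) (D : cstarAlgType R).
Implicit Types (a b c h p x y u : D) (K : finType).
Hypotheses (Dprime : forall x y, x != 0 -> y != 0 -> exists u, x *c u *c y != 0).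

Lemma her_refl_cle y x : cpos y -> her y x -> cle x y.
Proof. by move=> y0 [u u0 ->]; exact: cle_her. Qed.

(** Keep one half x1 of a splitting and continue inside the other half x2: what has the form x2 u x2
    is orthogonal to x1 and still of the form y v y. *)
Lemma orth_family N y :
  (forall x, her y x -> x != 0 -> splittable x) -> cpos y -> y != 0 -> splittable y ->
  exists x : 'I_N -> D, [/\ forall i, her y (x i), forall i, x i != 0 &
    forall i j, i != j -> x i *c x j = 0].
Proof.
move=> sp y0 yn0 sy; have [x1 [x2 [h1 h2 n1 n2 x12]]] := sy.
elim: N y sp y0 yn0 sy x1 x2 h1 h2 n1 n2 x12 => [|N IH] y sp y0 yn0 sy x1 x2 h1 h2 n1 n2 x12.
  by exists (fun _ => 0); split => [[]//|[]//|[]].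
have x20 := her_cpos y0 h2.
have [z1 [z2 [g1 g2 m1 m2 z12]]] := sp _ h2 n2.
have sp2 x : her x2 x -> x != 0 -> splittable x.
  by move=> hx; apply: sp; exact: her_trans hx.
have [x [hx nx xx]] := IH x2 sp2 x20 n2 (sp _ h2 n2) z1 z2 g1 g2 m1 m2 z12.
have x1x i : x1 *c x i = 0 by have [u _ ->] := hx i; rewrite !cmulA x12 !cmul0r.
have xx1 i : x i *c x1 = 0.
  rewrite -[LHS]cstarK cstarM (cpos_sa (her_cpos y0 h1)).
  by rewrite (cpos_sa (her_cpos x20 (hx i))) x1x cstar0.
exists (fun i => if unlift ord0 i is Some j then x j else x1); split.
- by move=> i; case: unliftP => [j _|_] //; exact: her_trans (hx j).
- by move=> i; case: unliftP => [j _|_].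
- move=> i j; case: unliftP => [i' ->|->]; case: unliftP => [j' ->|->] // ij.
  by apply: xx; apply: contraNneq ij => ->.
Qed.

(** One index at a time. Primeness gives u with z = y u x_k nonzero; z z^* has the form y v y, so
    the earlier comparisons persist, and it is also a conjugate of x_k^2, so it is below x_k. *)
Lemma common_lower K (x : K -> D) s : cpos s -> s != 0 -> (forall k, cpos (x k)) ->
  (forall k, x k != 0) -> exists y, [/\ her s y, y != 0 & forall k, cle y (x k)].
Proof.
move=> s0 sn0 x0 xn0.
suff [y [hy ny hk]] : exists y, [/\ her s y, y != 0 & forall k, k \in enum K -> cle y (x k)].
  by exists y; split => // k; apply: hk; rewrite mem_enum.
elim: (enum K) => [|k r [y [hy ny IH]]].
  exists (s *c s *c s); split => //; first by exists s.
  by apply/eqP => /(pow3_eq0 (cpos_sa s0))/eqP; apply/negP.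
have y0 := her_cpos s0 hy; have ysa := cpos_sa y0; have xsa := cpos_sa (x0 k).
have [u yux] := Dprime ny (xn0 k); pose z := y *c u *c x k.
have zzE : z *c z^c* = y *c (u *c x k *c x k *c u^c*) *c y.
  by rewrite /z !cstarM xsa ysa !cmulA.
have hz : her y (z *c z^c*).
  by exists (u *c x k *c x k *c u^c*); [exists (x k *c u^c*); rewrite cstarM cstarK xsa !cmulA|].
exists (z *c z^c*); split; first exact: her_trans hy hz.
  apply/eqP => zz0; have /star_mul_eq0 : (z^c*)^c* *c z^c* = 0 by rewrite cstarK.
  by move=> z0; move: yux; rewrite -/z -[z]cstarK z0 cstar0 eqxx.
move=> l; rewrite inE => /orP[/eqP ->|lr]; last first.
  by apply: cle_trans (IH l lr); exact: her_refl_cle.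
have -> : z *c z^c* = (u^c* *c y)^c* *c (x k *c x k) *c (u^c* *c y).
  by rewrite zzE cstarM cstarK ysa !cmulA.
exact: cle_trans (cle_conj _ _) (sqr_cle (x0 k)).
Qed.

(* Doubling [(k+1) a <= k b] makes room for [b <= c + b0] with [2k b0 <= c]: then
   [(2k+2) a <= 2k b <= (2k+1) c], while [e0] is orthogonal to [c]. *)
Lemma reserve (a b : D) k (e : R) : cpos a -> cpos b -> 0 < e ->
  (forall x, cpos x -> x != 0 -> splittable x) ->
  fle (fun _ : 'I_k.+1 => a) (fun _ : 'I_k => b) ->
  cle (cut e a) b \/ exists c e0 m, [/\ cpos c, cpos e0, e0 != 0,
    fle (fsum (fun _ : unit => c) (fun _ : unit => e0)) (fun _ : unit => b) &
    fle (fun _ : 'I_m.+1 => cut e a) (fun _ : 'I_m => c)].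
Proof.
move=> a0 b0 e_gt0 sp ab; have asa := cpos_sa a0; have bsa := cpos_sa b0.
have idz := @czero_id R.
(* On a cut of [b], a suitable function of [b] acts as a unit, which leaves room to work in. The
   small change of [b] is paid for by the cut of [a]. *)
have [d [d0 ab1]] : exists d, 0 < d /\ fle (fun _ : 'I_k.+1 => cut e a) (fun _ : 'I_k => cut d b).
  pose M : R := (k.+1 * k.+1)%:R; have M0 : 0 < M by rewrite ltr0n.
  have e20 : 0 < e / M / 2 by rewrite !divr_gt0.
  have [X hX] := ab _ e20.
  pose C := \sum_i \sum_i' \sum_j nrm (X j i) * nrm (X j i').
  have XX0 i i' j : 0 <= nrm (X j i) * nrm (X j i') by rewrite mulr_ge0 ?nrm_ge0.
  have Cii i i' : \sum_j nrm (X j i) * nrm (X j i') <= C.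
    rewrite /C (bigD1 i)//= (bigD1 i')//= -addrA lerDl addr_ge0//.
      by do 2!apply: sumr_ge0 => ? _.
    by do 3!apply: sumr_ge0 => ? _.
  have C0 : 0 <= C by do 3!apply: sumr_ge0 => ? _.
  pose d := e / M / 2 / (C + 1).
  have d0 : 0 < d by rewrite divr_gt0// ltr_wpDl.
  exists d; split => //.
  have -> : e = M * (e / M) by rewrite mulrCA mulfV ?mulr1// gt_eqF.
  have eM0 : 0 <= e / M by rewrite divr_ge0// ltW.
  apply: (fle_cut (X := X)) => //; first exact/cut_cpos/b0/ltW.
  move=> i i'.
  have -> : \sum_j (X j i)^c* *c cut d b *c X j i' =
      \sum_j (X j i)^c* *c b *c X j i' + \sum_j (X j i)^c* *c (cut d b - b) *c X j i'.
    rewrite -big_split; apply: eq_bigr => j _ /=.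
    by rewrite -cmulDl -cmulDr addrC subrK.
  rewrite addrAC (le_trans (nrmD _ _))// (splitr (e / M)) lerD//.
  rewrite (le_trans (nrm_sum _ _ _))// (@le_trans _ _ (C * d))//; last first.
    rewrite /d mulrCA ler_piMr ?divr_ge0 ?(ltW e_gt0) ?(ltW M0)//.
    by rewrite ler_pdivrMr ?mul1r ?lerDl// ltr_wpDl.
  rewrite (le_trans _ (ler_wpM2r (ltW d0) (Cii i i')))// mulr_suml; apply: ler_sum => j _.
  rewrite (le_trans (nrmM _ _))// mulrAC ler_wpM2r ?nrm_ge0//.
  rewrite (le_trans (nrmM _ _))// nrm_star ler_wpM2l ?nrm_ge0//.
  exact/cut_close/b0/ltW.
set a1 := cut e a in ab1 *; set b1 := cut d b in ab1.
have b10 : cpos b1 by exact/cut_cpos/b0/ltW.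
have b1sa := cpos_sa b10.
have [b1z|b1n] := eqVneq b1 0.
  left=> e' e'0; have [X hX] := ab1 _ e'0; exists 0.
  have := hX ord0 ord0; rewrite eqxx b1z big1 => [|j _]; last by rewrite cmulr0 cmul0r.
  by rewrite cmulr0.
right.
(* On t >= 0 this is t / d up to d and 1 beyond, so H is a unit for b1 = (b - d)_+ and still below
   [b]. *)
pose hf (t : R) := Num.max t 0 / Num.max t d.
have md t : 0 < Num.max t d by rewrite lt_max d0 orbT.
have hz : czero hf.
  split; last by rewrite /hf maxxx mul0r.
  apply: contM; first exact/cont_max/cont_cst/cont_id.
  by apply: cont_inv => [t|]; [rewrite gt_eqF|exact/cont_max/cont_cst/cont_id].
have hf1 t : hf t <= 1.
  by rewrite ler_pdivrMr// mul1r ge_max le_max lexx (ltW (md t)).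
have hf0 t : 0 <= hf t by rewrite divr_ge0 ?(ltW (md t))// le_max lexx orbT.
pose H := fc b hf; have H0 : cpos H by apply: cpos_fc.
have Hsa := cpos_sa H0.
have Hcut (f : R -> R) : czero f -> (forall t, t <= d -> f t = 0) -> H *c fc b f = fc b f.
  move=> fz f0; rewrite -fcM//; apply: fc_eq => t _.
  have [td|td] := leP t d; first by rewrite f0// mulr0.
  rewrite /hf [Num.max t d]max_l ?ltW// [Num.max t 0]max_l ?(ltW (lt_trans d0 td))//.
  by rewrite divff ?mul1r// gt_eqF// (lt_trans d0).
have Hb1 : H *c b1 = b1.
  apply: Hcut; first exact/czero_cut/ltW.
  by move=> t td; rewrite max_r// subr_le0.
have Hher x : her b1 x -> H *c x = x by move=> [u _ ->]; rewrite !cmulA Hb1.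
(* There are 2 k pieces w_i, and one more to contain y, which is to lie below all of them. *)
have [x [hx nx xx]] := orth_family (k * 2).+1 (fun x hx => sp x (her_cpos b10 hx)) b10 b1n (sp _ b10 b1n).
have x0 i := her_cpos b10 (hx i).
pose K := 'I_(k * 2); pose w (i : K) := x (lift ord0 i).
have [y [hy ny yw]] := @common_lower K w (x ord0) (x0 _) (nx _) (fun i => x0 _) (fun i => nx _).
have y0 : cpos y by exact: her_cpos hy.
have ysa := cpos_sa y0.
have Hy : H *c y = y by apply: Hher; exact: her_trans hy.
have yw0 i : y *c w i = 0.
  have [u _ ->] := hy; rewrite -cmulA xx ?cmulr0//.
have wy0 i : w i *c y = 0.
  by rewrite -[LHS]cstarK cstarM ysa (cpos_sa (x0 _)) yw0 cstar0.
pose r := nrm y; have r0 : 0 < r by rewrite lt_neqAle nrm_ge0 eq_sym nrm_eq0 ny.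
(* f1 rises linearly to 1 on [0, r / 2]; g1 lives above r / 2 and is scaled to reach 1 at r = |y|.
   Hence f1 g1 = g1 <= f1 on [0, r], while g1(y) is not 0. *)
pose f1 (t : R) := Num.max t 0 / Num.max t (r / 2).
have r20 : 0 < r / 2 by rewrite divr_gt0.
have mr t : 0 < Num.max t (r / 2) by rewrite lt_max r20 orbT.
have f1z : czero f1.
  split; last by rewrite /f1 maxxx mul0r.
  apply: contM; first exact/cont_max/cont_cst/cont_id.
  by apply: cont_inv => [t|]; [rewrite gt_eqF|exact/cont_max/cont_cst/cont_id].
have f11 t : f1 t <= 1.
  by rewrite ler_pdivrMr// mul1r ge_max le_max lexx (ltW (mr t)).
have f10 t : 0 <= f1 t by rewrite divr_ge0 ?(ltW (mr t))// le_max lexx orbT.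
pose c0 := fc y f1; have c00 : cpos c0 by exact: cpos_fc.
have c0sa := cpos_sa c00.
pose g1 (t : R) := (2 / r) * Num.max (t - r / 2) 0.
have g1z : czero g1 by apply: czeroMr; [exact: cont_cst|exact/czero_cut/ltW].
have g10 t : 0 <= g1 t by rewrite mulr_ge0 ?divr_ge0 ?(ltW r0)// le_max lexx orbT.
pose e0 := fc y g1; have e00 : cpos e0 by exact: cpos_fc.
have e0n : e0 != 0.
  apply/eqP => e0z; have : cut (r / 2) y = 0.
    have -> : cut (r / 2) y = (r / 2)%:C *: e0.
      rewrite -fcZ//; apply: fc_eq => t _; rewrite /g1 mulrA.
      by rewrite (_ : r / 2 * (2 / r) = 1) ?mul1r//; field; rewrite gt_eqF.
    by rewrite e0z scaler0.
  move=> cz; have := cut_close (ltW r20) y0; rewrite cz sub0r nrmN -/r leNgt.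
  by rewrite ltr_pdivrMr// ltr_pMr// ltr1n.
have Hc0 : H *c c0 = c0 by exact: fc_unit.
have c0H : c0 *c H = c0 by rewrite -[LHS]cstarK cstarM Hsa c0sa Hc0 c0sa.
have He0 : H *c e0 = e0 by exact: fc_unit.
(* As H and c0 both act as units on e0, c is orthogonal to e0; and c + e0 = H - (f1 - g1)(y) is at
   most H. *)
pose c := H - c0.
have c_pos : cpos c.
  have -> : c = (H - H *c H) + (H *c H - c0) by rewrite addrA subrK.
  apply: cposD.
    rewrite /H -fcM// -fcB//; last exact: czeroM.
    apply: cpos_fc => //; first by apply: czeroB => //; exact: czeroM.
    by move=> t _; rewrite subr_ge0 ler_piMr.
  apply/cposP; rewrite inUB inUM.
  have -> : inU H * inU H - inU c0 = (inU H)^c* * (rsc D 1 - inU c0) * inU H.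
    by rewrite -inU_star Hsa mulrBr mulrBl rsc1 mulr1 -!inUM Hc0 c0H.
  apply: upos_conj; have [] := @upos_of_nrm _ _ (inU c0) 1 => //.
    by rewrite -inU_star c0sa.
  rewrite nrm_inU; apply: cpos_fc_nrm => // t _.
  by rewrite ger0_norm.
have ce0 : c *c e0 = 0.
  rewrite cmulBl He0 /c0 /e0 -fcM// -fcB//; last exact: czeroM.
  rewrite -[RHS](fc0 ysa); apply: fc_eq => t _; rewrite /g1.
  case: (leP (t - r / 2) 0) => tr; first by rewrite !mulr0 subr0.
  have tr' : r / 2 < t by rewrite -subr_gt0.
  rewrite /f1 [Num.max t (r / 2)]max_l ?ltW// [Num.max t 0]max_l ?(ltW (lt_trans r20 tr'))//.
  by rewrite divff ?mul1r ?subrr// gt_eqF// (lt_trans r20).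
have ceb : cle (c + e0) b.
  apply: (@cle_trans _ _ H); last first.
    apply: (@cle_fc_le _ _ _ _ d^-1) => //; first by rewrite invr_gt0.
    move=> t /andP[t0 _]; rewrite hf0 /= /hf [Num.max t 0]max_l// mulrC ler_wpM2r//.
    by rewrite lef_pV2 ?posrE// le_max lexx orbT.
  apply: cle_le; first exact: cposD.
  have -> : H - (c + e0) = fc y (fun t => f1 t - g1 t).
    by rewrite fcB// /c opprD addrA subKr.
  apply: cpos_fc => //; first exact: czeroB.
  move=> t /andP[t0 tr]; rewrite subr_ge0 /g1.
  case: (leP (t - r / 2) 0) => tr2; first by rewrite mulr0.
  have tr' : r / 2 < t by rewrite -subr_gt0.
  rewrite /f1 [Num.max t (r / 2)]max_l ?(ltW tr')// [Num.max t 0]max_l//.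
  rewrite divff; last by rewrite gt_eqF// (lt_trans r20).
  by rewrite mulrAC ler_pdivrMr// mul1r; rewrite -/r in tr; lra.
exists c, e0, (k * 2).+1; split => //.
  by apply: fle_trans (fle_orth_sum c_pos e00 ce0) _; apply/cle_fle.
(* b1 <~ H = c + c0 splits into c and c0, and the 2 k copies of c0 fit under a single c: c0 <~ y <~
   w_i, the w_i are orthogonal, and c acts on them as a unit. *)
have step : fle (fun _ : K => b1) (fsum (fun _ : K => c) (fun _ : unit => c)).
  apply: (fle_trans (q := fun _ : K => c + c0)).
    apply: fle_pointwise => _; rewrite subrK.
    pose s := fc b (fun t => Num.sqrt (Num.max (t - d) 0)).
    have sz : czero (fun t : R => Num.sqrt (Num.max (t - d) 0)) by exact/czero_sqrt/czero_cut/ltW.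
    have -> : b1 = s^c* *c H *c s.
      rewrite fc_sa// -cmulA Hcut//; last by move=> t td; rewrite max_r ?sqrtr0// subr_le0.
      rewrite -fcM//; apply: fc_eq => t _; rewrite -expr2 sqr_sqrtr//.
      by rewrite le_max lexx orbT.
    exact: cle_conj.
  apply: fle_trans (fle_split K c_pos c00) _.
  apply: fle_sum; first by apply: fle_pointwise => _; exact: cle_refl.
  apply: (fle_trans (q := fun i : K => w i *c w i)).
    apply: fle_pointwise => i; apply: (@cle_trans _ _ y).
      apply: (@cle_fc_le _ _ _ _ (2 / r)) => //; first by rewrite divr_gt0.
      move=> t /andP[t0 _]; rewrite f10 /= /f1 [Num.max t 0]max_l// mulrC ler_wpM2r//.
      have -> : 2 / r = (r / 2)^-1 by rewrite invf_div.
      by rewrite lef_pV2 ?posrE// le_max lexx orbT.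
    exact: cle_trans (yw i) (cle_sqr (x0 _)).
  apply: fle_orth_unit.
  - by move=> i; exact/cpos_sa/x0.
  - move=> i; have c0w : c0 *c w i = 0.
      rewrite -[LHS]cstarK cstarM c0sa (cpos_sa (x0 _)).
      by rewrite [w i *c c0](_ : _ = 0) ?cstar0//; exact: fc_orth.
    by rewrite /c cmulBl c0w subr0; exact/Hher/hx.
  - by move=> i j ij; apply: xx; apply: contraNneq ij => /lift_inj ->.
(* Two copies of the relation: 2 k + 2 copies of a1 are below 2 k copies of b1, hence below 2 k + 1
   copies of c. *)
have h : fle (fun _ : 'I_(k * 2).+2 => a1) (fun _ : K => b1).
  by apply: fle_card (fle_prod bool ab1); rewrite ?card_prod ?card_ord card_bool// mulSn.
have := fle_trans h step.
have -> : fsum (fun _ : K => c) (fun _ : unit => c) = (fun _ => c).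
  by apply/funext => -[].
by apply: fle_card; rewrite ?card_ord// card_sum card_unit card_ord addn1.
Qed.

End reserve.

(** * Simple algebras *)

Section simple_algebras.
Context (R : realType) (A : cstarAlgType R).
Hypothesis (Asimple : simple_cstar A).
Implicit Types (x y z u v q s : A).

Lemma closed_nrm (S : set A) :
  (forall z, (forall e : R, 0 < e -> exists2 z', S z' & nrm (z - z') <= e) -> S z) -> closed S.
Proof.
move=> Sc z zS; apply: Sc => e e0.
have eC : 0 < (e%:C : R[i]) by rewrite ltcR.
have [z' [Sz']] := zS _ (nbhsx_ballx z _ eC).
by rewrite -ball_normE /= nrmE ltcR => /ltW; exists z'.
Qed.

(** Otherwise the closed ideal of all z with x A z = 0 contains y, so it is all of A; z = x^* with
    middle factor x^* x then forces x = 0. *)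
Lemma simple_prime x y : x != 0 -> y != 0 -> exists u, x *c u *c y != 0.
Proof.
move=> x0 y0; apply: contrapT => noU.
have xuy u : x *c u *c y = 0 by apply/eqP; apply: contrapT => h; apply: noU; exists u; apply/negP.
pose I : set A := [set z | forall u, x *c u *c z = 0].
have : closed_ideal I.
  split.
  - by move=> u; rewrite cmulr0.
  - by move=> z z' hz hz' u; rewrite cmulDr hz hz' addr0.
  - by move=> k z hz u; rewrite cmulZr hz scaler0.
  - move=> a z hz; split=> u; first by rewrite cmulA -(cmulA x) hz.
    by rewrite cmulA hz cmul0r.
  - apply: closed_nrm => z hz u; apply: (@nrm_small0 _ _ _ (nrm (x *c u))) => e e0.
    have [z' hz' zz'] := hz e e0.
    rewrite -[_ *c z]subr0 -(hz' u) -cmulBr (le_trans (nrmM _ _))//.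
    by rewrite ler_wpM2l ?nrm_ge0.
move=> /Asimple [I0|IT].
  have : I y by exact: xuy.
  by rewrite I0 /= => /eqP; rewrite (negbTE y0).
have : I x^c* by rewrite IT.
move=> /(_ (x^c* *c x)); rewrite !cmulA -(cmulA (x *c x^c*)) => xx0.
have : x *c x^c* = 0.
  by apply: star_mul_eq0; rewrite cstarM cstarK.
by rewrite -{1}[x]cstarK => /star_mul_eq0 /eqP; rewrite -nrm_eq0 nrm_star nrm_eq0 (negbTE x0).
Qed.

(** The elements that can be approximated in this way form a closed ideal. Without a unit, [q] is
    not visibly a sum of terms u q v, but q^* q q^* is one, and it is not zero. *)
Lemma simple_span q z (e : R) : q != 0 -> 0 < e ->
  exists s : seq (A * A), nrm (z - \sum_(uv <- s) uv.1 *c q *c uv.2) <= e.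
Proof.
move=> q0 e0.
pose I : set A := [set z | forall e, 0 < e ->
  exists s : seq (A * A), nrm (z - \sum_(uv <- s) uv.1 *c q *c uv.2) <= e].
have cI : closed_ideal I.
  split.
  - by move=> d d0; exists [::]; rewrite big_nil subr0 nrm0 ltW.
  - move=> x y hx hy d d0; have d2 : 0 < d / 2 by rewrite divr_gt0.
    have [s hs] := hx _ d2; have [t ht] := hy _ d2.
    exists (s ++ t); rewrite big_cat /= opprD addrACA (le_trans (nrmD _ _))//.
    by rewrite (splitr d) lerD.
  - move=> k x hx d d0.
    have k1 : 0 < nrm k + 1 by rewrite ltr_wpDl// nrm_ge0.
    have [s hs] := hx _ (divr_gt0 d0 k1).
    exists [seq (k *: uv.1, uv.2) | uv <- s]; rewrite big_map.
    under eq_bigr do rewrite /= !cmulZl.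
    rewrite -scaler_sumr -scalerBr nrmZ (@le_trans _ _ ((nrm k + 1) * (d / (nrm k + 1))))//.
      by rewrite ler_pM ?nrm_ge0// lerDl.
    by rewrite mulrCA mulfV ?mulr1// gt_eqF.
  - move=> a x hx; have a1 : 0 < nrm a + 1 by rewrite ltr_wpDl// nrm_ge0.
    split=> d d0; have [s hs] := hx _ (divr_gt0 d0 a1).
      exists [seq (a *c uv.1, uv.2) | uv <- s]; rewrite big_map.
      under eq_bigr do rewrite /= -!(cmulA a).
      rewrite -cmul_sumr -cmulBr (le_trans (nrmM _ _))//.
      rewrite (@le_trans _ _ ((nrm a + 1) * (d / (nrm a + 1))))//.
        by rewrite ler_pM ?nrm_ge0// lerDl.
      by rewrite mulrCA mulfV ?mulr1// gt_eqF.
    exists [seq (uv.1, uv.2 *c a) | uv <- s]; rewrite big_map.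
    under eq_bigr do rewrite /= cmulA.
    rewrite -cmul_suml -cmulBl (le_trans (nrmM _ _))//.
    rewrite (@le_trans _ _ (d / (nrm a + 1) * (nrm a + 1)))//.
      by rewrite ler_pM ?nrm_ge0// lerDl.
    by rewrite divfK// gt_eqF.
  - apply: closed_nrm => x hx d d0; have d2 : 0 < d / 2 by rewrite divr_gt0.
    have [x' hx' xx'] := hx _ d2; have [s hs] := hx' _ d2.
    by exists s; rewrite (le_trans (nrm_triangle x' _ _))// (splitr d) lerD.
have [I0|IT] := Asimple cI; last first.
  have Iz : I z by rewrite IT.
  exact: Iz.
exfalso; have : I (q^c* *c q *c q^c*).
  by move=> d d0; exists [:: (q^c*, q^c*)]; rewrite big_seq1 subrr nrm0 ltW.
rewrite I0 /= => qqq; move/eqP: q0; apply.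
apply: star_mul_eq0; apply: star_mul_eq0.
by rewrite cstarM cstarK cmulA qqq cmul0r.
Qed.

End simple_algebras.

(** * Matrices over a simple algebra *)

Section matrices_over_simple.
Context (R : realType) (A : cstarAlgType R) (n : nat).
Hypothesis (Asimple : simple_cstar A).
Local Notation D := (cmx A n).
Local Notation n2 := ((n * n)%:R : R).
Implicit Types (X Y p : D) (x s : A).

Definition elem_mx (i j : 'I_n) x : D := \matrix_(k, l) if (k == i) && (l == j) then x else 0.

Lemma elem_mxE i j x k l : elem_mx i j x k l = if (k == i) && (l == j) then x else 0.
Proof. by rewrite mxE. Qed.

Lemma elem_mx_sandwich i k l j (x y : A) X :
  elem_mx i k x *c X *c elem_mx l j y = elem_mx i j (x *c X k l *c y).
Proof.
apply/matrixP => r t; rewrite elem_mxE cmulmxE (bigD1 l)//= big1 ?addr0 => [|m /negbTE ml].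
  rewrite elem_mxE eqxx /= cmulmxE (bigD1 k)//= big1 ?addr0 => [|m /negbTE mk].
    rewrite elem_mxE eqxx andbT.
    by case: (r == i); case: (t == j); rewrite /= ?cmul0r ?cmulr0.
  by rewrite elem_mxE mk andbF cmul0r.
by rewrite elem_mxE ml cmulr0.
Qed.

Lemma elem_mx_star i j x : (elem_mx i j x)^c* = elem_mx j i x^c*.
Proof.
apply/matrixP => k l; rewrite cstarmxE !elem_mxE andbC.
by case: ifP => //; rewrite cstar0.
Qed.

Lemma mx_sum_elem X : X = \sum_i \sum_j elem_mx i j (X i j).
Proof.
apply/matrixP => k l; rewrite summxE (bigD1 k)//= [X in _ + X]big1 ?addr0 => [|i /negbTE ik].
  rewrite summxE (bigD1 l)//= [X in _ + X]big1 ?addr0 => [|j /negbTE jl]; rewrite elem_mxE ?eqxx//.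
  by rewrite eq_sym in jl; rewrite jl andbF.
by rewrite summxE big1// => j _; rewrite elem_mxE eq_sym ik.
Qed.

Lemma elem_mxB i j (x y : A) : elem_mx i j (x - y) = elem_mx i j x - elem_mx i j y.
Proof. by apply/matrixP => k l; rewrite !mxE; case: ifP => _; rewrite ?subr0. Qed.

Lemma elem_mx_sum i j (I : Type) (r : seq I) (F : I -> A) :
  elem_mx i j (\sum_(k <- r) F k) = \sum_(k <- r) elem_mx i j (F k).
Proof.
apply: (big_morph (elem_mx i j)) => [x y|]; apply/matrixP => k l; rewrite !mxE;
  by case: ifP => _; rewrite ?addr0.
Qed.

Lemma elem_mx_nrm i j x : nrm (elem_mx i j x) <= n2 * nrm x.
Proof.
apply: nrm_le_entry => [|k l]; first exact: nrm_ge0.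
by rewrite elem_mxE; case: ifP => // _; rewrite nrm0 nrm_ge0.
Qed.

Lemma mx_neq0 X : X != 0 -> exists i j, X i j != 0.
Proof.
move=> X0; apply: contrapT => noij; move/eqP: X0; apply; apply/matrixP => i j.
by rewrite mxE; apply/eqP; apply: contrapT => h; apply: noij; exists i, j; apply/negP.
Qed.

Lemma cmx_prime X Y : X != 0 -> Y != 0 -> exists T : D, X *c T *c Y != 0.
Proof.
move=> /mx_neq0[i [j Xij]] /mx_neq0[k [l Ykl]].
have [u xuy] := simple_prime Asimple Xij Ykl; exists (elem_mx j k u).
apply/eqP => XTY0; move/eqP: xuy; apply.
have <- : (X *c elem_mx j k u *c Y) i l = X i j *c u *c Y k l; last by rewrite XTY0 mxE.
rewrite cmulmxE (bigD1 k)//= big1 ?addr0 => [|m /negbTE mk].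
  rewrite cmulmxE (bigD1 j)//= big1 ?addr0 => [|m /negbTE mj].
    by rewrite elem_mxE !eqxx.
  by rewrite elem_mxE mj cmulr0.
rewrite cmulmxE big1 ?cmul0r// => t _.
by rewrite elem_mxE mk andbF cmulr0.
Qed.

(** One nonzero entry of p suffices: [simple_span] approximates each entry of X by it, and matrix
    units move the result into place. *)
Lemma cmx_span p X (e : R) : p != 0 -> 0 < e ->
  exists s : seq (D * D), nrm (X - \sum_(uv <- s) uv.1 *c p *c uv.2) <= e.
Proof.
move=> /mx_neq0[k [l pkl]] e0.
have d0 : 0 < e / (n2 * n2 + 1) by rewrite divr_gt0// ltr_wpDl.
have /choice[s hs] (ij : 'I_n * 'I_n) := simple_span Asimple (X ij.1 ij.2) pkl d0.
pose S ij := [seq (elem_mx ij.1 k uv.1, elem_mx l ij.2 uv.2) | uv <- s ij].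
exists (flatten [seq S ij | ij <- enum {: 'I_n * 'I_n}]).
rewrite big_flatten big_map big_enum /=.
have -> : X - \sum_(ij : 'I_n * 'I_n) \sum_(uv <- S ij) uv.1 *c p *c uv.2 =
    \sum_(ij : 'I_n * 'I_n) elem_mx ij.1 ij.2 (X ij.1 ij.2 - \sum_(uv <- s ij) uv.1 *c p k l *c uv.2).
  rewrite {1}[X]mx_sum_elem pair_bigA /= -sumrB; apply: eq_bigr => ij _.
  rewrite elem_mxB elem_mx_sum big_map; congr (_ - _); apply: eq_bigr => uv _ /=.
  by rewrite elem_mx_sandwich.
rewrite (le_trans (nrm_sum _ _ _))// (@le_trans _ _ (\sum_(ij : 'I_n * 'I_n) n2 * (e / (n2 * n2 + 1))))//.
  apply: ler_sum => ij _; rewrite (le_trans (elem_mx_nrm _ _ _))// ler_wpM2l//; exact: hs.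
rewrite sumr_const card_prod !card_ord -[leLHS]mulr_natl.
rewrite [leLHS](_ : _ = n2 * n2 / (n2 * n2 + 1) * e); last by ring.
by rewrite ler_piMl ?(ltW e0)// ler_pdivrMr ?ltr_wpDl// mul1r lerDl.
Qed.

(** A diagonal entry of Y^* Y is a sum of positive elements; if it vanishes, so does the
    corresponding column of Y. *)
Lemma cpos_diag_neq0 X : cpos X -> X != 0 -> exists i, X i i != 0.
Proof.
move=> [Y XE] X0; apply: contrapT => noi.
have Xii i : X i i = 0 by apply/eqP; apply: contrapT => h; apply: noi; exists i; apply/negP.
have Y0 : Y = 0.
  apply/matrixP => k i; rewrite mxE; apply: star_mul_eq0.
  have := Xii i; rewrite XE cmulmxE => S0.
  apply: cpos_anti; first by exists (Y k i).
  have {}S0 : \sum_j (Y j i)^c* *c Y j i = 0.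
    by apply: etrans S0; apply: eq_bigr => j _; rewrite cstarmxE.
  have -> : - ((Y k i)^c* *c Y k i) = \sum_(j | j != k) (Y j i)^c* *c Y j i.
    by move: S0; rewrite (bigD1 k)//= => /eqP; rewrite addr_eq0 => /eqP ->; rewrite opprK.
  by apply: cpos_sum => j _; exists (Y j i).
by move: X0; rewrite XE Y0 cmulr0 eqxx.
Qed.

Lemma cpos_diag X i : cpos X -> cpos (X i i).
Proof.
move=> [Y ->]; rewrite cmulmxE; apply: cpos_sum => k _; exists (Y k i).
by rewrite cstarmxE.
Qed.

Lemma cle_elem_mx X i j s : cle s (X i i) -> cle (elem_mx j j s) X.
Proof.
move=> sX e e0; have d0 : 0 < e / (n2 + 1) by rewrite divr_gt0// ltr_wpDl.
have [x hx] := sX _ d0; exists (elem_mx i j x).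
rewrite elem_mx_star elem_mx_sandwich -elem_mxB (le_trans (elem_mx_nrm _ _ _))//.
rewrite (@le_trans _ _ ((n2 + 1) * (e / (n2 + 1))))//.
  by rewrite ler_pM ?nrm_ge0// lerDl.
by rewrite mulrCA mulfV ?mulr1// gt_eqF// ltr_wpDl.
Qed.

Lemma fle_dg_elem s : cpos s ->
  fle (fun _ : unit => dg n s) (fun j : 'I_n => elem_mx j j s).
Proof.
move=> s0 e e0; have [f [fz hf]] := approx_unit s0 e0; set u := fc s f in hf.
have usa : u^c* = u by apply: fc_sa => //; exact: cpos_sa.
exists (fun j _ => elem_mx j j u) => -[] []; rewrite eqxx.
have -> : \sum_j (elem_mx j j u)^c* *c elem_mx j j s *c elem_mx j j u = dg n (u *c s *c u).
  transitivity (\sum_j elem_mx j j (u *c s *c u)).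
    apply: eq_bigr => j _; rewrite elem_mx_star usa elem_mx_sandwich.
    by rewrite elem_mxE !eqxx.
  apply/matrixP => k l; rewrite summxE dgE (bigD1 k)//= big1 ?addr0 => [|j /negbTE jk].
    by rewrite elem_mxE eqxx /= eq_sym.
  by rewrite elem_mxE eq_sym jk.
have -> : dg n (u *c s *c u) - dg n s = dg n (u *c s *c u - s).
  by apply/matrixP => i j; rewrite !mxE; case: eqP => _; rewrite ?subr0.
by rewrite (le_trans (dg_nrm _ _)).
Qed.

(** Each of n orthogonal pieces r_j of T has a nonzero diagonal entry, and s is a common lower bound
    of these entries. The j-th diagonal block of diag(s, ..., s) goes below r_j, and orthogonality
    lets the pieces add up inside T. *)
Lemma small_diagonal (T : D) : cpos T -> T != 0 ->
  (forall X, cpos X -> X != 0 -> splittable X) ->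
  exists s, [/\ cpos s, s != 0 & cle (dg n s) T].
Proof.
move=> T0 Tn sp.
have [r [hr nr rr]] := orth_family n (fun X hX => sp X (her_cpos T0 hX)) T0 Tn (sp _ T0 Tn).
have r0 i := her_cpos T0 (hr i).
have /choice[i hi] j := cpos_diag_neq0 (r0 j) (nr j).
have [i0 Ti0] := cpos_diag_neq0 T0 Tn.
have d0 j : cpos (r j (i j) (i j)) by exact: cpos_diag.
have [s [hs ns sd]] := common_lower (simple_prime Asimple) (cpos_diag i0 T0) Ti0 d0 hi.
have s0 := her_cpos (cpos_diag i0 T0) hs.
exists s; split => //; apply/cle_fle; apply: fle_trans (fle_dg_elem s0) _.
apply: (fle_trans (q := fun _ : unit => \sum_j r j)).
  apply: fle_into_orth_sum => // j; exact: cle_elem_mx (sd j).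
apply/cle_fle.
have /choice[u hu] j : exists u, cpos u /\ r j = T *c u *c T by have [u] := hr j; exists u.
have -> : \sum_j r j = T *c (\sum_j u j) *c T.
  by rewrite cmul_sumr cmul_suml; apply: eq_bigr => j _; have [] := hu j.
by apply: cle_her => //; apply: cpos_sum => j _; have [] := hu j.
Qed.

Definition entries (L : seq D) : set A :=
  [set` [seq (Y : D) kl.1 kl.2 | Y <- L, kl <- enum {: 'I_n * 'I_n}]].

Lemma entries_finite L : finite_set (entries L). Proof. exact: finite_seq. Qed.

Lemma entriesP L Y i j : Y \in L -> entries L (Y i j).
Proof.
by move=> YL; apply/allpairsP; exists (Y, (i, j)); rewrite mem_enum.
Qed.

Lemma dg_commutator L Y x (d : R) : Y \in L -> 0 <= d ->
  (forall z, entries L z -> nrm (x *c z - z *c x) <= d) ->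
  nrm (dg n x *c Y - Y *c dg n x) <= n2 * d.
Proof.
move=> YL d0 h; apply: nrm_le_entry => // i j.
have -> : (dg n x *c Y - Y *c dg n x) i j = (dg n x *c Y) i j - (Y *c dg n x) i j.
  by rewrite [LHS]mxE [in X in _ + X = _]mxE.
by rewrite dg_mull dg_mulr; apply: h; exact: entriesP.
Qed.

(* If [e] almost commutes with [p] then [p e p = k p], and [k] is small as [1 - e]
   almost preserves the norm of the entries of [p]. *)
Lemma minproj_annihilates (p X : D) (e : R) : minproj p -> 0 < e ->
  exists L (d : R), 0 < d /\ forall x : A, cpos x -> nrm x <= 1 ->
    (forall z, entries L z -> nrm (x *c z - z *c x) <= d) ->
    (forall z, entries L z -> nrm z - d <= nrm (z - x *c z)) ->
    nrm (dg n x *c X) <= e.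
Proof.
move=> [psa pp pn pk] e0; have e20 : 0 < e / 2 by rewrite divr_gt0.
(* X is nearly a sum of terms u p v, and E u p v = [E, u p] p v + k u p v with p E p = k p; the
   commutators and k are both of order d. *)
have [s hs] := cmx_span X pn e20.
have [i [j pij]] := mx_neq0 pn; set q := p i j in pij.
have q0 : 0 < nrm q by rewrite lt_neqAle nrm_ge0 eq_sym nrm_eq0 pij.
(* The coefficient of d: n^2 |v| for the commutator, and (n^2 + 1) / |q| times |u p v| for the term
   with k. *)
pose C := \sum_(uv <- s) (n2 * nrm uv.2 + (n2 + 1) / nrm q * nrm (uv.1 *c p *c uv.2)).
have C0 : 0 <= C.
  have q1 : 0 <= (n2 + 1) / nrm q by apply: divr_ge0; [exact: addr_ge0|exact: nrm_ge0].
  by apply: sumr_ge0 => uv _; apply: addr_ge0; rewrite mulr_ge0 ?nrm_ge0.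
pose d := e / 2 / (C + 1); have d0 : 0 < d by rewrite divr_gt0// ltr_wpDl.
pose L := p :: [seq uv.1 *c p | uv <- s]; exists L, d; split => // x x0 x1 xL xp.
set E := dg n x; have E0 : cpos E by exact: dg_cpos.
have E1 : nrm E <= 1 by rewrite (le_trans (dg_nrm _ _)).
have np : nrm p = 1.
  have : nrm p ^+ 2 = nrm p by rewrite -nrm_star_sq psa pp.
  move=> /eqP; rewrite expr2 -subr_eq0 -{3}[nrm p]mulr1 -mulrBr mulf_eq0 nrm_eq0 (negbTE pn).
  by rewrite subr_eq0 => /eqP.
have [k kE] := pk E.
have p0 : cpos p by exists p; rewrite psa pp.
(* p E p = k p is positive, which forces k to be real and nonnegative. *)
have k0 : 0 <= k.
  have pEp : cpos (k *: p) by rewrite -kE -{1}psa; exact: cpos_conj.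
  have kr : k^* = k.
    have := cpos_sa pEp; rewrite cstarZ psa => /eqP; rewrite -subr_eq0 -scalerBl scaler_eq0.
    by rewrite (negbTE pn) orbF subr_eq0 => /eqP.
  have kR : k \is Num.real by apply/CrealP.
  have kE' : k = (complex.Re k)%:C by rewrite RRe_real.
  rewrite kE' ler0c leNgt; apply/negP => k0.
  have : k *: p = 0.
    apply: cpos_anti => //; rewrite -scaleNr kE' -rmorphN; apply: cposZ => //.
    by rewrite oppr_ge0 ltW.
  move=> /eqP; rewrite scaler_eq0 (negbTE pn) orbF => /eqP kz.
  by move: k0; rewrite kz ltxx.
have kn : k = (nrm k)%:C by rewrite -nrmE ger0_norm.
have k1 : nrm k <= 1.
  rewrite -[nrm k]mulr1 -np -nrmZ -kE (le_trans (nrmM _ _))// np mulr1.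
  by rewrite (le_trans (nrmM _ _))// np mul1r.
(* At the entry q of p one has |q| - d <= |q - x q| <= n^2 d + (1 - k) |q|. *)
have kd : nrm k <= (n2 + 1) / nrm q * d.
  have h1 : nrm (p - E *c p - (1 - k) *: p) <= n2 * d.
    have -> : p - E *c p - (1 - k) *: p = - ((E *c p - p *c E) *c p).
      rewrite scalerBl scale1r -kE cmulBl -(cmulA E) pp opprB opprD opprK.
      by rewrite addrC subrKA addrC.
    rewrite nrmN (le_trans (nrmM _ _))// np mulr1.
    by apply: (@dg_commutator L) => //; [rewrite inE eqxx|exact: ltW].
  have h2 : nrm (q - x *c q - (1 - k) *: q) <= n2 * d.
    apply: le_trans h1; apply: le_trans (nrm_entry _ i j).
    suff -> : q - x *c q - (1 - k) *: q = (p - E *c p - (1 - k) *: p) i j by [].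
    have sE (Y Z : D) : (Y - Z) i j = Y i j - Z i j.
      by rewrite [LHS]mxE [in X in _ + X = _]mxE.
    by rewrite !sE cmx_scaleE dg_mull.
  have h3 : nrm q - d <= nrm (q - x *c q) by apply: xp; apply: entriesP; rewrite inE eqxx.
  have h4 : nrm (q - x *c q) <= n2 * d + (1 - nrm k) * nrm q.
    rewrite -[q - _](subrK ((1 - k) *: q)) (le_trans (nrmD _ _))// lerD//.
    rewrite nrmZ {1}kn -[1 - _]/(1%:C - (nrm k)%:C) -rmorphB /= nrm_real ger0_norm// subr_ge0//.
  rewrite mulrAC ler_pdivlMr//.
  lra.
rewrite -[X](subrK (\sum_(uv <- s) uv.1 *c p *c uv.2)) cmulDr (le_trans (nrmD _ _))//.
rewrite (splitr e) lerD//.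
  by rewrite (le_trans (nrmM _ _))// -[leRHS]mul1r ler_pM ?nrm_ge0.
rewrite (@le_trans _ _ (C * d))//; last first.
  rewrite /d mulrCA ler_piMr ?(ltW e20)// ler_pdivrMr ?mul1r ?lerDl//.
  by rewrite ltr_wpDl.
rewrite cmul_sumr (le_trans (nrm_sum _ _ _))// /C mulr_suml big_seq [leRHS]big_seq.
apply: ler_sum => uv uvs.
have -> : E *c (uv.1 *c p *c uv.2) = (E *c (uv.1 *c p) - uv.1 *c p *c E) *c (p *c uv.2) +
    k *: (uv.1 *c p *c uv.2).
  rewrite cmulBl.
  have -> : E *c (uv.1 *c p) *c (p *c uv.2) = E *c (uv.1 *c p *c uv.2).
    by rewrite -!cmulA (cmulA p p) pp.
  have -> : uv.1 *c p *c E *c (p *c uv.2) = k *: (uv.1 *c p *c uv.2).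
    by rewrite -!cmulA (cmulA E) (cmulA p) (cmulA p E) kE cmulZl cmulZr.
  by rewrite subrK.
rewrite (le_trans (nrmD _ _))// mulrDl lerD//.
  rewrite (le_trans (nrmM _ _))// mulrAC ler_pM ?nrm_ge0//.
    by apply: (@dg_commutator L) => //; [rewrite inE (map_f (fun w => w.1 *c p) uvs) orbT|exact: ltW].
  by rewrite (le_trans (nrmM _ _))// np mul1r.
by rewrite nrmZ mulrAC ler_wpM2r ?nrm_ge0.
Qed.

End matrices_over_simple.

(** * Transferring the comparison to a subalgebra *)

Section almost_commuting.
Context (R : realType) (D : cstarAlgType R) (T : Type) (S : R -> T -> Prop).
Local Notation U := (unitz D).
Hypothesis (S_mono : forall d d' t, d <= d' -> S d t -> S d' t).
Implicit Types (u v : T -> U) (p q : U).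

(** A single d has to be fixed before the configuration t is known. This quantifier hides it and is
    stable under finite conjunctions, so that limit arguments replace explicit estimates. *)
Definition eventually_small (P : T -> Prop) := exists2 d, 0 < d & forall t, S d t -> P t.

Lemma es_impl (P Q : T -> Prop) : (forall t, P t -> Q t) ->
  eventually_small P -> eventually_small Q.
Proof. by move=> PQ [d d0 h]; exists d => // t /h/PQ. Qed.

Lemma es_and (P Q : T -> Prop) : eventually_small P -> eventually_small Q ->
  eventually_small (fun t => P t /\ Q t).
Proof.
move=> [d d0 h] [d' d'0 h']; exists (Num.min d d'); first by rewrite lt_min d0.
by move=> t St; split; [apply: h|apply: h']; apply: S_mono St; rewrite ge_min lexx ?orbT.
Qed.

Lemma es_forall (I : finType) (P : I -> T -> Prop) :
  (forall i, eventually_small (P i)) -> eventually_small (fun t => forall i, P i t).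
Proof.
move=> h; suff hs (s : seq I) : eventually_small (fun t => forall i, i \in s -> P i t).
  by apply: es_impl (hs (enum I)) => t + i; apply; rewrite mem_enum.
elim: s => [|j s IH]; first by exists 1.
apply: es_impl (es_and (h j) IH) => t [Pj Ps] i; rewrite inE => /orP[/eqP->//|].
exact: Ps.
Qed.

Definition null u := forall e, 0 < e -> eventually_small (fun t => nrm (u t) <= e).

Definition bdd u := exists M, eventually_small (fun t => nrm (u t) <= M).

Lemma null_ext u v : u =1 v -> null u -> null v.
Proof. by move=> uv hu e /hu; apply: es_impl => t; rewrite uv. Qed.

Lemma nullD u v : null u -> null v -> null (fun t => u t + v t).
Proof.
move=> hu hv e e0; have e20 : 0 < e / 2 by rewrite divr_gt0.
apply: es_impl (es_and (hu _ e20) (hv _ e20)) => t [ut vt].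
by rewrite (splitr e) (le_trans (nrmD _ _))// lerD.
Qed.

Lemma nullN u : null u -> null (fun t => - u t).
Proof. by move=> hu e /hu; apply: es_impl => t; rewrite nrmN. Qed.

Lemma null_star u : null u -> null (fun t => (u t)^c*).
Proof. by move=> hu e /hu; apply: es_impl => t; rewrite nrm_star. Qed.

Lemma null_bound u v : null u -> bdd v ->
  forall e, 0 < e -> eventually_small (fun t => nrm (u t) * nrm (v t) <= e).
Proof.
move=> hu [M hv] e e0; pose N := Num.max M 0 + 1.
have N0 : 0 < N by rewrite ltr_wpDl// le_max lexx orbT.
apply: es_impl (es_and (hu (e / N) _) hv) => [t [ut vt]|]; last by rewrite divr_gt0.
have vN : nrm (v t) <= N by rewrite (le_trans vt)// ler_wpDr// le_max lexx.
by rewrite -[e](divfK (lt0r_neq0 N0)) ler_pM ?nrm_ge0.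
Qed.

Lemma null_mulr u v : null u -> bdd v -> null (fun t => u t * v t).
Proof.
move=> hu hv e /(null_bound hu hv); apply: es_impl => t; apply: le_trans.
exact: unrmM.
Qed.

Lemma null_mull u v : null u -> bdd v -> null (fun t => v t * u t).
Proof.
move=> hu hv e /(null_bound hu hv); apply: es_impl => t; apply: le_trans.
by rewrite mulrC; exact: unrmM.
Qed.

Lemma null0 : null (fun=> 0).
Proof. by move=> e e0; exists 1 => // t _; rewrite nrm0 ltW. Qed.

Lemma bdd_cst p : bdd (fun=> p).
Proof. by exists (nrm p), 1. Qed.

Lemma bddM u v : bdd u -> bdd v -> bdd (fun t => u t * v t).
Proof.
move=> [M hu] [N hv]; exists (M * N); apply: es_impl (es_and hu hv) => t [ut vt].
by rewrite (le_trans (unrmM _ _))// ler_pM ?nrm_ge0.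
Qed.

Lemma null_bdd u v : null (fun t => u t - v t) -> bdd v -> bdd u.
Proof.
move=> hu [M hv]; exists (1 + M); apply: es_impl (es_and (hu 1 ltr01) hv) => t [ut vt].
by rewrite -[u t](subrK (v t)) (le_trans (nrmD _ _))// lerD.
Qed.

Variable f : T -> U.
Hypotheses (f_sa : forall t, (f t)^c* = f t)
  (f_nrm : eventually_small (fun t => nrm (f t) <= 1)).

Lemma fX_nrm i : eventually_small (fun t => nrm (f t ^+ i) <= 1).
Proof.
apply: es_impl f_nrm => t ft; elim: i => [|i IH]; first by rewrite expr0 -rsc1 nrm_rsc normr1.
by rewrite exprS (le_trans (unrmM _ _))// -[leRHS]mulr1 ler_pM ?nrm_ge0.
Qed.

Lemma fX_bdd i : bdd (fun t => f t ^+ i). Proof. by exists 1; exact: fX_nrm. Qed.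

Definition acomm p := null (fun t => f t * p - p * f t).

Lemma acommX p i : acomm p -> null (fun t => f t ^+ i * p - p * f t ^+ i).
Proof.
move=> hp; elim: i => [|i IH].
  by apply: null_ext null0 => t; rewrite expr0 mulr1 mul1r subrr.
apply: null_ext (nullD (null_mull IH (fX_bdd 1)) (null_mulr hp (fX_bdd i))) => t.
by rewrite expr1 mulrBr mulrBl !mulrA subrKA -exprS -mulrA -exprS.
Qed.

(* [S d t] says that the configuration [t] is [d]-good; [u] agrees with [f^i p] as d
   tends to 0, and [f] almost commutes with [p]. Such pairs are closed under the
   *-operations, so that relations between the [p]'s pass to the [u]'s. *)
Definition nf i u p := null (fun t => u t - f t ^+ i * p) /\ acomm p.

Lemma nf_bdd i u p : nf i u p -> bdd u.
Proof. by move=> [/null_bdd hu _]; apply/hu/bddM/bdd_cst/fX_bdd. Qed.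

Lemma acommM p q : acomm p -> acomm q -> acomm (p * q).
Proof.
move=> hp hq; apply: null_ext (nullD (null_mulr hp (bdd_cst q)) (null_mull hq (bdd_cst p))) => t.
by rewrite mulrBr mulrBl !mulrA subrKA.
Qed.

Lemma acomm_star p : acomm p -> acomm p^c*.
Proof.
move=> hp; apply: null_ext (nullN (null_star hp)) => t.
by rewrite cstarB !ustarM f_sa opprB.
Qed.

Lemma acommD p q : acomm p -> acomm q -> acomm (p + q).
Proof.
move=> hp hq; apply: null_ext (nullD hp hq) => t.
by rewrite mulrDr mulrDl opprD addrACA.
Qed.

Lemma acommN p : acomm p -> acomm (- p).
Proof.
by move=> hp; apply: null_ext (nullN hp) => t; rewrite mulrN mulNr opprB opprK addrC.
Qed.

(** Telescoping: u v - f^(i+j) p q is the sum of u (v - f^j q), (u - f^i p) f^j q and f^i (p f^j -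
    f^j p) q. *)
Lemma nfM i j u v p q : nf i u p -> nf j v q -> nf (i + j) (fun t => u t * v t) (p * q).
Proof.
move=> hu hv; have [up hp] := hu; have [vq hq] := hv; split; last exact: acommM.
have h1 := null_mull vq (nf_bdd hu).
have h2 := null_mulr up (bddM (fX_bdd j) (bdd_cst q)).
have h3 := null_mulr (null_mull (nullN (acommX j hp)) (fX_bdd i)) (bdd_cst q).
apply: null_ext (nullD h1 (nullD h2 h3)) => t.
rewrite !mulrBr mulrBl opprB mulrBr mulrBl !mulrA addrA subrKA subrKA.
by rewrite exprD.
Qed.

Lemma nf_star i u p : nf i u p -> nf i (fun t => (u t)^c*) p^c*.
Proof.
move=> [up hp]; split; last exact: acomm_star.
apply: null_ext (nullD (null_star up) (null_star (acommX i hp))) => t.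
by rewrite !cstarB !ustarM ustarX f_sa subrKA.
Qed.

Lemma nfD i u v p q : nf i u p -> nf i v q -> nf i (fun t => u t + v t) (p + q).
Proof.
move=> [up hp] [vq hq]; split; last exact: acommD.
by apply: null_ext (nullD up vq) => t; rewrite mulrDr opprD addrACA.
Qed.

Lemma nfN i u p : nf i u p -> nf i (fun t => - u t) (- p).
Proof.
move=> [up hp]; split; last exact: acommN.
by apply: null_ext (nullN up) => t; rewrite mulrN opprD.
Qed.

Lemma nf0 i : nf i (fun=> 0) 0.
Proof.
split; first by apply: null_ext null0 => t; rewrite mulr0 subrr.
by apply: null_ext null0 => t; rewrite mulr0 mul0r subrr.
Qed.

Lemma nf_sum i (J : finType) (u : J -> T -> U) (p : J -> U) :
  (forall j, nf i (u j) (p j)) -> nf i (fun t => \sum_j u j t) (\sum_j p j).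
Proof.
move=> h; suff hs (s : seq J) : nf i (fun t => \sum_(j <- s) u j t) (\sum_(j <- s) p j) by exact: hs.
elim: s => [|j s [IH1 IH2]].
  by have [h1 h2] := nf0 i; split; [apply: null_ext h1 => t|]; rewrite !big_nil.
have [h1 h2] := nfD (h j) (conj IH1 IH2).
by split; [apply: null_ext h1 => t|]; rewrite !big_cons.
Qed.

Lemma nf_nrm i u p (e : R) : nf i u p -> 0 < e ->
  eventually_small (fun t => nrm (u t) <= nrm p + e).
Proof.
move=> [up _] e0; apply: es_impl (es_and (up e e0) (fX_nrm i)) => t [ut ft].
rewrite -[u t](subrK (f t ^+ i * p)) addrC (le_trans (nrmD _ _))// lerD//.
by rewrite (le_trans (unrmM _ _))// ler_piMl ?nrm_ge0.
Qed.

End almost_commuting.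

(** * Compression of a relation by f = 1 - e *)

Section compression.
Context (R : realType) (D : cstarAlgType R).
Local Notation U := (unitz D).

(* [1 - f^4] for [f = 1 - e]. *)
Definition compl4 (t : R) := 1 - (1 - t) ^+ 4.

Lemma czero_compl4 : czero compl4.
Proof.
split; last by rewrite /compl4 subr0 expr1n subrr.
by apply/contD/contN/contX/contD/contN/cont_id/cont_cst/cont_cst.
Qed.

Lemma inU_compl4 (E : D) : E^c* = E -> inU (fc E compl4) = 1 - (1 - inU E) ^+ 4.
Proof.
move=> Esa; have Usa : (inU E)^c* = inU E by rewrite -inU_star Esa.
have c1 : continuous (fun t : R => 1 - t) by apply/contD/contN/cont_id/cont_cst.
rewrite inU_fc//; last exact: czero_compl4.
rewrite [LHS](@fcUB _ _ _ _ (fun t => (1 - t) ^+ 4))//; last exact: contX.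
  by rewrite fcUX// fcUB ?fcU_cst ?fcU_id ?rsc1//; [exact: cont_cst|exact: cont_id].
exact: cont_cst.
Qed.

(** With f = 1 - E one has y^2 - y f^2 y = y E (1 + f) y, and E (1 + f) is a product of commuting
    positive elements. *)
Lemma cle_compress (E y : D) : cpos E -> nrm E <= 1 -> y^c* = y ->
  cle ((y - E *c y)^c* *c (y - E *c y)) (y *c y).
Proof.
move=> E0 E1 ysa; have Esa := cpos_sa E0.
have f0 : upos (1 - inU E).
  by rewrite -rsc1; have [] // := @upos_of_nrm _ _ (inU E) 1; rewrite ?nrm_inU// -inU_star Esa.
apply: cle_le; first by exists (y - E *c y).
have yE : inU (y - E *c y) = (1 - inU E) * inU y by rewrite inUB inUM mulrBl mul1r.
apply/cposP; rewrite inUB !inUM inU_star yE ustarM cstarB ustar1 -!inU_star Esa ysa.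
set h := inU E in f0 *.
have -> : inU y * inU y - inU y * (1 - h) * ((1 - h) * inU y)
    = (inU y)^c* * (h * (1 + (1 - h))) * inU y.
  have -> : h * (1 + (1 - h)) = 1 - (1 - h) * (1 - h).
    rewrite mulrDr mulr1 [(1 - h) * _]mulrBl mul1r !opprB [RHS]addrCA.
    by rewrite addrC; congr (_ + _); rewrite addrC subrK.
  by rewrite -inU_star ysa [in RHS]mulrBr mulr1 [in RHS]mulrBl !mulrA.
apply: upos_conj; apply: uposM; first exact/cposP.
  by apply: uposD => //; exact: upos1.
by rewrite mulrDl mulrDr mulrBl mulrBr mulr1 mul1r.
Qed.

(** To be used with z = a^(1/4) and y = b^(1/2). Both z^4 and the sums of X^* y^2 X have degree four
    in the elements replaced, so both pick up f^4, and an error h becomes at most 2 h. The second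
    estimate records what z^4 loses. The bound d precedes [E] and the primed elements. *)
Lemma compress_relations (I J : finType) (z y : D) (X : J -> I -> D) (h e : R) :
  z^c* = z -> y^c* = y -> 0 < h -> 0 < e ->
  (forall i i', nrm (\sum_j (X j i)^c* *c (y *c y) *c X j i' -
                     (if i == i' then (z *c z) *c (z *c z) else 0)) <= h) ->
  exists2 d : R, 0 < d & forall (E z' y' : D) (X' : J -> I -> D),
    cpos E -> nrm E <= 1 ->
    (forall u, u = z \/ u = y \/ (exists j i, u = X j i) -> nrm (E *c u - u *c E) <= d) ->
    nrm (z' - (z - E *c z)) <= d -> nrm (y' - (y - E *c y)) <= d ->
    (forall j i, nrm (X' j i - (X j i - E *c X j i)) <= d) ->
    let a' := (z'^c* *c z') *c (z'^c* *c z') in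
    [/\ forall i i', nrm (\sum_j (X' j i)^c* *c (y'^c* *c y') *c X' j i' -
                     (if i == i' then a' else 0)) <= h + h,
        nrm (a' + z *c z *c fc E compl4 *c (z *c z) - z *c z *c (z *c z)) <= h,
        nrm (y'^c* *c y' - (y - E *c y)^c* *c (y - E *c y)) <= e &
        forall j i, nrm (X' j i) <= nrm (X j i) + 1].
Proof.
move=> zsa ysa h0 e0 hX.
(* All data chosen after d form one configuration. The conditions on E are part of the type, so that
   f is self-adjoint at every configuration. *)
pose T := ({E : D | cpos E /\ nrm E <= 1} * D * D * (J -> I -> D))%type.
pose ee (t : T) : D := sval t.1.1.1.
pose zz (t : T) : D := t.1.1.2.
pose yy (t : T) : D := t.1.2.
pose xx (t : T) : J -> I -> D := t.2.
pose S (d : R) (t : T) := [/\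
  forall u, u = z \/ u = y \/ (exists j i, u = X j i) -> nrm (ee t *c u - u *c ee t) <= d,
  nrm (zz t - (z - ee t *c z)) <= d, nrm (yy t - (y - ee t *c y)) <= d &
  forall j i, nrm (xx t j i - (X j i - ee t *c X j i)) <= d].
have S_mono d d' t : d <= d' -> S d t -> S d' t.
  by move=> dd' [h1 h2 h3 h4]; split=> *; apply: le_trans dd'; auto.
have ee0 t : cpos (ee t) by case: (svalP t.1.1.1).
have ee1 t : nrm (ee t) <= 1 by case: (svalP t.1.1.1).
pose f (t : T) : U := 1 - inU (ee t).
have f_sa t : (f t)^c* = f t by rewrite cstarB ustar1 -inU_star (cpos_sa (ee0 t)).
have f_nrm : eventually_small S (fun t => nrm (f t) <= 1).
  exists 1 => // t _; rewrite /f -rsc1; apply: upos_ball; first exact/cposP.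
  by rewrite nrm_inU.
have nf1 (u : T -> D) v : v = z \/ v = y \/ (exists j i, v = X j i) ->
    (forall d t, S d t -> nrm (u t - (v - ee t *c v)) <= d) ->
    nf S f 1 (fun t => inU (u t)) (inU v).
  move=> vL hu; split => d d0; exists d => // t St.
    rewrite expr1 /f mulrBl mul1r -inUM -!inUB nrm_inU; exact: hu.
  case: St => /(_ v vL) hc _ _ _.
  by rewrite /f mulrBl mulrBr mul1r mulr1 opprB addrC addrA subrK -nrmN opprB -!inUM -inUB nrm_inU.
have nz : nf S f 1 (fun t => inU (zz t)) (inU z) by apply: nf1; [left|move=> d t []].
have ny : nf S f 1 (fun t => inU (yy t)) (inU y) by apply: nf1; [right; left|move=> d t []].
have nx j i : nf S f 1 (fun t => inU (xx t j i)) (inU (X j i)).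
  by apply: nf1; [right; right; exists j, i|move=> d t []].
have ny' : nf S f 1 (fun t => inU (y - ee t *c y)) (inU y).
  by apply: nf1; [right; left|move=> d t [_ _ + _]; rewrite subrr nrm0; apply: le_trans (nrm_ge0 _)].
pose aa t := (zz t)^c* *c zz t *c ((zz t)^c* *c zz t).
pose cc t := (yy t)^c* *c yy t.
pose cf t := (y - ee t *c y)^c* *c (y - ee t *c y).
pose NF i (u : T -> D) (p : D) := nf S f i (fun t => inU (u t)) (inU p).
have NFE i (u v : T -> U) p q : u =1 v -> p = q -> nf S f i u p -> nf S f i v q.
  by move=> uv <- [h1 h2]; split => //; apply: null_ext h1 => t; rewrite uv.
have NFM i j u v p q : NF i u p -> NF j v q -> NF (i + j)%N (fun t => u t *c v t) (p *c q).
  move=> hu hv; apply: NFE (nfM S_mono f_nrm hu hv); last by rewrite inUM.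
  by move=> t; rewrite inUM.
have NFs i u p : NF i u p -> NF i (fun t => (u t)^c*) p^c*.
  move=> hu; apply: NFE (nf_star S_mono f_sa f_nrm hu); last by rewrite inU_star.
  by move=> t; rewrite inU_star.
have NFB i u v p q : NF i u p -> NF i v q -> NF i (fun t => u t - v t) (p - q).
  move=> hu hv; apply: NFE (nfD S_mono hu (nfN hv)); last by rewrite inUB.
  by move=> t; rewrite inUB.
have naa : NF 4%N aa (z *c z *c (z *c z)).
  by rewrite -{1 3}zsa; apply: (NFM 2%N 2%N); apply: (NFM 1%N 1%N) => //; exact: NFs.
have ncc : NF 2%N cc (y *c y) by rewrite -{1}ysa; apply: (NFM 1%N 1%N) => //; exact: NFs.
have ncf : NF 2%N cf (y *c y) by rewrite -{1}ysa; apply: (NFM 1%N 1%N) => //; exact: NFs.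
have nrel i i' : NF 4%N (fun t => \sum_j (xx t j i)^c* *c cc t *c xx t j i' -
      (if i == i' then aa t else 0))
    (\sum_j (X j i)^c* *c (y *c y) *c X j i' - (if i == i' then (z *c z) *c (z *c z) else 0)).
  apply: NFB; last first.
    case: eqP => _ //; apply: NFE (nf0 S f 4%N) => //.
  apply: (NFE _ _ _ _ _ _ _ (nf_sum S_mono (fun j =>
    NFM _ _ _ _ _ _ (NFM _ _ _ _ _ _ (NFs _ _ _ (nx j i)) ncc) (nx j i')))).
    by move=> t; rewrite inU_sum.
  by rewrite inU_sum.
have k1 : eventually_small S (fun t => forall ii : I * I,
    nrm (\sum_j (xx t j ii.1)^c* *c cc t *c xx t j ii.2 -
      (if ii.1 == ii.2 then aa t else 0)) <= h + h).
  apply: es_forall => // -[i i'] /=.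
  apply: es_impl (nf_nrm S_mono f_nrm (nrel i i') h0) => t.
  by rewrite !nrm_inU => /le_trans; apply; rewrite lerD2r.
have k2 : eventually_small S (fun t =>
   nrm (aa t + z *c z *c fc (ee t) compl4 *c (z *c z) - z *c z *c (z *c z)) <= h).
  have [n1 _] := naa; have cz : acomm S f (inU (z *c z)).
    by have [] := NFM _ _ _ _ _ _ nz nz.
  have n2 := null_mulr S_mono (acommX S_mono f_nrm 4%N cz) (bdd_cst _ (inU (z *c z))).
  apply: es_impl (nullD S_mono n1 n2 h0) => t; apply: le_trans.
  rewrite -nrm_inU inUB inUD [inU (z *c z *c (z *c z))]inUM !(inUM (z *c z *c _)) !(inUM (z *c z)).
  rewrite inU_compl4 ?(cpos_sa (ee0 t))// -/(f t).
  rewrite le_eqVlt; apply/orP; left; apply/eqP; congr nrm.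
  rewrite mulrBr mulr1 !mulrBl [in RHS]mulrA addrA subrKA.
  by rewrite [LHS]addrAC addrK.
have k3 : eventually_small S (fun t => nrm (cc t - cf t) <= e).
  have [n1 _] := ncc; have [n2 _] := ncf.
  apply: es_impl (nullD S_mono n1 (nullN n2) e0) => t.
  by rewrite opprB addrA subrK -inUB nrm_inU.
have k4 : eventually_small S (fun t => forall ji : J * I,
    nrm (xx t ji.1 ji.2) <= nrm (X ji.1 ji.2) + 1).
  apply: es_forall => // -[j i] /=.
  by apply: es_impl (nf_nrm S_mono f_nrm (nx j i) ltr01) => t; rewrite !nrm_inU.
have [d d0 hd] := es_and S_mono (es_and S_mono k1 k2) (es_and S_mono k3 k4).
exists d => // E z' y' X' E0 E1 hc hz hy hx a'.
have [|[K1 K2] [K3 K4]] := hd (exist _ E (conj E0 E1), z', y', X'); first by split.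
split=> //; first by move=> i i'; exact: (K1 (i, i')).
by move=> j i; exact: (K4 (j, i)).
Qed.

End compression.

(** Almost unperforation for the elements of D itself, multiples being constant families; imposed on
    all matrix algebras it amounts to [class_W], by [class_W_mx]. *)
Definition almost_unperforated_at (R : realType) (D : cstarAlgType R) :=
  forall (a b : D) k, cpos a -> cpos b ->
    fle (fun _ : 'I_k.+1 => a) (fun _ : 'I_k => b) -> cle a b.

(** A lower bound up to C takes the place of isometry; for matrices over a subalgebra, C = n^2 is
    read off the entries. *)
Record star_embedding (R : realType) (D' D : cstarAlgType R) (C : R) := StarEmbedding {
  semb_fun :> D' -> D;
  sembD : forall x y, semb_fun (x + y) = semb_fun x + semb_fun y;
  sembZ : forall (k : R[i]) x, semb_fun (k *: x) = k *: semb_fun x;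
  sembM : forall x y, semb_fun (x *c y) = semb_fun x *c semb_fun y;
  semb_star : forall x, semb_fun x^c* = (semb_fun x)^c*;
  semb_nrm : forall x, nrm (semb_fun x) <= nrm x;
  semb_nrm_le : forall x, nrm x <= C * nrm (semb_fun x) }.

(** * Functional calculus and comparison under embeddings *)

Section embeddings.
Context (R : realType) (D' D : cstarAlgType R) (C : R) (phi : star_embedding D' D C).

Lemma semb_fc a f : a^c* = a -> czero f -> phi (fc a f) = fc (phi a) f.
Proof. exact: morph_fc (sembD phi) (sembZ phi) (sembM phi) (semb_star phi) (semb_nrm phi) _ _. Qed.

Lemma semb_cpos a : cpos a -> cpos (phi a).
Proof. by move=> [y ->]; exists (phi y); rewrite sembM semb_star. Qed.

Lemma semb0 : phi 0 = 0. Proof. exact: morph0 (sembZ phi). Qed.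

Lemma sembB x y : phi (x - y) = phi x - phi y.
Proof. by rewrite sembD (morphN (sembZ phi)). Qed.

Lemma semb_sum (J : finType) (F : J -> D') : phi (\sum_j F j) = \sum_j phi (F j).
Proof. exact: (big_morph phi (sembD phi) semb0). Qed.

Lemma semb_cle a b : cle a b -> cle (phi a) (phi b).
Proof.
move=> ab e /ab[x hx]; exists (phi x).
by rewrite -semb_star -!sembM -sembB (le_trans (semb_nrm _ _)).
Qed.

End embeddings.

(** The relation in D' holds up to 3 C h. [fle_cut] makes it exact for a cut of a0', almost
    unperforation removes the multiples, and the image of that cut is the element sought. On the
    other side c0' is cut as well, so that [cle_cut] puts it below y f^2 y, hence below [c]. *)
Lemma unperforated_transfer (R : realType) (D : cstarAlgType R) (a c : D) k (C e : R) :
  cpos a -> cpos c -> 0 <= C -> 0 < e ->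
  fle (fun _ : 'I_k.+1 => a) (fun _ : 'I_k => c) ->
  exists (L : seq D) (d : R), 0 < d /\
    forall (E : D) (D' : cstarAlgType R) (phi : star_embedding D' D C),
    cpos E -> nrm E <= 1 -> almost_unperforated_at D' ->
    (forall u, u \in L -> nrm (E *c u - u *c E) <= d) ->
    (forall u, u \in L -> exists u' : D', nrm (phi u' - (u - E *c u)) <= d) ->
    exists b : D, [/\ cpos b, cle b c &
      nrm (b + fc a Num.sqrt *c fc E (@compl4 R) *c fc a Num.sqrt - a) <= e].
Proof.
move=> a0 c0 C0 e0 ac; have asa := cpos_sa a0; have csa := cpos_sa c0.
have idc := @czero_id R; have cs := czero_sqrt idc.
have css := czero_sqrt cs.
pose z := fc a (fun t => Num.sqrt (Num.sqrt t)); pose y := fc c Num.sqrt.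
have zsa : z^c* = z by exact: fc_sa.
have ysa : y^c* = y by exact: fc_sa.
have zz : z *c z = fc a Num.sqrt.
  rewrite -fcM//; apply: cpos_fc_eq => // [|t _]; first exact: czeroM.
  by rewrite -expr2 sqr_sqrtr// sqrtr_ge0.
have ww : fc a Num.sqrt *c fc a Num.sqrt = a.
  rewrite -fcM// -[RHS]fc_id//; apply: cpos_fc_eq => // [|/= t /andP[t0 _]]; first exact: czeroM.
  by rewrite -expr2 sqr_sqrtr.
have yy : y *c y = c.
  rewrite -fcM// -[RHS]fc_id//; apply: cpos_fc_eq => // [|/= t /andP[t0 _]]; first exact: czeroM.
  by rewrite -expr2 sqr_sqrtr.
pose N2 : R := (k.+1 * k.+1)%:R; have N20 : 0 <= N2 by exact: ler0n.
(* Chosen so that the cut N2 * (C * (3 * h)) and the defect h of the compression add up to (Q + 1) h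
   = e. *)
pose Q := N2 * (C * 3); have Q0 : 0 <= Q by rewrite !mulr_ge0.
pose h := e / (Q + 1); have h0 : 0 < h by rewrite divr_gt0// ltr_wpDl.
have c3h0 : 0 <= C * (3 * h) by apply: mulr_ge0 => //; apply: mulr_ge0 => //; exact: ltW.
have kap0 : 0 <= N2 * (C * (3 * h)) by exact: mulr_ge0.
have [X hX] := ac h h0.
(* M bounds the sums of products of norms of the elements replacing [X], each of norm at most 1 more
   than the original; cutting c0' by h / (M + 1) then changes the relation by at most h. *)
pose M := \sum_j \sum_i \sum_i' (nrm (X j i) + 1) * (nrm (X j i') + 1).
have n1 j i : 0 <= nrm (X j i) + 1 by rewrite addr_ge0 ?nrm_ge0.
have M0 : 0 <= M by do 3 (apply: sumr_ge0 => ? _); rewrite mulr_ge0.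
have g0 : 0 < h / (M + 1) by rewrite divr_gt0// ltr_wpDl.
have [|d d0 hd] := compress_relations zsa ysa h0 g0 (X := X).
  by move=> i i'; rewrite zz ww yy.
exists (z :: y :: [seq X ji.1 ji.2 | ji <- enum {: 'I_k * 'I_k.+1}]), d; split => //.
have XL j i : X j i \in z :: y :: [seq X ji.1 ji.2 | ji <- enum {: 'I_k * 'I_k.+1}].
  by rewrite !inE; apply/orP; right; apply/orP; right; apply/mapP; exists (j, i); rewrite ?mem_enum.
move=> E D' phi E0 E1 unp hc hu.
have [z0 hz0] := hu z (mem_head _ _).
have [|y0 hy0] := hu y; first by rewrite !inE eqxx orbT.
have [X0' hX0'] := choice (fun ji : 'I_k * 'I_k.+1 => hu _ (XL ji.1 ji.2)).
pose X0 j i := X0' (j, i).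
have [||K1 K2 K3 K4] := hd E (phi z0) (phi y0) (fun j i => phi (X0 j i)) E0 E1 _ hz0 hy0.
- move=> u [->|[->|[j [i ->]]]]; apply: hc => //; first exact: mem_head.
  by rewrite !inE eqxx orbT.
- by move=> j i; exact: (hX0' (j, i)).
set a' := (phi z0)^c* *c phi z0 *c ((phi z0)^c* *c phi z0) in K1 K2.
pose a0' := (z0^c* *c z0) *c (z0^c* *c z0); pose c0' := y0^c* *c y0.
have c0p : cpos c0' by exists y0.
have a0p : cpos a0'.
  by exists (z0^c* *c z0); rewrite cstarM cstarK.
have pa : phi a0' = a' by rewrite !sembM !semb_star.
set g := h / (M + 1) in g0 K3.
have gw := ltW g0.
have pc : phi (cut g c0') = cut g (phi c0').
  by apply: semb_fc; [exact: cpos_sa|exact: czero_cut].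
(* The cut of c0' costs h and the compressed relation 2 h; the factor C comes from pulling the norm
   back to D'. *)
have rel i i' : nrm (\sum_j (X0 j i)^c* *c cut g c0' *c X0 j i' -
    (if i == i' then a0' else 0)) <= C * (3 * h).
  apply: le_trans (semb_nrm_le phi _) _; apply: ler_wpM2l => //.
  rewrite sembB semb_sum (fun_if phi) semb0 pa.
  have hM : \sum_j (nrm (phi (X0 j i)) * g * nrm (phi (X0 j i'))) <= h.
    apply: (@le_trans _ _ (M * g)); last first.
      by rewrite /g mulrCA ler_piMr ?(ltW h0)// ler_pdivrMr ?mul1r ?lerDl// ltr_wpDl.
    rewrite /M mulr_suml; apply: ler_sum => j _.
    rewrite mulrAC ler_wpM2r// (bigD1 i)//= (bigD1 i')//= -addrA.
    apply: (@le_trans _ _ ((nrm (X j i) + 1) * (nrm (X j i') + 1))).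
      by apply: ler_pM; rewrite ?nrm_ge0.
    rewrite lerDl addr_ge0//; first by apply: sumr_ge0 => ? _; rewrite mulr_ge0.
    by do 2 (apply: sumr_ge0 => ? _); rewrite mulr_ge0.
  have -> : 3 * h = h + (h + h) by ring.
  rewrite -[leLHS](_ : nrm (\sum_j phi (X0 j i)^c* *c (phi (cut g c0' - c0')) *c phi (X0 j i') +
    (\sum_j (phi (X0 j i))^c* *c ((phi y0)^c* *c phi y0) *c phi (X0 j i') -
      (if i == i' then a' else 0))) = _).
    apply: le_trans (nrmD _ _) _; apply: lerD (K1 i i').
    apply: le_trans (nrm_sum _ _ _) _; apply: le_trans hM; apply: ler_sum => j _.
    rewrite semb_star; apply: le_trans (nrmM _ _) _; apply: ler_wpM2r; first exact: nrm_ge0.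
    apply: le_trans (nrmM _ _) _; rewrite nrm_star; apply: ler_wpM2l; first exact: nrm_ge0.
    by apply: le_trans (semb_nrm _ _) _; exact: cut_close.
  congr nrm; rewrite addrA -big_split/=; congr (_ - _); apply: eq_bigr => j _.
  by rewrite !sembM semb_star sembB -cmulDl -cmulDr !sembM semb_star subrK.
exists (cut (N2 * (C * (3 * h))) a'); split.
- apply: cut_cpos; first exact: kap0.
  by rewrite -pa; exact: semb_cpos.
- apply: (@cle_trans _ _ (phi (cut g c0'))).
  + have -> : cut (N2 * (C * (3 * h))) a' = phi (cut (N2 * (C * (3 * h))) a0').
      rewrite -pa [RHS]semb_fc//; first exact: cpos_sa.
      exact: czero_cut kap0.
    apply: semb_cle; apply: (unp _ _ k).
    * by apply: cut_cpos => //; exact: kap0.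
    * exact: cut_cpos.
    * apply: (fle_cut (X := X0)) => //; first exact: cut_cpos.
  + rewrite pc; apply: (@cle_trans _ _ ((y - E *c y)^c* *c (y - E *c y))).
      apply: cle_cut => //; [exact: semb_cpos|by exists (y - E *c y)|].
      by rewrite sembM semb_star.
    by rewrite -yy; exact: cle_compress.
- set b := cut _ a'; set w := fc a Num.sqrt; rewrite -/w zz ww -/w in K2 *.
  have -> : b + w *c fc E (@compl4 R) *c w - a = (b - a') + (a' + w *c fc E (@compl4 R) *c w - a).
    by rewrite -(addrA a') [RHS]addrA subrK addrA.
  apply: le_trans (nrmD _ _) _; apply: (@le_trans _ _ (N2 * (C * (3 * h)) + h)).
    apply: lerD => //; apply: cut_close; first exact: kap0.
    by rewrite -pa; exact: semb_cpos.
  have -> : N2 * (C * (3 * h)) + h = (Q + 1) * h by rewrite /Q; ring.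
  by rewrite /h mulrC divfK// lt0r_neq0// ltr_wpDl.
Qed.

Lemma compl4_bounds (R : realType) (t : R) : 0 <= t <= 1 -> 0 <= compl4 t <= 4 * t.
Proof.
move=> /andP[t0 t1]; rewrite /compl4.
have -> : 1 - (1 - t) ^+ 4 = t * ((2 - t) * (1 + (1 - t) ^+ 2)) by ring.
have u0 : 0 <= (1 - t) ^+ 2 by exact: sqr_ge0.
have u1 : (1 - t) ^+ 2 <= 1 by rewrite expr_le1//; lra.
rewrite mulr_ge0//=; last by rewrite mulr_ge0//; lra.
rewrite mulrC ler_wpM2r//; nra.
Qed.

(** 1 - (1 - t)^4 is at most 4 t on [0, 1], so the error term of the transfer is below [E] whatever
    [w] is. *)
Lemma cle_compl4 (R : realType) (D : cstarAlgType R) (E w : D) : cpos E -> nrm E <= 1 ->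
  w^c* = w -> cle (w *c fc E (@compl4 R) *c w) E.
Proof.
move=> E0 E1 wsa; apply: (@cle_trans _ _ (fc E (@compl4 R))).
  by rewrite -{1}wsa; exact: cle_conj.
apply: (@cle_fc_le _ _ _ _ 4) => //; first exact: czero_compl4.
by move=> t /andP[t0 t1]; apply: compl4_bounds; rewrite t0 (le_trans t1).
Qed.

Lemma cpos_compl4 (R : realType) (D : cstarAlgType R) (E : D) : cpos E -> nrm E <= 1 ->
  cpos (fc E (@compl4 R)).
Proof.
move=> E0 E1; apply: cpos_fc => //; first exact: czero_compl4.
move=> t /andP[t0 t1]; suff /andP[] : 0 <= compl4 t <= 4 * t by [].
by apply: compl4_bounds; rewrite t0 (le_trans t1).
Qed.

(** 1 - (1 - t)^4 = q(t) t, and 15 = q(-1) is the largest value of q on [-1, 1]. *)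
Lemma compl4_nrm (R : realType) (D : cstarAlgType R) (E w : D) : E^c* = E -> nrm E <= 1 ->
  nrm (fc E (@compl4 R) *c w) <= 15 * nrm (E *c w).
Proof.
move=> Esa E1; have Usa : (inU E)^c* = inU E by rewrite -inU_star Esa.
have idc := @cont_id R.
have c1 (s : R) : continuous (fun t : R => s - t) by apply/contD/contN/cont_id/cont_cst.
pose q (t : R) := (2 - t) * (1 + (1 - t) ^+ 2).
have qc : continuous q.
  by apply: contM => //; apply: contD; [exact: cont_cst|exact: contX].
have gE : inU (fc E (@compl4 R)) = fcU (inU E) q * inU E.
  rewrite inU_fc//; last exact: czero_compl4.
  have -> : fcU (inU E) q * inU E = fcU (inU E) (fun t => q t * t) by rewrite -{2}(fcU_id Usa) -fcUM.
  apply: fcU_eq => t _.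
  by rewrite /compl4 /q; ring.
rewrite -nrm_inU inUM gE -mulrA -inUM -(nrm_inU (E *c w)).
apply: le_trans (unrmM _ _) _; apply: ler_wpM2r; first exact: nrm_ge0.
apply: fcU_norm => // t; rewrite nrm_inU => tE.
have : `|t| <= 1 by exact: le_trans E1.
rewrite ler_norml => /andP[t0 t1]; rewrite /q ler_norml; apply/andP; split; nra.
Qed.

Lemma subalg_nrmE (R : realType) (A : cstarAlgType R) (B : cstarSubalg A)
  (b : subalgType B) : nrm (subalg_val b) = nrm b.
Proof. by rewrite !nrm_Re. Qed.

(** * Matrices over a subalgebra *)

Section subalgebra_matrices.
Context (R : realType) (A : cstarAlgType R) (B : cstarSubalg A) (n : nat).
Local Notation n2 := ((n * n)%:R : R).

Definition subalg_mx (X : cmx (subalgType B) n) : cmx A n :=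
  \matrix_(i, j) subalg_val (X i j).

Lemma subalg_mxE X i j : subalg_mx X i j = subalg_val (X i j).
Proof. by rewrite mxE. Qed.

Lemma subalg_val_sum (J : finType) (F : J -> subalgType B) :
  subalg_val (\sum_j F j) = \sum_j subalg_val (F j).
Proof. exact: (big_morph (@subalg_val R A B)). Qed.

Lemma subalg_mxD X Y : subalg_mx (X + Y) = subalg_mx X + subalg_mx Y.
Proof. by apply/matrixP => i j; rewrite mxE [in LHS]mxE [RHS]mxE !subalg_mxE. Qed.

Lemma subalg_mxZ (k : R[i]) X : subalg_mx (k *: X) = k *: subalg_mx X.
Proof. by apply/matrixP => i j; rewrite subalg_mxE !cmx_scaleE subalg_mxE. Qed.

Lemma subalg_mxM X Y : subalg_mx (X *c Y) = subalg_mx X *c subalg_mx Y.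
Proof.
apply/matrixP => i j; rewrite subalg_mxE !cmx_mulE !cmulmxE subalg_val_sum.
by apply: eq_bigr => k _; rewrite !subalg_mxE.
Qed.

Lemma subalg_mx_star X : subalg_mx X^c* = (subalg_mx X)^c*.
Proof. by apply/matrixP => i j; rewrite subalg_mxE !cmx_starE !cstarmxE subalg_mxE. Qed.

Lemma subalg_mx_nrm_le X : nrm X <= n2 * nrm (subalg_mx X).
Proof.
apply: nrm_le_entry; first exact: nrm_ge0.
by move=> i j; rewrite -subalg_nrmE -subalg_mxE; exact: nrm_entry.
Qed.

Lemma subalg_mx_nrm X : nrm (subalg_mx X) <= nrm X.
Proof.
apply: (morph_contractive subalg_mxM subalg_mx_star (C := n2)) => {}X.
apply: nrm_le_entry; first exact: nrm_ge0.
by move=> i j; rewrite subalg_mxE subalg_nrmE; exact: nrm_entry.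
Qed.

Definition subalg_mx_embedding : star_embedding (cmx (subalgType B) n) (cmx A n) n2 :=
  StarEmbedding subalg_mxD subalg_mxZ subalg_mxM subalg_mx_star subalg_mx_nrm
    subalg_mx_nrm_le.

Lemma subalg_mx_near (Y : cmx A n) (d : R) : 0 <= d ->
  (forall i j, exists2 b, subalg_set B b & nrm (Y i j - b) <= d) ->
  exists X : cmx (subalgType B) n, nrm (subalg_mx X - Y) <= n2 * d.
Proof.
move=> d0 h.
have h' (ij : 'I_n * 'I_n) : exists b : subalgType B, nrm (Y ij.1 ij.2 - subalg_val b) <= d.
  have [b Bb Yb] := h ij.1 ij.2.
  have Bb' : b \in subalg_pred B by exact/mem_set.
  by exists (SubalgElt Bb').
have [X hX] := choice h'; exists (\matrix_(i, j) X (i, j)); apply: nrm_le_entry => // i j.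
have -> : (subalg_mx (\matrix_(i, j) X (i, j)) - Y) i j = subalg_val (X (i, j)) - Y i j.
  by rewrite [LHS]mxE [in X in _ + X]mxE subalg_mxE mxE.
rewrite nrmB; exact: (hX (i, j)).
Qed.

End subalgebra_matrices.

(** * The Cuntz semigroup in terms of matrices *)

Section generalized_matrices.
Context (R : realType) (A : cstarAlgType R).

(** Matrices over arbitrary finite index types, with errors measured entrywise: padding, direct sums
    and multiples become changes of index sets. *)
Definition mle (I J : finType) (a : I -> I -> A) (b : J -> J -> A) :=
  forall e : R, 0 < e -> exists X : J -> I -> A, forall i i',
    nrm (\sum_j \sum_j' (X j i)^c* *c b j j' *c X j' i' - a i i') <= e.

(* [b] is [a] padded with zeros along [f]. *)
Definition mext (I J : finType) (f : I -> J) (a : I -> I -> A) (b : J -> J -> A) :=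
  [/\ injective f, forall i i', b (f i) (f i') = a i i' &
      forall j j', j \notin codom f -> b j j' = 0 /\ b j' j = 0].

Lemma sum_codom (V : nmodType) (I J : finType) (f : I -> J) (F : J -> V) : injective f ->
  (forall j, j \notin codom f -> F j = 0) -> \sum_j F j = \sum_i F (f i).
Proof.
move=> finj F0; rewrite (bigID (fun j => j \in codom f))/= [X in _ + X]big1 ?addr0//.
rewrite -(big_imset (h := f) (A := predT) F)/=; last by move=> i i' _ _; exact: finj.
apply: eq_bigl => j; apply/idP/imsetP => [/codomP[i ->]|[i _ ->]]; first by exists i.
exact: codom_f.
Qed.

Lemma sum2_codom (V : nmodType) (I J : finType) (f : I -> J) (F : J -> J -> V) : injective f ->
  (forall j j', j \notin codom f -> F j j' = 0 /\ F j' j = 0) ->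
  \sum_j \sum_j' F j j' = \sum_i \sum_i' F (f i) (f i').
Proof.
move=> finj F0; rewrite (sum_codom finj) => [|j jf]; last first.
  by apply: big1 => j' _; have [] := F0 j j' jf.
by apply: eq_bigr => i _; apply: (sum_codom finj) => j jf; have [] := F0 j (f i) jf.
Qed.

Definition push (I J : finType) (f : I -> J) (F : I -> A) (j : J) : A :=
  if [pick i | f i == j] is Some i then F i else 0.

Lemma push_f (I J : finType) (f : I -> J) F i : injective f -> push f F (f i) = F i.
Proof.
rewrite /push => finj; case: pickP => [i' /eqP/finj ->//|/(_ i)].
by rewrite eqxx.
Qed.

Lemma push_out (I J : finType) (f : I -> J) F j : j \notin codom f -> push f F j = 0.
Proof.
by rewrite /push; case: pickP => [i /eqP <-|//]; rewrite codom_f.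
Qed.

(** The witness is extended by zero along [f], or restricted along it. *)
Lemma mle_extr (I J J' : finType) (f : J -> J') (a : I -> I -> A) (b : J -> J -> A)
  (b' : J' -> J' -> A) : mext f b b' -> mle a b <-> mle a b'.
Proof.
move=> [finj bE b0]; split=> ab e /ab[X hX].
  exists (fun j' i => push f (fun j => X j i) j') => i i'.
  rewrite (sum2_codom finj) => [|j j' jf]; last first.
    by rewrite !(push_out _ jf) cstar0 !cmul0r cmulr0.
  by under eq_bigr do under eq_bigr do rewrite !push_f// bE.
exists (fun j i => X (f j) i) => i i'; apply: le_trans (hX i i').
rewrite [in leRHS](sum2_codom finj) => [|j j' jf]; last first.
  by have [-> ->] := b0 j j' jf; rewrite !cmulr0 !cmul0r.
by under eq_bigr do under eq_bigr do rewrite -bE.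
Qed.

Lemma mle_extl (I I' J : finType) (f : I -> I') (a : I -> I -> A) (a' : I' -> I' -> A)
  (b : J -> J -> A) : mext f a a' -> mle a b <-> mle a' b.
Proof.
move=> [finj aE a0]; split=> ab e e0; have [X hX] := ab e e0.
  exists (fun j i' => push f (X j) i') => i i'.
  have [/codomP[k ->]|kf] := boolP (i \in codom f); last first.
    have [-> _] := a0 i i' kf; rewrite subr0 big1 ?nrm0 ?(ltW e0)// => j _.
    by rewrite big1// => j' _; rewrite (push_out _ kf) cstar0 !cmul0r.
  have [/codomP[k' ->]|kf] := boolP (i' \in codom f); last first.
    have [_ ->] := a0 i' (f k) kf; rewrite subr0 big1 ?nrm0 ?(ltW e0)// => j _.
    by rewrite big1// => j' _; rewrite (push_out _ kf) cmulr0.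
  by rewrite aE; under eq_bigr do under eq_bigr do rewrite !push_f//.
by exists (fun j i => X j (f i)) => i i'; rewrite -aE.
Qed.

(** The Kronecker product of the identity on K with [a]: one diagonal block [a] for each element of
    K. *)
Definition kron (K I : finType) (a : I -> I -> A) (x y : K * I) : A :=
  if x.1 == y.1 then a x.2 y.2 else 0.

Lemma mext_kron (K I J : finType) (f : I -> J) a b : mext f a b ->
  mext (fun x : K * I => (x.1, f x.2)) (kron a) (kron b).
Proof.
move=> [finj bE b0]; split.
- by move=> [k i] [k' i'] /= [-> /finj ->].
- by move=> [k i] [k' i'] /=; rewrite /kron /= bE.
move=> [k j] [k' j'] kj; rewrite /kron /= eq_sym.
have [|-> ->] := b0 j j'; last by rewrite if_same.
by apply: contra kj => /codomP[i ->]; apply/codomP; exists (k, i).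
Qed.

Lemma mext_unit (I : finType) (a : I -> I -> A) : mext (fun i => (tt, i)) a (kron a).
Proof.
split=> //; first by move=> i i' [].
by move=> [[] j] j' /codomP[]; exists j.
Qed.

(** A family of witnesses in M_n(A) is one rectangular witness over A; the norm of M_n(A) and the
    entries differ by a factor n^2 at most. *)
Lemma fle_mle n (K L : finType) (a b : cmx A n) :
  fle (fun _ : K => a) (fun _ : L => b) <-> mle (kron (K := K) a) (kron (K := L) b).
Proof.
have E (X : L -> K -> cmx A n) k k' s t :
    (\sum_l (X l k)^c* *c b *c X l k' - (if k == k' then a else 0) : cmx A n) s t =
    \sum_(j : L * 'I_n) \sum_(j' : L * 'I_n) (X j.1 k j.2 s)^c* *c kron b j j' *c X j'.1 k' j'.2 t
      - kron a (k, s) (k', t).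
  rewrite [LHS]mxE [in X in _ + X = _]mxE; congr (_ - _); last first.
    by rewrite /kron /=; case: eqP; rewrite // mxE.
  rewrite summxE -(pair_bigA _ (fun l u => \sum_(j' : L * 'I_n)
    (X l k u s)^c* *c kron b (l, u) j' *c X j'.1 k' j'.2 t))/=.
  apply: eq_bigr => l _; rewrite cmx_mulE cmulmxE.
  have hb u v : ((X l k)^c* *c b) u v = \sum_w (X l k w u)^c* *c b w v.
    by rewrite cmx_mulE cmulmxE; apply: eq_bigr => w _; rewrite cmx_starE cstarmxE.
  transitivity (\sum_v \sum_w (X l k w s)^c* *c b w v *c X l k' v t).
    by apply: eq_bigr => v _; rewrite hb cmul_suml.
  rewrite exchange_big; apply: eq_bigr => u _.
  rewrite -(pair_bigA _ (fun l' v => (X l k u s)^c* *c kron b (l, u) (l', v) *c X l' k' v t))/=.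
  rewrite (bigD1 l)//= [X in _ + X]big1 ?addr0 => [|l' ll']; last first.
    by apply: big1 => v _; rewrite /kron /= eq_sym (negbTE ll') cmulr0 cmul0r.
  by apply: eq_bigr => v _; rewrite /kron /= eqxx.
split=> ab e e0.
  have [X hX] := ab e e0; exists (fun j i => X j.1 i.1 j.2 i.2) => -[k s] [k' t] /=.
  by rewrite -E; apply: le_trans (hX k k'); exact: nrm_entry.
have n20 : 0 < (n * n)%:R + 1 :> R by rewrite ltr_wpDl.
have [|X hX] := ab (e / ((n * n)%:R + 1)); first by rewrite divr_gt0.
pose Y l k : cmx A n := \matrix_(u, s) X (l, u) (k, s); exists Y => k k'.
apply: le_trans (_ : (n * n)%:R * (e / ((n * n)%:R + 1)) <= _); last first.
  by rewrite mulrCA ler_piMr ?(ltW e0)// ler_pdivrMr ?mul1r ?lerDl.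
apply: nrm_le_entry => [|s t]; first by rewrite divr_ge0 ?(ltW e0)// ltW.
rewrite [X in nrm X](E Y); apply: le_trans (hX (k, s) (k', t)); rewrite le_eqVlt; apply/orP; left.
apply/eqP; congr (nrm (_ - _)); apply: eq_bigr => -[l u] _; apply: eq_bigr => -[l' v] _.
by rewrite !mxE.
Qed.

Lemma cle_mle n (a b : cmx A n) : cle a b <-> mle (fun i j => a i j) (fun i j => b i j).
Proof.
rewrite cle_fle fle_mle -(mle_extl _ (mext_unit _)) -(mle_extr _ (mext_unit _)).
by [].
Qed.

End generalized_matrices.

(** * Classes, sums and multiples in W(A) *)

Section cuntz_semigroup.
Context (R : realType) (A : cstarAlgType R).
Implicit Types (a b c : Moopos A).

Lemma cuntz_submxP n (a b : cmx A n) : cuntz_submx a b <-> cle a b.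
Proof.
have E (x : cmx A n) : mxnorm (a - cmulmx (cstarmx x) (cmulmx b x)) = nrm (x^c* *c b *c x - a).
  by rewrite nrmB -nrm_mxnorm cmulmxA.
split=> [[x hx] e e0|ab].
  move/cvgrPdist_le : hx => /(_ e e0)[N _ /(_ N (leqnn N))] /=.
  rewrite sub0r normrN => /(le_trans (ler_norm _)) h; exists (x N).
  by rewrite -E.
have h m : exists x : cmx A n, nrm (x^c* *c b *c x - a) <= m.+1%:R^-1.
  by apply: ab; rewrite invr_gt0.
have [x hx] := choice h; exists x; apply/cvgrPdist_le => e e0.
near=> m; rewrite sub0r normrN E.
rewrite ger0_norm ?nrm_ge0// (le_trans (hx m))//; apply: ltW.
by near: m; exact: near_infty_natSinv_lt (PosNum e0).
Unshelve. all: by end_near. Qed.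

Lemma mext_pad n N (a : 'M[A]_n) (nN : (n <= N)%N) :
  mext (widen_ord nN) (fun i j => a i j) (fun i j => padmx N a i j).
Proof.
split.
- by move=> i j /(congr1 val) /= ij; exact: val_inj.
- by move=> i j; rewrite mxE /= !valK.
move=> i j iN; rewrite !mxE.
rewrite (_ : insub (i : nat) = None); first by split=> //; case: insubP.
case: insubP => // k _ ki; case/negP: iN; apply/codomP; exists k.
exact: val_inj.
Qed.

Lemma cposmx_pad n N (a : 'M[A]_n) : (n <= N)%N -> cposmx a -> cposmx (padmx N a).
Proof.
move=> nN [Y ->]; exists (padmx N Y); apply/matrixP => i j.
have [winj YE Y0] := mext_pad Y nN; have [_ E E0] := mext_pad (cmulmx (cstarmx Y) Y) nN.
rewrite cmulmxE (sum_codom winj) => [|k kN]; last first.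
  by rewrite cstarmxE; have [-> _] := Y0 k i kN; rewrite cstar0 cmul0r.
have [/codomP[i' ->]|iN] := boolP (i \in codom (widen_ord nN)); last first.
  have [-> _] := E0 i j iN; rewrite big1// => k _.
  by rewrite cstarmxE; have [_ ->] := Y0 i (widen_ord nN k) iN; rewrite cstar0 cmul0r.
have [/codomP[j' ->]|jN] := boolP (j \in codom (widen_ord nN)); last first.
  have [_ ->] := E0 j (widen_ord nN i') jN; rewrite big1// => k _.
  by have [_ ->] := Y0 j (widen_ord nN k) jN; rewrite cmulr0.
by rewrite E cmulmxE; apply: eq_bigr => k _; rewrite !cstarmxE !YE.
Qed.

Definition mm a := fun i j => Moo_mx a i j.
Arguments mm : clear implicits.

Lemma cuntz_leP a b : cuntz_le a b <-> mle (mm a) (mm b).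
Proof.
rewrite /cuntz_le /= cuntz_submxP cle_mle.
rewrite (mle_extl _ (mext_pad (Moo_mx a) (leq_maxl _ _)))
  (mle_extr _ (mext_pad (Moo_mx b) (leq_maxr _ _))).
exact: iff_refl.
Qed.

Lemma cuntz_le_refl a : cuntz_le a a.
Proof. by apply/cuntz_leP/cle_mle/cle_refl/cposmxE/Moo_mxP. Qed.

Lemma cuntz_le_trans b a c : cuntz_le a b -> cuntz_le b c -> cuntz_le a c.
Proof.
move=> /cuntz_leP ab /cuntz_leP bc; apply/cuntz_leP.
pose N := (Moo_dim a + Moo_dim b + Moo_dim c)%N.
have aN : (Moo_dim a <= N)%N by rewrite /N -addnA leq_addr.
have bN : (Moo_dim b <= N)%N by rewrite /N addnAC leq_addl.
have cN : (Moo_dim c <= N)%N by rewrite /N leq_addl.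
have ea := mext_pad (Moo_mx a) aN; have eb := mext_pad (Moo_mx b) bN.
have ec := mext_pad (Moo_mx c) cN.
move: ab bc; rewrite /mm (mle_extl _ ea) (mle_extr _ eb) (mle_extl _ eb) (mle_extr _ ec).
rewrite (mle_extl _ ea) (mle_extr _ ec) -!cle_mle; exact: cle_trans.
Qed.

(** The second block may be a padded version of [u], which is what the induction on multiples
    needs. *)
Lemma mext_dsum a b (I : finType) (f : I -> 'I_(Moo_dim b)) (u : I -> I -> A) :
  mext f u (mm b) ->
  mext (fun x : 'I_(Moo_dim a) + I => unsplit (match x with inl i => inl i | inr i => inr (f i) end))
    (fun x y => match x, y with inl i, inl j => mm a i j | inr i, inr j => u i j | _, _ => 0 end)
    (mm (Moo_dsum a b)).
Proof.
move=> [finj uE u0]; split.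
- by move=> [i|i] [j|j] /(can_inj (@unsplitK _ _)) // []; [move=> ->|move=> /finj ->].
- case=> i; case=> j; rewrite /mm /=.
  + by rewrite block_mxEul.
  + by rewrite block_mxEur mxE.
  + by rewrite block_mxEdl mxE.
  + by rewrite block_mxEdr -uE.
move=> x y; rewrite /mm /=; case: (split_ordP x) => i ->{x} xf.
  by case/negP: xf; apply/codomP; exists (inl i).
have fi : i \notin codom f.
  by apply: contra xf => /codomP[j ->]; apply/codomP; exists (inr j).
case: (split_ordP y) => j ->; first by rewrite block_mxEdl block_mxEur !mxE.
by rewrite !block_mxEdr; exact: u0.
Qed.

Lemma mext_id (I : finType) (u : I -> I -> A) : mext id u u.
Proof. by split=> // i j /negP[]; apply/codomP; exists i. Qed.

Lemma mle_dsum a b a' b' : cuntz_le a a' -> cuntz_le b b' ->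
  cuntz_le (Moo_dsum a b) (Moo_dsum a' b').
Proof.
move=> /cuntz_leP ab /cuntz_leP ab'; apply/cuntz_leP.
rewrite -(mle_extl _ (mext_dsum a (mext_id (mm b)))) -(mle_extr _ (mext_dsum a' (mext_id (mm b')))).
move=> e e0; have [X hX] := ab e e0; have [Y hY] := ab' e e0.
exists (fun x y => match x, y with inl i, inl j => X i j | inr i, inr j => Y i j | _, _ => 0 end).
have z1 (I : finType) (F : I -> A) : (forall k, F k = 0) -> \sum_k F k = 0.
  by move=> F0; apply: big1 => k _.
have zl (I J : finType) (F : I + J -> A) : (forall k, F (inr k) = 0) ->
    \sum_k F k = \sum_k F (inl k).
  by move=> F0; rewrite big_sumType /= [X in _ + X]z1 ?addr0.
have zr (I J : finType) (F : I + J -> A) : (forall k, F (inl k) = 0) ->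
    \sum_k F k = \sum_k F (inr k).
  by move=> F0; rewrite big_sumType /= [X in X + _]z1 ?add0r.
case=> i; case=> j.
- rewrite zl => [|k]; last by rewrite z1// => l /=; rewrite cstar0 !cmul0r.
  under eq_bigr => k _.
    rewrite zl => [|l]; last by rewrite /= cmulr0.
    over.
  exact: hX.
- rewrite z1 ?subr0 ?nrm0 ?(ltW e0)// => -[] k; rewrite z1// => -[] l /=;
    by rewrite ?cmulr0 ?cstar0 ?cmul0r.
- rewrite z1 ?subr0 ?nrm0 ?(ltW e0)// => -[] k; rewrite z1// => -[] l /=;
    by rewrite ?cmulr0 ?cstar0 ?cmul0r.
- rewrite zr => [|k]; last by rewrite z1// => l /=; rewrite cstar0 !cmul0r.
  under eq_bigr => k _.
    rewrite zr => [|l]; last by rewrite /= cmulr0.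
    over.
  exact: hY.
Qed.

Fixpoint ksum k a := if k is k'.+1 then Moo_dsum a (ksum k' a) else Moo_zero A.

(** The recursive sum and the block matrix differ by a relabelling: block 0 goes to the left
    summand, the others to the recursive one. *)
Lemma ksum_kron k a : exists f : 'I_k * 'I_(Moo_dim a) -> 'I_(Moo_dim (ksum k a)),
  mext f (kron (mm a)) (mm (ksum k a)).
Proof.
elim: k => [|k [f hf]].
  have f : 'I_0 * 'I_(Moo_dim a) -> 'I_(Moo_dim (ksum 0 a)) by case=> -[].
  by exists f; split; case=> -[].
have [ginj gE g0] := mext_dsum a hf.
pose s (x : 'I_k.+1 * 'I_(Moo_dim a)) : 'I_(Moo_dim a) + ('I_k * 'I_(Moo_dim a)) :=
  if unlift ord0 x.1 is Some i then inr (i, x.2) else inl x.2.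
have sinj : injective s.
  move=> [i u] [j v]; rewrite /s /=.
  by case: unliftP => [i'|] ->; case: unliftP => [j'|] -> // []; [move=> -> ->|move=> ->].
set g := fun x => _ in ginj gE g0.
exists (fun x => g (s x)); split.
- exact: inj_comp.
- move=> [i u] [j v]; rewrite gE /s /kron /=.
  case: unliftP => [i'|] ->; case: unliftP => [j'|] -> //=.
move=> x y xs; apply: g0; apply: contra xs => /codomP[[u|[i u]] ->]; apply/codomP.
  by exists (ord0, u); rewrite /s /= unlift_none.
by exists (lift ord0 i, u); rewrite /s /= liftK.
Qed.

(** Monotonicity of direct sums makes the representatives chosen in [W_add] immaterial. *)
Lemma W_natmulP k a c : W_natmul k (cuntz_class a) c <-> cuntz_eq c (ksum k a).
Proof.
elim: k c => [//|k IH] c /=; split.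
  move=> [a1 [c1 [[a1a aa1] /IH[c1k kc1] [cs sc]]]]; split.
    exact: cuntz_le_trans cs (mle_dsum _ _).
  exact: cuntz_le_trans (mle_dsum _ _) sc.
move=> h; exists a, (ksum k a); split=> //; first by split; exact: cuntz_le_refl.
by apply/IH; split; exact: cuntz_le_refl.
Qed.

Lemma W_leP k l a b :
  W_le (W_natmul k (cuntz_class a)) (W_natmul l (cuntz_class b)) <->
  cuntz_le (ksum k a) (ksum l b).
Proof.
split=> [[c [d [/W_natmulP[_ ac] /W_natmulP[db _] cd]]]|ab].
  exact: cuntz_le_trans ac (cuntz_le_trans cd db).
by exists (ksum k a), (ksum l b); split=> //; apply/W_natmulP; split; exact: cuntz_le_refl.
Qed.

Lemma cuntz_class_leP a b : W_le (cuntz_class a) (cuntz_class b) <-> cuntz_le a b.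
Proof.
split=> [[c [d [[_ ac] [db _] cd]]]|ab].
  exact: cuntz_le_trans ac (cuntz_le_trans cd db).
by exists a, b; split=> //; split; exact: cuntz_le_refl.
Qed.

Lemma ksum_leP k l a b : cuntz_le (ksum k a) (ksum l b) <->
  mle (kron (K := 'I_k) (mm a)) (kron (K := 'I_l) (mm b)).
Proof.
have [f hf] := ksum_kron k a; have [g hg] := ksum_kron l b.
by rewrite cuntz_leP (mle_extl _ hf) (mle_extr _ hg).
Qed.

(** Multiples of classes are block matrices, so both sides compare k + 1 copies with k copies;
    representatives of different sizes are first padded to a common N. *)
Lemma class_W_mx : class_W A <-> forall n, almost_unperforated_at (cmx A n).
Proof.
split=> [hW n a b k /cposmxE a0 /cposmxE b0 /fle_mle ab|h].
  have := hW (cuntz_class (MkMoopos a0)) (cuntz_class (MkMoopos b0)) (imageT _ _) (imageT _ _) k.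
  rewrite W_leP ksum_leP cuntz_class_leP cuntz_leP => /(_ ab) le_ab.
  exact/cle_mle.
move=> X Y [a _ <-] [b _ <-] k; rewrite W_leP ksum_leP cuntz_class_leP cuntz_leP.
set N := maxn (Moo_dim a) (Moo_dim b).
have ea := mext_pad (Moo_mx a) (leq_maxl _ _ : (_ <= N)%N).
have eb := mext_pad (Moo_mx b) (leq_maxr _ _ : (_ <= N)%N).
rewrite (mle_extl _ (mext_kron _ ea)) (mle_extr _ (mext_kron _ eb)).
rewrite (mle_extl _ ea) (mle_extr _ eb) => ab.
apply/(@cle_mle _ _ N (padmx N (Moo_mx a)) (padmx N (Moo_mx b))).
apply: (h N _ _ k); last exact/fle_mle.
- exact/cposmxE/(cposmx_pad (leq_maxl _ _))/Moo_mxP.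
- exact/cposmxE/(cposmx_pad (leq_maxr _ _))/Moo_mxP.
Qed.

End cuntz_semigroup.

(** * The approximation of A carried to matrices, and the two cases *)

Section tracial_approximation.
Context (R : realType) (A : cstarAlgType R) (n : nat).
Local Notation D := (cmx A n).
Local Notation n2 := ((n * n)%:R : R).

Lemma cuntz_sub_cle (x s : A) : cuntz_sub x s -> cle x s.
Proof.
move=> /(@cuntz_submxP _ _ 1) h e /h[X hX]; exists (X ord0 ord0).
apply: le_trans hX; apply: le_trans (nrm_entry _ ord0 ord0).
rewrite le_eqVlt; apply/orP; left; apply/eqP; congr nrm.
rewrite [RHS]mxE [in X in _ = _ + X]mxE !cmx_mulE !cmulmxE big_ord1 cmulmxE big_ord1.
by rewrite cmx_starE cstarmxE !mxE.
Qed.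

Lemma cle_dg (x s : A) : cle x s -> cle (dg n x) (dg n s).
Proof.
move=> h e /h[y hy]; exists (dg n y).
have -> : (dg n y)^c* *c dg n s *c dg n y - dg n x = dg n (y^c* *c s *c y - x).
  by rewrite dgD !dgM dg_star; congr (_ + _); rewrite -scaleN1r -dgZ scaleN1r.
exact: le_trans (dg_nrm _ _) hy.
Qed.

Lemma entries_sub (L L' : seq D) z : {subset L <= L'} -> entries L z -> entries L' z.
Proof. by move=> LL /allpairsP[[Y [i j]] /= [/LL YL _ ->]]; exact: entriesP. Qed.

(** The approximation of A is applied to all entries of the matrices in [L], with the tolerance
    divided by n^2 + 1 because entrywise errors may grow by n^2. *)
Lemma tracial_step (L : seq D) (d : R) (s : A) :
  essentially_tracially_in (@class_W R) A -> 0 < d -> cpos s -> s != 0 ->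
  exists (x : A) (D' : cstarAlgType R) (phi : star_embedding D' D n2),
    [/\ cpos x /\ nrm x <= 1, almost_unperforated_at D', cle x s,
      forall u, u \in L -> nrm (dg n x *c u - u *c dg n x) <= d /\
         exists u' : D', nrm (phi u' - (u - dg n x *c u)) <= d &
      forall z, entries L z ->
        nrm (x *c z - z *c x) <= d /\ nrm z - d <= nrm (z - x *c z)].
Proof.
move=> hA d0 s0 sn0; pose d' := d / (n2 + 1).
have d'0 : 0 < d' by rewrite divr_gt0// ltr_wpDl.
have d'd : d' <= d by rewrite ler_pdivrMr ?ltr_wpDl// ler_peMr ?(ltW d0)// lerDr.
have n2d : n2 * d' <= d.
  by rewrite /d' mulrCA ler_piMr ?(ltW d0)// ler_pdivrMr ?mul1r ?lerDl// ltr_wpDl.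
have [x [B [[x0 x1] [BW _] hc hB /cuntz_sub_cle xs]]] := hA _ _ _ (entries_finite L) d'0 s0 sn0.
rewrite rnormE in x1.
have hc' z : entries L z -> nrm (x *c z - z *c x) <= d'.
  by move=> /hc; rewrite rnormE => /ltW.
exists x, (cmx (subalgType B) n), (subalg_mx_embedding B n); split=> //.
- by have /class_W_mx := BW; apply.
- move=> u uL; split.
    by apply: le_trans n2d; apply: (@dg_commutator _ _ _ L) => //; exact: ltW.
  have [|X hX] := @subalg_mx_near _ _ B _ (u - dg n x *c u) d' (ltW d'0).
    move=> i j; have [[z Bz hz] _] := hB _ (entriesP i j uL); exists z => //.
    rewrite rnormE in hz; suff -> : (u - dg n x *c u) i j = u i j - x *c u i j by exact: ltW.
    by rewrite [LHS]mxE [in X in _ + X]mxE dg_mull.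
  by exists X; exact: le_trans hX n2d.
- move=> z zL; split; first exact: le_trans (hc' z zL) d'd.
  have [_] := hB z zL; rewrite !rnormE; apply: le_trans.
  by rewrite lerD2l lerN2.
Qed.

Lemma simple_tracial_unperforated : simple_cstar A ->
  essentially_tracially_in (@class_W R) A -> almost_unperforated_at D.
Proof.
move=> As hA a b k a0 b0 ab; have n20 : 0 <= n2 by exact: ler0n.
have sc := czero_sqrt (@czero_id R).
have [[p hp]|nop] := pselect (exists p : D, minproj p).
  have [_ _ pn _] := hp.
  have [i [j pij]] := mx_neq0 pn.
  (* Any nonzero positive element may serve as [s] here, since the error term is controlled in
     norm. *)
  have s0 : cpos ((p i j)^c* *c p i j) by exists (p i j).
  have sn0 : (p i j)^c* *c p i j != 0 by apply: contra pij => /eqP/star_mul_eq0 ->.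
  apply: cle_closed => e e0; have e20 : 0 < e / 2 by rewrite divr_gt0.
  set w := fc a Num.sqrt.
  have [L1 [d1 [d10 h1]]] := unperforated_transfer a0 b0 n20 e20 ab.
  (* The divisor absorbs the bound |w (1 - f^4) w| <= (|w| + 1) 15 |E w|, with 15 from
     [compl4_nrm]. *)
  have wn : 0 < 15 * (nrm w + 1) by rewrite mulr_gt0// ltr_wpDl ?nrm_ge0.
  have [|L2 [d2 [d20 h2]]] := @minproj_annihilates _ _ _ As p w (e / 2 / (15 * (nrm w + 1))) hp.
    by rewrite divr_gt0.
  have [|x [D' [phi [[x0 x1] unp _ hL hE]]]] := @tracial_step (L1 ++ L2) (Num.min d1 d2) _ hA _ s0 sn0.
    by rewrite lt_min d10.
  have [m1 m2] : Num.min d1 d2 <= d1 /\ Num.min d1 d2 <= d2 by rewrite !ge_min !lexx orbT.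
  have E0 := @dg_cpos _ _ n _ x0.
  have E1 : nrm (dg n x) <= 1 by exact: le_trans (dg_nrm _ _) x1.
  have [||c [c0 cb hc]] := h1 (dg n x) D' phi E0 E1 unp.
  - by move=> u uL; have [|h _] := hL u; rewrite ?mem_cat ?uL//; exact: le_trans m1.
  - move=> u uL; have [|_ [u' h]] := hL u; first by rewrite mem_cat uL.
    by exists u'; exact: le_trans m1.
  have L2L : {subset L2 <= L1 ++ L2} by move=> u uL; rewrite mem_cat uL orbT.
  have Ew : nrm (dg n x *c w) <= e / 2 / (15 * (nrm w + 1)).
    apply: h2 => // z /(entries_sub L2L)/hE[z1 z2]; first exact: le_trans m2.
    by apply: le_trans z2; rewrite lerD2l lerN2.
  exists c => //; rewrite -/w in hc.
  have -> : c - a = (c + w *c fc (dg n x) (@compl4 R) *c w - a)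
      - w *c (fc (dg n x) (@compl4 R) *c w) by rewrite cmulA addrAC addrK.
  rewrite (splitr e); apply: le_trans (nrmD _ _) _; apply: lerD => //.
  rewrite nrmN; apply: le_trans (nrmM _ _) _.
  apply: (@le_trans _ _ ((nrm w + 1) * (15 * nrm (dg n x *c w)))).
    apply: ler_pM; rewrite ?nrm_ge0 ?lerDl//.
    exact: compl4_nrm (cpos_sa E0) E1.
  rewrite ler_pdivlMr// in Ew; apply: le_trans Ew.
  by rewrite le_eqVlt; apply/orP; left; apply/eqP; ring.
have hs (x : D) : cpos x -> x != 0 -> splittable x.
  by move=> x0 xn; apply: contrapT => /(unsplittable_minproj x0 xn).
apply: cle_closed => e e0; exists (cut e a); first exact: cut_close (ltW e0) a0.
have [//|[c [e1 [m [c0 e10 e1n cb am]]]]] := reserve (@cmx_prime _ _ n As) a0 b0 e0 hs ab.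
have [s [s0 sn0 se]] := small_diagonal As e10 e1n hs.
have a'0 : cpos (cut e a) by exact: cut_cpos (ltW e0) a0.
apply: cle_closed => h h0; set a' := cut e a in a'0 am *.
have [L [d [d0 h1]]] := unperforated_transfer a'0 c0 n20 h0 am.
have [x [D' [phi [[x0 x1] unp xs hL _]]]] := tracial_step L hA d0 s0 sn0.
have E0 := @dg_cpos _ _ n _ x0.
have E1 : nrm (dg n x) <= 1 by exact: le_trans (dg_nrm _ _) x1.
have [||b' [b'0 b'c hb']] := h1 (dg n x) D' phi E0 E1 unp.
- by move=> u /hL[].
- by move=> u /hL[].
set w := fc a' Num.sqrt in hb'.
have wsa : w^c* = w by apply: fc_sa => //; exact: cpos_sa.
(* The element below is close to a'. Its two terms, taken side by side, are below c and e1: the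
   second passes through diag(x, ..., x) and diag(s, ..., s). Finally c and e1 fit together under
   b. *)
exists (b' + w *c fc (dg n x) (@compl4 R) *c w) => //.
apply/cle_fle; apply: fle_trans (fle_split _ _ _) _ => //.
  by rewrite -{1}wsa; apply/cpos_conj/cpos_compl4.
apply: fle_trans cb; apply: fle_sum; apply/cle_fle => //.
apply: (cle_trans (cle_compl4 E0 E1 wsa)).
exact: cle_trans (cle_dg xs) se.
Qed.

End tracial_approximation.

Theorem theorem4p3 (R : realType) (A : cstarAlgType R) :
  simple_cstar A -> essentially_tracially_in (@class_W R) A -> class_W A.
Proof.
by move=> As hA; apply/class_W_mx => n; exact: simple_tracial_unperforated.
Qed.
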